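(* Let $g$ and $G$ be transcendental meromorphic functions in the plane such that $G' = g$ and either $G^{-1}$ or $g^{-1}$ has a logarithmic singularity over $\infty$. Then in each neighbourhood of this singularity the flow $\dot z = \overline{g(z)}$ has a family of pairwise disjoint trajectories $\gamma_Y$, $Y \in \mathbb{R}$, each of which tends to infinity in finite increasing time.
   Context: For a transcendental meromorphic function $h$ in the plane, $h^{-1}$ has a logarithmic singularity over $\infty$ if there exist $M>0$ and a component $U$ of $\{z \in \mathbb{C} : |h(z)|>M\}$ such that $U$ contains no poles of $h$ and $\log h$ maps $U$ conformally onto the half-plane $\{v : \mathrm{Re}\, v > \log M\}$. A neighbourhood of the singularity is a set of the form $\{z \in U : |h(z)| > M'\}$ with $M' \geq M$. A trajectory of $\dot z = \overline{g(z)}$ is a path $z(t)$ with $z'(t) = \overline{g(z(t))} \in \mathbb{C}$ for $t$ in a maximal interval $(\alpha,\beta)$; it tends to infinity in finite increasing time if $\beta<+\infty$ and $z(t)\to\infty$ as $t\to\beta^-$. *)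

(* Defs.v *)
From Stdlib Require Import Reals List.
From Coquelicot Require Import Coquelicot.
Open Scope R_scope.

(** Complex differentiability (holomorphy at a point): Coquelicot's
    [is_derive] with scalars in C_AbsRing is the complex derivative. *)
Definition is_C_deriv (f : C -> C) (z l : C) : Prop :=
  @is_derive C_AbsRing C_NormedModule f z l.

Definition ex_C_deriv (f : C -> C) (z : C) : Prop :=
  exists l : C, is_C_deriv f z l.

Definition cexp (v : C) : C :=
  (exp (Re v) * cos (Im v), exp (Re v) * sin (Im v)).

(** Meromorphic function in the plane with pole set [P]: the poles have no
    accumulation point in C, [f] is holomorphic off [P], and [|f| -> oo]
    at every pole (so each isolated singularity is a pole).  The value of
    [f] at a pole is irrelevant. *)
Definition meromorphic (f : C -> C) (P : C -> Prop) : Prop :=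
  (forall z : C, exists r : R, 0 < r /\
      forall w : C, 0 < Cmod (w - z)%C < r -> ~ P w) /\
  (forall z : C, ~ P z -> ex_C_deriv f z) /\
  (forall p : C, P p -> forall K : R, exists r : R, 0 < r /\
      forall w : C, 0 < Cmod (w - p)%C < r -> K < Cmod (f w)).

Fixpoint peval (l : list C) (z : C) : C :=
  match l with
  | nil => RtoC 0
  | c :: l' => (c + z * peval l' z)%C
  end.

Definition rational_fun (f : C -> C) (P : C -> Prop) : Prop :=
  exists a b : list C, (exists i : nat, nth i b (RtoC 0) <> RtoC 0) /\
    forall z : C, ~ P z -> (peval b z * f z)%C = peval a z.

Definition transcendental_meromorphic (f : C -> C) (P : C -> Prop) : Prop :=
  meromorphic f P /\ ~ rational_fun f P.

Definition open_set (A : C -> Prop) : Prop :=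
  forall z, A z -> exists r, 0 < r /\ forall w, Cmod (w - z)%C < r -> A w.

Definition connected_set (A : C -> Prop) : Prop :=
  forall O1 O2 : C -> Prop, open_set O1 -> open_set O2 ->
    (forall z, A z -> O1 z \/ O2 z) ->
    (exists z, A z /\ O1 z) -> (exists z, A z /\ O2 z) ->
    exists z, A z /\ O1 z /\ O2 z.

Definition component_of (U S : C -> Prop) : Prop :=
  (exists z, U z) /\ (forall z, U z -> S z) /\ connected_set U /\
  forall V : C -> Prop, connected_set V -> (forall z, U z -> V z) ->
    (forall z, V z -> S z) -> forall z, V z -> U z.

(** [h^{-1}] has a logarithmic singularity over infinity, witnessed by [M]
    and the component [U] of [{z : |h z| > M}] (poles, where [h = oo],
    belong to this set): [U] contains no poles and a branch [L] of [log h]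
    maps [U] conformally (holomorphically and bijectively) onto the
    half-plane [Re v > log M]. *)
Definition log_sing_infty (h : C -> C) (P : C -> Prop) (M : R)
    (U : C -> Prop) : Prop :=
  0 < M /\
  component_of U (fun z => P z \/ M < Cmod (h z)) /\
  (forall z, U z -> ~ P z) /\
  exists L : C -> C,
    (forall z, U z -> ex_C_deriv L z) /\
    (forall z, U z -> cexp (L z) = h z) /\
    (forall z1 z2, U z1 -> U z2 -> L z1 = L z2 -> z1 = z2) /\
    (forall z, U z -> ln M < Re (L z)) /\
    (forall v : C, ln M < Re v -> exists z, U z /\ L z = v).

Definition sing_nbhd (h : C -> C) (U : C -> Prop) (M' : R) : C -> Prop :=
  fun z => U z /\ M' < Cmod (h z).

Definition solves_on (g : C -> C) (P : C -> Prop) (z : R -> C)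
    (a b : Rbar) : Prop :=
  forall t : R, Rbar_lt a t -> Rbar_lt t b ->
    ~ P (z t) /\ is_derive z t (Cconj (g (z t))).

Definition trajectory (g : C -> C) (P : C -> Prop) (z : R -> C)
    (a b : Rbar) : Prop :=
  Rbar_lt a b /\ solves_on g P z a b /\
  forall (w : R -> C) (a' b' : Rbar),
    Rbar_le a' a -> Rbar_le b b' -> solves_on g P w a' b' ->
    (forall t : R, Rbar_lt a t -> Rbar_lt t b -> w t = z t) ->
    a' = a /\ b' = b.

Definition escapes_finite_time (z : R -> C) (a b : Rbar) : Prop :=
  exists beta : R, b = Finite beta /\
    forall K : R, exists d : R, 0 < d /\
      forall t : R, Rbar_lt a t -> beta - d < t < beta -> K < Cmod (z t).

(* Main.v *)
(** The flow is [z' = conj g], so along a trajectory [d/dt G(z) = |g|^2]: [Im G] is constant and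
    trajectories with different values of [Im G] are disjoint.

    Let [L : U -> {Re v > ln M}] be the branch of [log h] and [E = g / L'], that is, [E = h] if
    [h = G] and [E = h / L'] if [h = g].  In the coordinate [v = L z] the flow is
    [v' = |L'|^2 conj E].  The inverse [phi] of [L] is univalent on a half-plane, and a Koebe-type
    distortion estimate [|phi''| <= const |phi'| / (Re v - ln M)] shows that far to the right
    [dE/dv] is close to [E] and [L'] varies slowly.  Hence, once [E] lies in the cone
    [|Im E| <= Re E / 2], it stays there, [Re v] increases, and [s = d(Re v)/dt = |L'|^2 Re E]
    satisfies [s' >= s^2 / 4]; such an [s] lives for finite time only.  The maximal trajectory stays
    in a closed set on which [g] has neither zeros nor poles, so it must tend to infinity. *)

Require Import Defs.
From Stdlib Require Import Reals Ranalysis5 Lra Lia Classical ClassicalEpsilon.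
From Coquelicot Require Import Coquelicot.
Open Scope R_scope.

(** * Complex derivatives *)

(** The distortion estimate is wanted only up to an absolute constant, because the constant merely
    decides how far to the right the argument starts. Two facts yield it: on a disc of radius [R]
    about [c] a univalent [f] without zeros satisfies [|f' c| * R <= const * |f c|], and on the
    largest disc about [v] inside the half-plane [phi] omits a value at distance comparable to
    [|phi' v| * (Re v - ln M)] from [phi v]. The function [E] makes the two cases alike. If [h = G],
    then [dE/dv = E] exactly; if [h = g], the relative error is [|L''| / |L'|^2], which the
    distortion estimate bounds. The speed [s] carries the factor [|L'|^2], so time in the original
    plane is controlled although nothing is known about the size of [L']. The set [Re L >= u2] must
    be closed in the plane and not just in [U]. This holds because [|h| = exp (Re L)]: limit points
    lie in the superlevel set again, hence in the component. The cone condition is open, so starting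
    points fill a disc, [G] maps them onto a neighbourhood of a point, and [Im G] takes a whole
    interval of values, one for each [Y]. *)

Lemma Cmod_sub_sym (a b : C) : Cmod (a - b) = Cmod (b - a).
Proof. rewrite <- Cmod_opp. f_equal. ring. Qed.

Lemma Cmod_sub_trans (a b c : C) : Cmod (a - c) <= Cmod (a - b) + Cmod (b - c).
Proof. replace (a - c)%C with ((a - b) + (b - c))%C by ring. apply Cmod_triangle. Qed.

Lemma Cmod_triangle_rev (a b : C) : Cmod a - Cmod b <= Cmod (a - b).
Proof.
  generalize (Cmod_triangle (a - b)%C b).
  replace (a - b + b)%C with a by ring. lra.
Qed.

Lemma Cmod_sub_eq_0 (a : C) : Cmod (a - a) = 0.
Proof. replace (a - a)%C with (RtoC 0) by ring. apply Cmod_0. Qed.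

Lemma Cmod_sub_le_0 (a b : C) : Cmod (a - b) <= 0 -> a = b.
Proof.
  intro H. assert (E : (a - b)%C = 0%C)
    by (apply Cmod_eq_0; generalize (Cmod_ge_0 (a - b)); lra).
  replace a with ((a - b) + b)%C by ring. rewrite E. ring.
Qed.

Lemma im_le_Cmod (c : C) : Rabs (Im c) <= Cmod c.
Proof. eapply Rle_trans; [apply Rmax_r | apply (Rmax_Cmod c)]. Qed.

Lemma Cmod_le_Re_Im (c : C) : Cmod c <= Rabs (Re c) + Rabs (Im c).
Proof.
  apply Rsqr_incr_0_var.
  - unfold Rsqr. generalize (Cmod2_alt c) (Rabs_pos (Re c)) (Rabs_pos (Im c)).
    generalize (Rsqr_abs (Re c)) (Rsqr_abs (Im c)). unfold Rsqr. nra.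
  - generalize (Rabs_pos (Re c)) (Rabs_pos (Im c)). lra.
Qed.

Lemma C_eq_Re_Im (a b : C) : Re a = Re b -> Im a = Im b -> a = b.
Proof. destruct a, b. simpl. intros -> ->. reflexivity. Qed.

Lemma Rlt_Rmin (x a b : R) : x < Rmin a b -> x < a /\ x < b.
Proof. intros H. split; eapply Rlt_le_trans; [exact H|apply Rmin_l|exact H|apply Rmin_r]. Qed.

Definition near (p : C) (Q : C -> Prop) : Prop :=
  exists d, 0 < d /\ forall w, Cmod (w - p) < d -> Q w.

Lemma near_and (p : C) (Q1 Q2 : C -> Prop) : near p Q1 -> near p Q2 -> near p (fun w => Q1 w /\ Q2 w).
Proof.
  intros [d1 [H1 B1]] [d2 [H2 B2]]. exists (Rmin d1 d2). split; [now apply Rmin_glb_lt|].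
  intros w Hw. apply Rlt_Rmin in Hw. split; [now apply B1|now apply B2].
Qed.

Definition ccont (f : C -> C) (z : C) : Prop :=
  forall e, 0 < e -> exists d, 0 < d /\
    forall w, Cmod (w - z) < d -> Cmod (f w - f z) < e.

(** There is no quotient and the bound is non-strict, so the condition is harmless at [w = z]. *)
Definition cdiff (f : C -> C) (z l : C) : Prop :=
  forall e, 0 < e -> exists d, 0 < d /\
    forall w, Cmod (w - z) < d -> Cmod (f w - f z - l * (w - z)) <= e * Cmod (w - z).

Lemma is_C_deriv_cdiff (f : C -> C) (z l : C) : is_C_deriv f z l <-> cdiff f z l.
Proof.
  split.
  - intros [_ H] e He.
    specialize (H z (fun P HP => HP) (mkposreal e He)).
    destruct H as [d Hd]. exists d. split; [apply cond_pos |].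
    intros w Hw. specialize (Hd w Hw). simpl in Hd.
    change (Cmod (f w - f z - (w - z) * l) <= e * Cmod (w - z)) in Hd.
    rewrite (Cmult_comm l). exact Hd.
  - intros H. split; [apply is_linear_scal_l |].
    intros x Hx. rewrite <- (is_filter_lim_locally_unique _ _ Hx).
    intro e. destruct (H e (cond_pos e)) as [d [Hd Hb]].
    exists (mkposreal d Hd). intros w Hw. specialize (Hb w Hw).
    rewrite (Cmult_comm l) in Hb. exact Hb.
Qed.

(** Two normed-module structures on [C] carry the same derivative; over this one the generic product
    and chain rules apply. *)
Lemma cdiff_derive (f : C -> C) (z l : C) :
  cdiff f z l <-> @is_derive C_AbsRing (AbsRing_NormedModule C_AbsRing) f z l.
Proof.
  rewrite <- is_C_deriv_cdiff. split; intros [_ H]; (split; [apply is_linear_scal_l|exact H]).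
Qed.

Lemma cdiff_unique (f : C -> C) (z l1 l2 : C) :
  cdiff f z l1 -> cdiff f z l2 -> l1 = l2.
Proof.
  intros H1 H2. apply Cmod_sub_le_0. apply Rnot_lt_le. intro Hp.
  destruct (H1 (Cmod (l1 - l2) / 4)) as [d1 [Hd1 B1]]; [lra |].
  destruct (H2 (Cmod (l1 - l2) / 4)) as [d2 [Hd2 B2]]; [lra |].
  (* A single real increment compares the linear parts: each remainder is at most a quarter of
     [|l1 - l2| * d]. *)
  set (d := Rmin d1 d2 / 2).
  assert (Hd : 0 < d) by (unfold d; generalize (Rmin_glb_lt _ _ _ Hd1 Hd2); lra).
  assert (E : (z + d - z)%C = RtoC d) by ring.
  assert (Ed : Cmod (z + d - z) = d) by (rewrite E, Cmod_R; apply Rabs_pos_eq; lra).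
  assert (L1 := Rmin_l d1 d2). assert (L2 := Rmin_r d1 d2).
  specialize (B1 (z + d)%C). specialize (B2 (z + d)%C).
  rewrite Ed in B1, B2. rewrite E in B1, B2.
  specialize (B1 ltac:(unfold d; lra)). specialize (B2 ltac:(unfold d; lra)).
  assert (T := Cmod_sub_trans (l1 * d)%C (f (z + d)%C - f z)%C (l2 * d)%C).
  rewrite (Cmod_sub_sym (l1 * d)%C (f (z + d)%C - f z)%C) in T.
  replace (l1 * d - l2 * d)%C with ((l1 - l2) * d)%C in T by ring.
  rewrite Cmod_mult, Cmod_R, (Rabs_pos_eq d) in T by lra. nra.
Qed.

Lemma cdiff_ext_loc (f g : C -> C) (z l : C) (r : R) : 0 < r ->
  (forall w, Cmod (w - z) < r -> f w = g w) -> cdiff f z l -> cdiff g z l.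
Proof.
  intros Hr E H e He. destruct (H e He) as [d [Hd B]].
  exists (Rmin d r). split; [now apply Rmin_glb_lt |].
  intros w Hw.
  apply Rlt_Rmin in Hw. destruct Hw as [Hw Hr'].
  rewrite <- !E; auto. now rewrite Cmod_sub_eq_0.
Qed.

Lemma ccont_ext_loc (f g : C -> C) (z : C) (r : R) : 0 < r ->
  (forall w, Cmod (w - z) < r -> f w = g w) -> ccont f z -> ccont g z.
Proof.
  intros Hr E H e He. destruct (H e He) as [d [Hd B]].
  exists (Rmin d r). split; [now apply Rmin_glb_lt |].
  intros w Hw.
  apply Rlt_Rmin in Hw. destruct Hw as [Hw Hr'].
  rewrite <- !E; auto. now rewrite Cmod_sub_eq_0.
Qed.

Lemma cdiff_const (c z : C) : cdiff (fun _ => c) z 0.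
Proof. apply cdiff_derive. apply (is_derive_const (V := AbsRing_NormedModule C_AbsRing)). Qed.

Lemma cdiff_id (z : C) : cdiff (fun w => w) z 1.
Proof. apply cdiff_derive. apply (is_derive_id (K := C_AbsRing)). Qed.

Lemma cdiff_plus (f g : C -> C) (z a b : C) :
  cdiff f z a -> cdiff g z b -> cdiff (fun w => f w + g w)%C z (a + b)%C.
Proof. rewrite !cdiff_derive. intros. now apply (is_derive_plus (V := AbsRing_NormedModule C_AbsRing)). Qed.

Lemma cdiff_minus (f g : C -> C) (z a b : C) :
  cdiff f z a -> cdiff g z b -> cdiff (fun w => f w - g w)%C z (a - b)%C.
Proof. rewrite !cdiff_derive. intros. now apply (is_derive_minus (V := AbsRing_NormedModule C_AbsRing)). Qed.

Lemma cdiff_mult (f g : C -> C) (z a b : C) :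
  cdiff f z a -> cdiff g z b -> cdiff (fun w => f w * g w)%C z (a * g z + f z * b)%C.
Proof. rewrite !cdiff_derive. intros. apply (is_derive_mult (K := C_AbsRing)); auto. exact Cmult_comm. Qed.

Lemma cdiff_cscal (c : C) (f : C -> C) (z a : C) :
  cdiff f z a -> cdiff (fun w => c * f w)%C z (c * a)%C.
Proof.
  intros H. replace (c * a)%C with (0 * f z + c * a)%C by ring.
  apply (cdiff_mult (fun _ => c) f); auto. apply cdiff_const.
Qed.

Lemma cdiff_comp (f g : C -> C) (z a b : C) :
  cdiff f (g z) a -> cdiff g z b -> cdiff (fun w => f (g w)) z (b * a)%C.
Proof. rewrite !cdiff_derive. intros. now apply (is_derive_comp (K := C_AbsRing) (V := AbsRing_NormedModule C_AbsRing)). Qed.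

Lemma cdiff_lipschitz (f : C -> C) (z l : C) : cdiff f z l ->
  exists d, 0 < d /\ forall w, Cmod (w - z) < d -> Cmod (f w - f z) <= (Cmod l + 1) * Cmod (w - z).
Proof.
  intros H. destruct (H 1 Rlt_0_1) as [d [Hd B]]. exists d. split; auto.
  intros w Hw. specialize (B w Hw).
  assert (T := Cmod_triangle (f w - f z - l * (w - z))%C (l * (w - z))%C).
  replace (f w - f z - l * (w - z) + l * (w - z))%C with (f w - f z)%C in T by ring.
  rewrite Cmod_mult in T. lra.
Qed.

Lemma cdiff_cont (f : C -> C) (z l : C) : cdiff f z l -> ccont f z.
Proof.
  intros H e He. destruct (cdiff_lipschitz f z l H) as [d [Hd B]].
  assert (Hl := Cmod_ge_0 l).
  exists (Rmin d (e / (Cmod l + 1))). split.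
  - apply Rmin_glb_lt; auto. apply Rdiv_lt_0_compat; lra.
  - intros w Hw.
    destruct (Rlt_Rmin _ _ _ Hw) as [H1 H2].
    specialize (B w H1). apply (Rmult_lt_compat_l (Cmod l + 1)) in H2; [|lra].
    replace ((Cmod l + 1) * (e / (Cmod l + 1))) with e in H2 by (field; lra). lra.
Qed.

Lemma cdiff_Cinv (z : C) : z <> 0%C -> cdiff Cinv z (- (/ z * / z))%C.
Proof.
  intros Hz e He. assert (P := proj1 (Cmod_gt_0 z) Hz). set (m := Cmod z) in *.
  (* Within [m / 2] of [z] one has [|w| >= m / 2], so the remainder [(w - z)^2 / (z^2 w)] is at most
     [2 / m^3 * |w - z|^2]; the second radius absorbs this factor. *)
  exists (Rmin (m / 2) (e * m * m * m / 2)). split.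
  - apply Rmin_glb_lt; [lra |]. assert (0 < e * m * m * m) by (repeat apply Rmult_lt_0_compat; lra). lra.
  - intros w Hw.
    destruct (Rlt_Rmin _ _ _ Hw) as [H1 H2].
    assert (T := Cmod_triangle_rev z (z - w)%C). rewrite (Cmod_sub_sym z w) in T.
    replace (z - (z - w))%C with w in T by ring. fold m in T.
    assert (Hw0 : w <> 0%C) by (apply Cmod_gt_0; lra).
    replace (/ w - / z - - (/ z * / z) * (w - z))%C
      with ((w - z) * (w - z) * (/ z * / z * / w))%C by (field; auto).
    rewrite !Cmod_mult, !Cmod_inv by auto. fold m.
    assert (Hi : / Cmod w <= 2 / m).
    { unfold Rdiv. rewrite <- (Rinv_inv 2), <- Rinv_mult. apply Rinv_le_contravar; lra. }
    assert (Hc := Cmod_ge_0 (w - z)).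
    assert (K : Cmod (w - z) * (/ m * / m * / Cmod w) <= e).
    { apply Rle_trans with (e * m * m * m / 2 * (/ m * / m * (2 / m))).
      - assert (0 < / m) by (apply Rinv_0_lt_compat; lra).
        assert (0 < / Cmod w) by (apply Rinv_0_lt_compat; lra).
        apply Rmult_le_compat; try lra.
        + repeat apply Rmult_le_pos; lra.
        + apply Rmult_le_compat_l; auto. apply Rmult_le_pos; lra.
      - right. field. lra. }
    rewrite Rmult_assoc, (Rmult_comm e). apply Rmult_le_compat_l; lra.
Qed.

Lemma cdiff_inv (f : C -> C) (z a : C) : f z <> 0%C ->
  cdiff f z a -> cdiff (fun w => / f w)%C z (- (a * (/ f z * / f z)))%C.
Proof.
  intros Hz H. replace (- (a * (/ f z * / f z)))%C with (a * - (/ f z * / f z))%C by ring.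
  apply (cdiff_comp Cinv f); auto. now apply cdiff_Cinv.
Qed.

Lemma ccont_const (c z : C) : ccont (fun _ => c) z.
Proof. eapply cdiff_cont, cdiff_const. Qed.

Lemma ccont_plus (f g : C -> C) (z : C) :
  ccont f z -> ccont g z -> ccont (fun w => f w + g w)%C z.
Proof.
  intros Hf Hg e He. destruct (Hf (e / 2)) as [d1 [Hd1 B1]]; [lra|].
  destruct (Hg (e / 2)) as [d2 [Hd2 B2]]; [lra|].
  exists (Rmin d1 d2). split; [now apply Rmin_glb_lt|]. intros w Hw.
  apply Rlt_Rmin in Hw. specialize (B1 w (proj1 Hw)). specialize (B2 w (proj2 Hw)).
  replace (f w + g w - (f z + g z))%C with ((f w - f z) + (g w - g z))%C by ring.
  eapply Rle_lt_trans; [apply Cmod_triangle | lra].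
Qed.

Lemma ccont_comp (f g : C -> C) (z : C) :
  ccont f (g z) -> ccont g z -> ccont (fun w => f (g w)) z.
Proof.
  intros Hf Hg e He. destruct (Hf e He) as [d1 [Hd1 B1]].
  destruct (Hg d1 Hd1) as [d2 [Hd2 B2]].
  exists d2. split; auto.
Qed.

Lemma ccont_loc_bound (f : C -> C) (z : C) : ccont f z ->
  exists d, 0 < d /\ forall w, Cmod (w - z) < d -> Cmod (f w) <= Cmod (f z) + 1.
Proof.
  intros H. destruct (H 1 Rlt_0_1) as [d [Hd B]]. exists d. split; auto.
  intros w Hw. specialize (B w Hw). generalize (Cmod_triangle_rev (f w) (f z)). lra.
Qed.

Lemma ccont_mult (f g : C -> C) (z : C) :
  ccont f z -> ccont g z -> ccont (fun w => f w * g w)%C z.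
Proof.
  intros Hf Hg e He.
  destruct (ccont_loc_bound g z Hg) as [d0 [Hd0 B0]].
  assert (P1 := Cmod_ge_0 (f z)). assert (P2 := Cmod_ge_0 (g z)).
  destruct (Hf (e / 2 / (Cmod (g z) + 1))) as [d1 [Hd1 B1]]; [apply Rdiv_lt_0_compat; lra|].
  destruct (Hg (e / 2 / (Cmod (f z) + 1))) as [d2 [Hd2 B2]]; [apply Rdiv_lt_0_compat; lra|].
  exists (Rmin d0 (Rmin d1 d2)). split; [repeat apply Rmin_glb_lt; auto|]. intros w Hw.
  apply Rlt_Rmin in Hw. destruct Hw as [H0 Hw]. apply Rlt_Rmin in Hw. destruct Hw as [H1 H2].
  specialize (B0 w H0). specialize (B1 w H1). specialize (B2 w H2).
  replace (f w * g w - f z * g z)%C with ((f w - f z) * g w + f z * (g w - g z))%C by ring.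
  eapply Rle_lt_trans; [apply Cmod_triangle|]. rewrite !Cmod_mult.
  apply Rlt_div_r in B1; [|lra]. apply Rlt_div_r in B2; [|lra].
  assert (P3 := Cmod_ge_0 (f w - f z)). assert (P4 := Cmod_ge_0 (g w - g z)).
  assert (P5 := Cmod_ge_0 (g w)). nra.
Qed.

Lemma ccont_opp (f : C -> C) (z : C) : ccont f z -> ccont (fun w => - f w)%C z.
Proof.
  intros H e He. destruct (H e He) as [d [Hd B]]. exists d. split; auto.
  intros w Hw. replace (- f w - - f z)%C with (- (f w - f z))%C by ring.
  rewrite Cmod_opp. auto.
Qed.

Lemma ccont_minus (f g : C -> C) (z : C) :
  ccont f z -> ccont g z -> ccont (fun w => f w - g w)%C z.
Proof. intros. apply ccont_plus; auto. now apply ccont_opp. Qed.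

Lemma ccont_inv (f : C -> C) (z : C) : f z <> 0%C -> ccont f z -> ccont (fun w => / f w)%C z.
Proof.
  intros Hz H. apply (ccont_comp Cinv f); auto. eapply cdiff_cont, cdiff_Cinv, Hz.
Qed.

Lemma ccont_RtoC_Cmod (f : C -> C) (z : C) : ccont f z -> ccont (fun w => RtoC (Cmod (f w))) z.
Proof.
  intros H e He. destruct (H e He) as [d [Hd B]]. exists d. split; auto.
  intros w Hw. specialize (B w Hw).
  rewrite <- RtoC_minus, Cmod_R. apply Rabs_def1.
  - generalize (Cmod_triangle_rev (f w) (f z)). lra.
  - generalize (Cmod_triangle_rev (f z) (f w)). rewrite Cmod_sub_sym. lra.
Qed.

(** * Curves and mean value inequalities *)

(** Coordinatewise, so that real-variable rules apply to [Re] and [Im]; [rdiff_eps] recovers the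
    form with [Cmod]. *)
Definition rdiff (z : R -> C) (t : R) (d : C) : Prop :=
  is_derive (fun s => Re (z s)) t (Re d) /\ is_derive (fun s => Im (z s)) t (Im d).

Lemma is_derive_eps (f : R -> R) (t l : R) : is_derive f t l <->
  forall e, 0 < e -> exists d, 0 < d /\
    forall s, Rabs (s - t) < d -> Rabs (f s - f t - (s - t) * l) <= e * Rabs (s - t).
Proof.
  split.
  - intros [_ H] e He.
    specialize (H t (fun P HP => HP) (mkposreal e He)).
    destruct H as [d Hd]. exists d. split; [apply cond_pos |].
    intros w Hw. exact (Hd w Hw).
  - intros H. split; [apply is_linear_scal_l |].
    intros x Hx. rewrite <- (is_filter_lim_locally_unique _ _ Hx).
    intro e. destruct (H e (cond_pos e)) as [d [Hd Hb]].
    exists (mkposreal d Hd). intros w Hw. exact (Hb w Hw).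
Qed.

Lemma rdiff_eps (z : R -> C) (t : R) (d : C) : rdiff z t d <->
  forall e, 0 < e -> exists r, 0 < r /\
    forall s, Rabs (s - t) < r -> Cmod (z s - z t - RtoC (s - t) * d) <= e * Rabs (s - t).
Proof.
  unfold rdiff. rewrite !is_derive_eps. split.
  - intros [H1 H2] e He.
    destruct (H1 (e / 2)) as [r1 [Hr1 B1]]; [lra|].
    destruct (H2 (e / 2)) as [r2 [Hr2 B2]]; [lra|].
    exists (Rmin r1 r2). split; [now apply Rmin_glb_lt|]. intros s Hs.
    specialize (B1 s (Rlt_le_trans _ _ _ Hs (Rmin_l _ _))).
    specialize (B2 s (Rlt_le_trans _ _ _ Hs (Rmin_r _ _))).
    eapply Rle_trans; [apply Cmod_le_Re_Im|].
    destruct (z s), (z t), d. simpl in *.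
    replace (r + - r3 + - ((s - t) * r5 - 0 * r6)) with (r - r3 - (s - t) * r5) by ring.
    replace (r0 + - r4 + - ((s - t) * r6 + 0 * r5)) with (r0 - r4 - (s - t) * r6) by ring. lra.
  - intros H. split; intros e He; destruct (H e He) as [r [Hr B]];
      exists r; (split; [auto|]); intros s Hs; specialize (B s Hs);
      (eapply Rle_trans; [|apply B]).
    + eapply Rle_trans; [|apply re_le_Cmod]. right. f_equal.
      destruct (z s), (z t), d. simpl. ring.
    + eapply Rle_trans; [|apply im_le_Cmod]. right. f_equal.
      destruct (z s), (z t), d. simpl. ring.
Qed.

Lemma rdiff_is_derive (z : R -> C) (t : R) (d : C) : rdiff z t d <-> is_derive z t d.
Proof.
  rewrite rdiff_eps. split.
  - intros H. split; [apply is_linear_scal_l |].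
    intros x Hx. rewrite <- (is_filter_lim_locally_unique _ _ Hx).
    intro e. destruct (H e (cond_pos e)) as [r [Hr Hb]].
    exists (mkposreal r Hr). intros w Hw. specialize (Hb w Hw).
    refine (Rle_trans _ _ _ _ Hb). right. rewrite Cmod_norm. f_equal.
    destruct (z w), (z t), d. apply injective_projections; simpl; unfold minus, plus, opp, scal; simpl;
      unfold mult; simpl; ring.
  - intros [_ H] e He.
    specialize (H t (fun P HP => HP) (mkposreal e He)).
    destruct H as [r Hr]. exists r. split; [apply cond_pos |].
    intros w Hw. specialize (Hr w Hw).
    refine (Rle_trans _ _ _ _ Hr). right. rewrite Cmod_norm. f_equal.
    destruct (z w), (z t), d. apply injective_projections; simpl; unfold minus, plus, opp, scal; simpl;
      unfold mult; simpl; ring.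
Qed.

Lemma rdiff_line (a b : C) (t : R) : rdiff (fun s => a + s * b)%C t b.
Proof.
  split; destruct a, b; simpl; auto_derive; auto; ring.
Qed.

Lemma rdiff_minus (z w : R -> C) (t : R) (a b : C) :
  rdiff z t a -> rdiff w t b -> rdiff (fun s => z s - w s)%C t (a - b)%C.
Proof.
  intros [X1 X2] [Y1 Y2]. split.
  - apply (is_derive_minus (fun s => Re (z s)) (fun s => Re (w s))); auto.
  - apply (is_derive_minus (fun s => Im (z s)) (fun s => Im (w s))); auto.
Qed.

Lemma rdiff_lipschitz (z : R -> C) (t : R) (d : C) : rdiff z t d ->
  exists r, 0 < r /\ forall s, Rabs (s - t) < r -> Cmod (z s - z t) <= (Cmod d + 1) * Rabs (s - t).
Proof.
  rewrite rdiff_eps. intros H. destruct (H 1 Rlt_0_1) as [r [Hr B]]. exists r. split; auto.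
  intros s Hs. specialize (B s Hs).
  assert (T := Cmod_triangle (z s - z t - RtoC (s - t) * d)%C (RtoC (s - t) * d)%C).
  replace (z s - z t - RtoC (s - t) * d + RtoC (s - t) * d)%C with (z s - z t)%C in T by ring.
  rewrite Cmod_mult, Cmod_R in T. lra.
Qed.

Definition rcont (z : R -> C) (t : R) : Prop :=
  forall e, 0 < e -> exists r, 0 < r /\ forall s, Rabs (s - t) < r -> Cmod (z s - z t) < e.

Lemma rdiff_cont (z : R -> C) (t : R) (d : C) : rdiff z t d -> rcont z t.
Proof.
  intros H e He. destruct (rdiff_lipschitz z t d H) as [r [Hr B]].
  assert (Hl := Cmod_ge_0 d).
  exists (Rmin r (e / (Cmod d + 1))). split.
  - apply Rmin_glb_lt; auto. apply Rdiv_lt_0_compat; lra.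
  - intros w Hw.
    specialize (B w (Rlt_le_trans _ _ _ Hw (Rmin_l _ _))).
    assert (H2 := Rlt_le_trans _ _ _ Hw (Rmin_r _ _)).
    apply Rlt_div_r in H2; lra.
Qed.

Lemma ccont_rcont (f : C -> C) (z : R -> C) (t : R) :
  ccont f (z t) -> rcont z t -> rcont (fun s => f (z s)) t.
Proof.
  intros Hf Hg e He. destruct (Hf e He) as [d1 [Hd1 B1]].
  destruct (Hg d1 Hd1) as [d2 [Hd2 B2]]. exists d2. split; auto.
Qed.

Lemma cdiff_rdiff (f : C -> C) (z : R -> C) (t : R) (l d : C) :
  cdiff f (z t) l -> rdiff z t d -> rdiff (fun s => f (z s)) t (l * d)%C.
Proof.
  intros Hf Hz. destruct (rdiff_lipschitz z t d Hz) as [r1 [Hr1 B1]].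
  assert (Hc := rdiff_cont z t d Hz). rewrite rdiff_eps in *.
  intros e He. assert (Pd := Cmod_ge_0 d). assert (Pl := Cmod_ge_0 l).
  destruct (Hf (e / 2 / (Cmod d + 1))) as [r2 [Hr2 B2]]; [apply Rdiv_lt_0_compat; lra|].
  destruct (Hc r2 Hr2) as [r3 [Hr3 B3]].
  destruct (Hz (e / 2 / (Cmod l + 1))) as [r4 [Hr4 B4]]; [apply Rdiv_lt_0_compat; lra|].
  exists (Rmin r1 (Rmin r3 r4)). split; [repeat apply Rmin_glb_lt; auto|]. intros s Hs.
  specialize (B1 s (Rlt_le_trans _ _ _ Hs (Rmin_l _ _))).
  assert (Hs' := Rlt_le_trans _ _ _ Hs (Rmin_r _ _)).
  specialize (B2 (z s) (B3 s (Rlt_le_trans _ _ _ Hs' (Rmin_l _ _)))).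
  specialize (B4 s (Rlt_le_trans _ _ _ Hs' (Rmin_r _ _))).
  replace (f (z s) - f (z t) - RtoC (s - t) * (l * d))%C
    with ((f (z s) - f (z t) - l * (z s - z t)) + l * (z s - z t - RtoC (s - t) * d))%C by ring.
  eapply Rle_trans; [apply Cmod_triangle|]. rewrite (Cmod_mult l).
  assert (P := Rabs_pos (s - t)).
  assert (K1 : e / 2 / (Cmod d + 1) * Cmod (z s - z t) <= e / 2 * Rabs (s - t)).
  { apply Rle_trans with (e / 2 / (Cmod d + 1) * ((Cmod d + 1) * Rabs (s - t))).
    - apply Rmult_le_compat_l; auto. apply Rlt_le, Rdiv_lt_0_compat; lra.
    - right. field. lra. }
  assert (K2 : Cmod l * (e / 2 / (Cmod l + 1) * Rabs (s - t)) <= e / 2 * Rabs (s - t)).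
  { replace (e / 2 * Rabs (s - t)) with ((Cmod l + 1) * (e / 2 / (Cmod l + 1) * Rabs (s - t))) by (field; lra).
    apply Rmult_le_compat_r; [|lra]. apply Rmult_le_pos; auto. apply Rlt_le, Rdiv_lt_0_compat; lra. }
  assert (K3 := Rmult_le_compat_l _ _ _ Pl B4). lra.
Qed.

Lemma rdiff_ext_loc (z w : R -> C) (t : R) (d : C) (r : R) : 0 < r ->
  (forall s, Rabs (s - t) < r -> z s = w s) -> rdiff z t d -> rdiff w t d.
Proof.
  rewrite !rdiff_eps. intros Hr E H e He. destruct (H e He) as [q [Hq B]].
  exists (Rmin q r). split; [now apply Rmin_glb_lt|]. intros s Hs.
  rewrite <- !E. 2: { unfold Rminus; rewrite Rplus_opp_r, Rabs_R0; lra. }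
  2: { eapply Rlt_le_trans; [apply Hs | apply Rmin_r]. }
  apply B. eapply Rlt_le_trans; [apply Hs | apply Rmin_l].
Qed.

(** Continuous induction by a supremum. At [s = a] the premise of the first hypothesis is empty, so
    that hypothesis also gives the base case. *)
Lemma real_induction (Q : R -> Prop) (a b : R) :
  (forall s, a <= s <= b -> (forall u, a <= u < s -> Q u) -> Q s) ->
  (forall s, a <= s < b -> (forall u, a <= u <= s -> Q u) ->
     exists d, 0 < d /\ forall u, s < u < s + d -> u <= b -> Q u) ->
  forall s, a <= s <= b -> Q s.
Proof.
  intros Hc Ho.
  assert (Hab : a <= b -> forall u, a <= u <= b -> Q u); [intros ab | intros s Hs; apply Hab; lra].
  set (E := fun s => a <= s <= b /\ forall u, a <= u <= s -> Q u).
  assert (Ea : E a).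
  { split; [lra|]. intros u Hu. apply Hc; [lra|]. intros; lra. }
  destruct (completeness E) as [s [Hs1 Hs2]].
  { exists b. intros x [Hx _]. lra. }
  { now exists a. }
  assert (Hs : a <= s <= b).
  { split; [now apply Hs1|]. apply Hs2. intros x [Hx _]. lra. }
  assert (Hlt : forall u, a <= u < s -> Q u).
  { intros u Hu. apply NNPP. intro N. assert (s <= u); [|lra]. apply Hs2.
    intros x [Hx Ex]. apply Rnot_lt_le. intro. apply N, Ex. lra. }
  assert (Hle : forall u, a <= u <= s -> Q u).
  { intros u Hu. apply Hc; [lra|]. intros w Hw. apply Hlt. lra. }
  destruct (Req_dec s b) as [e|e]; [now subst|]. exfalso.
  destruct (Ho s ltac:(lra) Hle) as [d [Hd B]].
  assert (T1 := Rmin_l (s + d / 2) b). assert (T2 := Rmin_r (s + d / 2) b).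
  assert (T3 : s < Rmin (s + d / 2) b) by (apply Rmin_glb_lt; lra).
  assert (Rmin (s + d / 2) b <= s); [|lra]. apply Hs1. split; [lra|]. intros u Hu.
  destruct (Rle_lt_dec u s); [apply Hle; lra|apply B; lra].
Qed.

Lemma real_increasing (f df : R -> R) (a b : R) : a <= b ->
  (forall t, a <= t <= b -> is_derive f t (df t)) ->
  (forall t, a <= t <= b -> 0 <= df t) -> f a <= f b.
Proof.
  intros Hab Hd Hp.
  destruct (MVT_gen f a b df) as [c [Hc E]].
  - intros x Hx. rewrite Rmin_left, Rmax_right in Hx by lra. apply Hd. lra.
  - intros x Hx. rewrite Rmin_left, Rmax_right in Hx by lra.
    apply continuity_pt_filterlim. apply (ex_derive_continuous f x). exists (df x). now apply Hd.
  - rewrite Rmin_left, Rmax_right in Hc by lra. specialize (Hp c Hc). nra.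
Qed.

Lemma Re_conj_mult_le (a b : C) : Re a * Re b + Im a * Im b <= Cmod a * Cmod b.
Proof.
  assert (H := re_le_Cmod (Cconj a * b)%C). rewrite Cmod_mult, Cmod_conj in H.
  replace (Re (Cconj a * b)%C) with (Re a * Re b + Im a * Im b) in H by (destruct a, b; simpl; ring).
  generalize (Rle_abs (Re a * Re b + Im a * Im b)). lra.
Qed.

Lemma Cmod_sqr (a : C) : Cmod a * Cmod a = Re a * Re a + Im a * Im a.
Proof. generalize (Cmod2_alt a). simpl. lra. Qed.

(** Projecting the curve onto the chord [e] gives a real function whose derivative is at most
    [|e| * K]; dividing by [|e|] leaves the case [e = 0] apart. *)
Lemma curve_mean_value (z z' : R -> C) (a b K : R) : a <= b ->
  (forall t, a <= t <= b -> rdiff z t (z' t)) ->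
  (forall t, a <= t <= b -> Cmod (z' t) <= K) ->
  Cmod (z b - z a) <= K * (b - a).
Proof.
  intros Hab Hd HK. set (e := (z b - z a)%C).
  assert (He := Cmod_ge_0 e).
  assert (H : Cmod e * Cmod e <= Cmod e * K * (b - a)).
  { assert (I := real_increasing
      (fun t => Cmod e * K * t - (Re e * Re (z t) + Im e * Im (z t)))
      (fun t => Cmod e * K * 1 - (Re e * Re (z' t) + Im e * Im (z' t))) a b Hab).
    cbv beta in I. rewrite Cmod_sqr.
    assert (Er : Re e = Re (z b) - Re (z a)) by (unfold e, Cminus; now rewrite re_plus, re_opp).
    assert (Ei : Im e = Im (z b) - Im (z a)) by (unfold e, Cminus; now rewrite im_plus, im_opp).
    cut (Cmod e * K * a - (Re e * Re (z a) + Im e * Im (z a)) <=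
     Cmod e * K * b - (Re e * Re (z b) + Im e * Im (z b))); [rewrite Er, Ei; lra|].
    apply I.
    - intros t Ht. destruct (Hd t Ht) as [D1 D2].
      apply (is_derive_minus (fun t => Cmod e * K * t) (fun t => Re e * Re (z t) + Im e * Im (z t))).
      + apply is_derive_scal. apply (is_derive_id (K := R_AbsRing)).
      + apply (is_derive_plus (fun t => Re e * Re (z t)) (fun t => Im e * Im (z t))); now apply is_derive_scal.
    - intros t Ht. generalize (Re_conj_mult_le e (z' t)) (HK t Ht). nra. }
  destruct (Req_dec (Cmod e) 0) as [E|E].
  - rewrite E. apply Rmult_le_pos; [|lra]. apply Rle_trans with (Cmod (z' a)); [apply Cmod_ge_0|apply HK; lra].
  - apply Rmult_le_reg_l with (Cmod e); lra.
Qed.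

(** The squared modulus [N] is differentiable even where [y] vanishes, and
    [N t * exp (- 2 k (t - a))] decreases; a square root finishes. *)
Lemma curve_gronwall (y y' : R -> C) (a b k : R) : a <= b ->
  (forall t, a <= t <= b -> rdiff y t (y' t)) ->
  (forall t, a <= t <= b -> Cmod (y' t) <= k * Cmod (y t)) ->
  Cmod (y b) <= Cmod (y a) * exp (k * (b - a)).
Proof.
  intros Hab Hd HK.
  set (N := fun t => Re (y t) * Re (y t) + Im (y t) * Im (y t)).
  assert (I := real_increasing
    (fun t => - (N t * exp (- (2 * k * (t - a)))))
    (fun t => - ((2 * (Re (y t) * Re (y' t) + Im (y t) * Im (y' t))) * exp (- (2 * k * (t - a)))
       + N t * (- (2 * k) * exp (- (2 * k * (t - a)))))) a b Hab).
  cbv beta in I.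
  assert (I' : - (N a * exp (- (2 * k * (a - a)))) <= - (N b * exp (- (2 * k * (b - a))))).
  { apply I.
    - intros t Ht. destruct (Hd t Ht) as [D1 D2].
      apply (is_derive_opp (fun t => N t * exp (- (2 * k * (t - a))))).
      apply (is_derive_mult N (fun t => exp (- (2 * k * (t - a))))); [| |exact Rmult_comm].
      + unfold N.
        replace (2 * (Re (y t) * Re (y' t) + Im (y t) * Im (y' t))) with
          ((Re (y' t) * Re (y t) + Re (y t) * Re (y' t)) + (Im (y' t) * Im (y t) + Im (y t) * Im (y' t))) by ring.
        apply (is_derive_plus (fun t => Re (y t) * Re (y t)) (fun t => Im (y t) * Im (y t))).
        * apply (is_derive_mult (fun t => Re (y t)) (fun t => Re (y t))); auto. exact Rmult_comm.
        * apply (is_derive_mult (fun t => Im (y t)) (fun t => Im (y t))); auto. exact Rmult_comm.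
      + auto_derive; auto. unfold Rminus. ring.
    - intros t Ht. assert (E := exp_pos (- (2 * k * (t - a)))).
      assert (R1 := Re_conj_mult_le (y t) (y' t)). assert (R2 := HK t Ht).
      assert (R3 := Cmod_sqr (y t)). assert (R4 := Cmod_ge_0 (y t)). fold (N t) in R3.
      assert (Re (y t) * Re (y' t) + Im (y t) * Im (y' t) <= k * N t) by nra.
      nra. }
  replace (2 * k * (a - a)) with 0 in I' by ring. rewrite Ropp_0, exp_0 in I'.
  assert (F : N b <= N a * exp (2 * k * (b - a))).
  { rewrite exp_Ropp in I'. assert (P := exp_pos (2 * k * (b - a))).
    set (q := exp (2 * k * (b - a))) in *.
    apply Rmult_le_reg_r with (/ q).
    - now apply Rinv_0_lt_compat.
    - rewrite Rmult_assoc, Rinv_r by lra. lra. }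
  unfold N in F. rewrite <- !Cmod_sqr in F.
  replace (2 * k * (b - a)) with (k * (b - a) + k * (b - a)) in F by ring.
  rewrite exp_plus in F. assert (P := exp_pos (k * (b - a))).
  apply Rsqr_incr_0_var; unfold Rsqr.
  - lra.
  - apply Rmult_le_pos; [apply Cmod_ge_0|lra].
Qed.

Lemma rdiff_ray (w : C) (t : R) : rdiff (fun s => s * w)%C t w.
Proof. split; destruct w; simpl; auto_derive; auto; ring. Qed.

Definition convex (A : C -> Prop) : Prop :=
  forall a b s, A a -> A b -> 0 <= s <= 1 -> A (a + RtoC s * (b - a))%C.

Definition cdisc (c : C) (r : R) (z : C) : Prop := Cmod (z - c) < r.

Lemma cdisc_convex (c : C) (r : R) : convex (cdisc c r).
Proof.
  intros a b s Ha Hb Hs. unfold cdisc in *.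
  replace (a + s * (b - a) - c)%C with (RtoC (1 - s) * (a - c) + RtoC s * (b - c))%C
    by (rewrite RtoC_minus; ring).
  eapply Rle_lt_trans; [apply Cmod_triangle|]. rewrite !Cmod_mult, !Cmod_R, !Rabs_pos_eq by lra.
  destruct (Req_dec s 0); [subst; lra|].
  assert (s * Cmod (b - c) < s * r) by (apply Rmult_lt_compat_l; lra).
  assert ((1 - s) * Cmod (a - c) <= (1 - s) * r) by (apply Rmult_le_compat_l; lra). lra.
Qed.

Lemma cdisc_center (c : C) (r : R) : 0 < r -> cdisc c r c.
Proof. unfold cdisc. now rewrite Cmod_sub_eq_0. Qed.

Lemma cdisc_open (c : C) (r : R) : Defs.open_set (cdisc c r).
Proof.
  intros z Hz. unfold cdisc in *. exists (r - Cmod (z - c)). split; [lra|].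
  intros w Hw. generalize (Cmod_sub_trans w z c). lra.
Qed.

Lemma segment_rdiff (f f' : C -> C) (a b : C) (s : R) :
  cdiff f (a + s * (b - a))%C (f' (a + s * (b - a))%C) ->
  rdiff (fun s => f (a + s * (b - a))%C) s (f' (a + s * (b - a))%C * (b - a))%C.
Proof.
  intros H. apply (cdiff_rdiff f (fun s => a + s * (b - a))%C); auto. apply rdiff_line.
Qed.

Lemma mean_value (A : C -> Prop) (f f' : C -> C) (K : R) (a b : C) : convex A ->
  (forall z, A z -> cdiff f z (f' z)) -> (forall z, A z -> Cmod (f' z) <= K) ->
  A a -> A b -> Cmod (f b - f a) <= K * Cmod (b - a).
Proof.
  intros HA Hf HK Ha Hb.
  assert (I := curve_mean_value (fun s => f (a + s * (b - a))%C)
    (fun s => f' (a + s * (b - a))%C * (b - a))%C 0 1 (K * Cmod (b - a)) Rle_0_1).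
  cbv beta in I.
  replace (a + 1 * (b - a))%C with b in I by ring.
  replace (a + 0 * (b - a))%C with a in I by ring.
  replace (K * Cmod (b - a)) with (K * Cmod (b - a) * (1 - 0)) by ring.
  apply I; intros t Ht.
  - apply segment_rdiff, Hf, HA; auto.
  - rewrite Cmod_mult. apply Rmult_le_compat_r; [apply Cmod_ge_0|]. apply HK, HA; auto.
Qed.

Lemma gronwall (A : C -> Prop) (f f' : C -> C) (k : R) (a b : C) : convex A ->
  (forall z, A z -> cdiff f z (f' z)) -> (forall z, A z -> Cmod (f' z) <= k * Cmod (f z)) ->
  A a -> A b -> Cmod (f b) <= Cmod (f a) * exp (k * Cmod (b - a)).
Proof.
  intros HA Hf HK Ha Hb.
  assert (I := curve_gronwall (fun s => f (a + s * (b - a))%C)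
    (fun s => f' (a + s * (b - a))%C * (b - a))%C 0 1 (k * Cmod (b - a)) Rle_0_1).
  cbv beta in I.
  replace (a + 1 * (b - a))%C with b in I by ring.
  replace (a + 0 * (b - a))%C with a in I by ring.
  replace (k * Cmod (b - a)) with (k * Cmod (b - a) * (1 - 0)) by ring.
  apply I; intros t Ht.
  - apply segment_rdiff, Hf, HA; auto.
  - rewrite Cmod_mult, Rmult_assoc, (Rmult_comm (Cmod (b - a))), <- Rmult_assoc.
    apply Rmult_le_compat_r; [apply Cmod_ge_0|]. apply HK, HA; auto.
Qed.

(** Heine-Borel for any relation monotone in its bound. It serves continuous functions on compact
    sets, and also the remaining life span of a trajectory as a function of its position. *)
Lemma loc_bounded (Q : C -> R -> Prop) (K : R) :
  (forall w m m', Q w m -> m <= m' -> Q w m') ->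
  (forall p, exists d, 0 < d /\ exists m, forall w, Cmod (w - p) < d -> Q w m) ->
  exists m, forall w, Cmod w <= K -> Q w m.
Proof.
  intros Hm Hl.
  (* One positive number has to serve as gauge, so [d] encodes both the radius and the bound [/ d].
     The factor 2 passes from a square of half-side [d] to a disc. *)
  assert (Hl' : forall x y, exists d : posreal, forall w, Cmod (w - (x, y)) < 2 * d -> Q w (/ d)).
  { intros x y. destruct (Hl (x, y)) as [d [Hd [m Hq]]].
    assert (P : 0 < Rmin (d / 2) (/ (Rabs m + 1))).
    { apply Rmin_glb_lt; [lra|]. apply Rinv_0_lt_compat. generalize (Rabs_pos m). lra. }
    exists (mkposreal _ P). simpl. intros w Hw. apply Hm with m.
    - apply Hq. generalize (Rmin_l (d / 2) (/ (Rabs m + 1))). lra.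
    - assert (H1 := Rmin_r (d / 2) (/ (Rabs m + 1))).
      apply Rinv_le_contravar in H1; auto. rewrite Rinv_inv in H1.
      generalize (Rle_abs m). lra. }
  destruct (compactness_value_2d (- K) K (- K) K
    (fun x y => proj1_sig (constructive_indefinite_description _ (Hl' x y)))) as [d Hd].
  exists (/ d). intros w Hw. apply NNPP. intro HN.
  assert (W1 := Rle_trans _ _ _ (re_le_Cmod w) Hw). assert (W2 := Rle_trans _ _ _ (im_le_Cmod w) Hw).
  apply Rabs_le_between in W1. apply Rabs_le_between in W2.
  apply (Hd (Re w) (Im w)); auto. intros [u [v [_ [_ H]]]]. apply HN.
  revert H. destruct (constructive_indefinite_description _ (Hl' u v)) as [q Hq].
  simpl. intros [H1 [H2 H3]].
  apply Hm with (/ q).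
  - apply Hq. eapply Rle_lt_trans; [apply Cmod_le_Re_Im|].
    change (Rabs (Re w - u) + Rabs (Im w - v) < 2 * q). lra.
  - apply Rinv_le_contravar; auto. apply cond_pos.
Qed.

Lemma compact_bounded (S : C -> Prop) (f : C -> C) (K : R) :
  (forall z, S z -> Cmod z <= K) ->
  (forall z, ~ S z -> exists d, 0 < d /\ forall w, Cmod (w - z) < d -> ~ S w) ->
  (forall z, S z -> ccont f z) ->
  exists m, forall z, S z -> Cmod (f z) <= m.
Proof.
  intros HK HS H.
  destruct (loc_bounded (fun w m => S w -> Cmod (f w) <= m) K) as [m Hm].
  - intros w m m' Hq Hmm Hw. specialize (Hq Hw). lra.
  - intros p. destruct (classic (S p)) as [Hp|Hp].
    + destruct (ccont_loc_bound f p (H p Hp)) as [d [Hd B]].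
      exists d. split; auto. exists (Cmod (f p) + 1). auto.
    + destruct (HS p Hp) as [d [Hd B]]. exists d. split; auto. exists 0.
      intros w Hw Hs. now destruct (B w Hw).
  - exists m. intros z Hz. apply Hm; auto.
Qed.

Lemma closed_cdisc_avoid (c : C) (r : R) (z : C) : ~ Cmod (z - c) <= r ->
  exists d, 0 < d /\ forall w, Cmod (w - z) < d -> ~ Cmod (w - c) <= r.
Proof.
  intros H. exists (Cmod (z - c) - r). split; [lra|]. intros w Hw Hc.
  generalize (Cmod_sub_trans z w c). rewrite (Cmod_sub_sym z w). lra.
Qed.

Lemma closed_disc_bounded (f : C -> C) (c : C) (r : R) :
  (forall z, Cmod (z - c) <= r -> ccont f z) ->
  exists m, forall z, Cmod (z - c) <= r -> Cmod (f z) <= m.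
Proof.
  apply compact_bounded with (Cmod c + r); [|apply closed_cdisc_avoid].
  intros z Hz. generalize (Cmod_triangle_rev z c). lra.
Qed.

(** * Complex-valued integrals *)

(** Extending a curve constantly in the imaginary direction makes the rules for [ccont] available
    for curves. *)
Lemma rcont_ccont (z : R -> C) (t : R) : rcont z t <-> ccont (fun p => z (Re p)) (RtoC t).
Proof.
  split; intros H e He; destruct (H e He) as [r [Hr B]]; exists r; (split; [auto|]); intros w Hw.
  - apply (B (Re w)). eapply Rle_lt_trans; [|apply Hw].
    eapply Rle_trans; [|apply re_le_Cmod]. apply Rle_refl.
  - apply (B (RtoC w)). now rewrite <- RtoC_minus, Cmod_R.
Qed.

Lemma rcont_const (c : C) (t : R) : rcont (fun _ => c) t.
Proof. apply rcont_ccont, ccont_const. Qed.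

Lemma rcont_plus (f g : R -> C) (t : R) : rcont f t -> rcont g t -> rcont (fun s => f s + g s)%C t.
Proof. rewrite !rcont_ccont. apply (ccont_plus (fun p => f (Re p)) (fun p => g (Re p))). Qed.

Lemma rcont_minus (f g : R -> C) (t : R) : rcont f t -> rcont g t -> rcont (fun s => f s - g s)%C t.
Proof. rewrite !rcont_ccont. apply (ccont_minus (fun p => f (Re p)) (fun p => g (Re p))). Qed.

Lemma rcont_mult (f g : R -> C) (t : R) : rcont f t -> rcont g t -> rcont (fun s => f s * g s)%C t.
Proof. rewrite !rcont_ccont. apply (ccont_mult (fun p => f (Re p)) (fun p => g (Re p))). Qed.

Lemma rcont_inv (f : R -> C) (t : R) : f t <> 0%C -> rcont f t -> rcont (fun s => / f s)%C t.
Proof. rewrite !rcont_ccont. intros Hz. now apply (ccont_inv (fun p => f (Re p)) (RtoC t)). Qed.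

Lemma rcont_re (k : R -> C) (t : R) : rcont k t -> continuous (fun s => Re (k s)) t.
Proof.
  intros H. apply filterlim_locally. intros e. destruct (H e (cond_pos e)) as [r [Hr B]].
  exists (mkposreal r Hr). intros s Hs. specialize (B s Hs).
  eapply Rle_lt_trans; [|apply B]. eapply Rle_trans; [|apply re_le_Cmod]. apply Rle_refl.
Qed.

Lemma rcont_im (k : R -> C) (t : R) : rcont k t -> continuous (fun s => Im (k s)) t.
Proof.
  intros H. apply filterlim_locally. intros e. destruct (H e (cond_pos e)) as [r [Hr B]].
  exists (mkposreal r Hr). intros s Hs. specialize (B s Hs).
  eapply Rle_lt_trans; [|apply B]. eapply Rle_trans; [|apply im_le_Cmod]. apply Rle_refl.
Qed.

Lemma ex_RInt_re (k : R -> C) (a b : R) : (forall t, rcont k t) -> ex_RInt (fun t => Re (k t)) a b.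
Proof. intros H. apply (ex_RInt_continuous (V := R_CompleteNormedModule)). intros; now apply rcont_re. Qed.

Lemma ex_RInt_im (k : R -> C) (a b : R) : (forall t, rcont k t) -> ex_RInt (fun t => Im (k t)) a b.
Proof. intros H. apply (ex_RInt_continuous (V := R_CompleteNormedModule)). intros; now apply rcont_im. Qed.

(** Used only for curves continuous on the whole line, so both components are genuinely
    integrable. *)
Definition Cint (k : R -> C) (a b : R) : C :=
  (RInt (fun t => Re (k t)) a b, RInt (fun t => Im (k t)) a b).

Lemma Cint_ext (k l : R -> C) (a b : R) : (forall t, k t = l t) -> Cint k a b = Cint l a b.
Proof. intros H. unfold Cint. f_equal; apply RInt_ext; intros; now rewrite H. Qed.

Lemma Cint_plus (k l : R -> C) (a b : R) : (forall t, rcont k t) -> (forall t, rcont l t) ->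
  Cint (fun t => k t + l t)%C a b = (Cint k a b + Cint l a b)%C.
Proof.
  intros Hk Hl. unfold Cint, Cplus. simpl. f_equal.
  - transitivity (RInt (fun t => plus (Re (k t)) (Re (l t))) a b).
    + apply RInt_ext. reflexivity.
    + apply (RInt_plus (V := R_CompleteNormedModule)); now apply ex_RInt_re.
  - transitivity (RInt (fun t => plus (Im (k t)) (Im (l t))) a b).
    + apply RInt_ext. reflexivity.
    + apply (RInt_plus (V := R_CompleteNormedModule)); now apply ex_RInt_im.
Qed.

Lemma Cint_scal (c : C) (k : R -> C) (a b : R) : (forall t, rcont k t) ->
  Cint (fun t => c * k t)%C a b = (c * Cint k a b)%C.
Proof.
  intros Hk. apply injective_projections; simpl.
  - transitivity (RInt (fun t => minus (scal (Re c) (Re (k t))) (scal (Im c) (Im (k t)))) a b).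
    + apply RInt_ext. reflexivity.
    + etransitivity.
      * apply (RInt_minus (V := R_CompleteNormedModule)); apply (ex_RInt_scal (V := R_NormedModule));
          [now apply ex_RInt_re | now apply ex_RInt_im].
      * rewrite (RInt_scal (V := R_CompleteNormedModule)) by now apply ex_RInt_re.
        rewrite (RInt_scal (V := R_CompleteNormedModule)) by now apply ex_RInt_im. reflexivity.
  - transitivity (RInt (fun t => plus (scal (Re c) (Im (k t))) (scal (Im c) (Re (k t)))) a b).
    + apply RInt_ext. reflexivity.
    + etransitivity.
      * apply (RInt_plus (V := R_CompleteNormedModule)); apply (ex_RInt_scal (V := R_NormedModule));
          [now apply ex_RInt_im | now apply ex_RInt_re].
      * rewrite (RInt_scal (V := R_CompleteNormedModule)) by now apply ex_RInt_im.
        rewrite (RInt_scal (V := R_CompleteNormedModule)) by now apply ex_RInt_re. reflexivity.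
Qed.

Lemma Cint_minus (k l : R -> C) (a b : R) : (forall t, rcont k t) -> (forall t, rcont l t) ->
  Cint (fun t => k t - l t)%C a b = (Cint k a b - Cint l a b)%C.
Proof.
  intros Hk Hl. rewrite (Cint_ext _ (fun t => k t + (-1) * l t)%C) by (intros; ring).
  rewrite Cint_plus; auto; [rewrite Cint_scal by auto; ring|].
  intros t. apply rcont_mult; auto. apply rcont_const.
Qed.

(** Multiplication by the conjugate of the integral rotates it onto the positive real axis, where
    the estimate for real integrals applies without loss of a constant. *)
Lemma Cint_norm (k : R -> C) (a b M : R) : a <= b -> (forall t, rcont k t) ->
  (forall t, Cmod (k t) <= M) -> Cmod (Cint k a b) <= M * (b - a).
Proof.
  intros Hab Hk HM. set (I := Cint k a b).
  assert (HI := Cmod_ge_0 I).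
  assert (H : Cmod I * Cmod I <= Cmod I * M * (b - a)).
  { rewrite Cmod_sqr.
    replace (Re I * Re I + Im I * Im I) with (Re (Cconj I * Cint k a b)%C)
      by (fold I; destruct I; simpl; ring).
    rewrite <- Cint_scal by auto. simpl.
    replace (Cmod I * M * (b - a)) with (RInt (fun _ => Cmod I * M) a b)
      by (rewrite RInt_const; unfold scal; simpl; unfold mult; simpl; ring).
    apply RInt_le; auto.
    - apply ex_RInt_re with (k := fun t => (Cconj I * k t)%C).
      intros t. apply rcont_mult; auto. apply rcont_const.
    - apply ex_RInt_const.
    - intros t _. apply Rle_trans with (Cmod (Cconj I * k t)%C);
        [eapply Rle_trans; [apply Rle_abs | exact (re_le_Cmod (Cconj I * k t)%C)] |].
      rewrite Cmod_mult, Cmod_conj.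
      apply Rmult_le_compat_l; auto. }
  destruct (Req_dec (Cmod I) 0) as [E|E].
  - rewrite E. apply Rmult_le_pos; [|lra]. apply Rle_trans with (Cmod (k 0)); [apply Cmod_ge_0|auto].
  - apply Rmult_le_reg_l with (Cmod I); lra.
Qed.

Lemma Cint_derive (y y' : R -> C) (a b : R) :
  (forall t, rdiff y t (y' t)) -> (forall t, rcont y' t) -> Cint y' a b = (y b - y a)%C.
Proof.
  intros Hd Hc. apply injective_projections; simpl; apply is_RInt_unique.
  - apply (is_RInt_derive (fun t => Re (y t)) (fun t => Re (y' t))); intros; [apply Hd | now apply rcont_re].
  - apply (is_RInt_derive (fun t => Im (y t)) (fun t => Im (y' t))); intros; [apply Hd | now apply rcont_im].
Qed.

(** Joint continuity, with the parameter pair read as a complex number so that the rules for [ccont]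
    apply. *)
Definition jcont (K : R -> R -> C) (s t : R) : Prop :=
  ccont (fun p => K (Re p) (Im p)) (s, t).

Lemma jcont_eps (K : R -> R -> C) (s t : R) : jcont K s t ->
  forall e, 0 < e -> exists d, 0 < d /\ forall u v, Rabs (u - s) < d -> Rabs (v - t) < d ->
    Cmod (K u v - K s t) < e.
Proof.
  intros H e He. destruct (H e He) as [d [Hd B]]. exists (d / 2). split; [lra|].
  intros u v Hu Hv. apply (B (u, v)). eapply Rle_lt_trans; [apply Cmod_le_Re_Im|].
  change (Rabs (u - s) + Rabs (v - t) < d). lra.
Qed.

Lemma jcont_fst (s t : R) : jcont (fun u _ => RtoC u) s t.
Proof.
  intros e He. exists e. split; auto. intros w Hw. eapply Rle_lt_trans; [|apply Hw].
  rewrite <- RtoC_minus, Cmod_R. eapply Rle_trans; [|apply re_le_Cmod]. apply Rle_refl.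
Qed.

Lemma jcont_snd (k : R -> C) (s t : R) : rcont k t -> jcont (fun _ v => k v) s t.
Proof.
  intros H e He. destruct (H e He) as [d [Hd B]]. exists d. split; auto.
  intros w Hw. apply B. eapply Rle_lt_trans; [|apply Hw].
  eapply Rle_trans; [|apply im_le_Cmod]. apply Rle_refl.
Qed.

Lemma is_derive_RInt_jcont (k k' : R -> R -> R) (a b s0 eta : R) : 0 < eta ->
  (forall s t, Rabs (s - s0) < eta -> is_derive (fun u => k u t) s (k' s t)) ->
  (forall t e, 0 < e -> exists d, 0 < d /\ forall u v, Rabs (u - s0) < d -> Rabs (v - t) < d ->
     Rabs (k' u v - k' s0 t) < e) ->
  (forall s, Rabs (s - s0) < eta -> ex_RInt (k s) a b) ->
  is_derive (fun s => RInt (k s) a b) s0 (RInt (k' s0) a b).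
Proof.
  intros He Hd Hj Hc.
  assert (H0 : Rabs (s0 - s0) < eta) by (unfold Rminus; now rewrite Rplus_opp_r, Rabs_R0).
  assert (D : forall s t, Rabs (s - s0) < eta -> Derive (fun u => k u t) s = k' s t).
  { intros s t Hs. apply is_derive_unique. now apply Hd. }
  rewrite (RInt_ext _ (fun t => Derive (fun u => k u t) s0)) by (intros; now rewrite D).
  apply (is_derive_RInt_param (fun s t => k s t)).
  - exists (mkposreal eta He). intros s Hs t _. exists (k' s t). now apply Hd.
  - intros t _ e. destruct (Hj t e (cond_pos e)) as [d [Hd' B]].
    assert (P : 0 < Rmin d eta) by now apply Rmin_glb_lt.
    exists (mkposreal _ P). simpl. intros u v Hu Hv.
    destruct (Rlt_Rmin _ _ _ Hu) as [Hu1 Hu2]. destruct (Rlt_Rmin _ _ _ Hv) as [Hv1 _].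
    rewrite !D by auto. now apply B.
  - exists (mkposreal eta He). intros s Hs. now apply Hc.
Qed.

Lemma rdiff_Cint_param (K K' : R -> R -> C) (a b s0 eta : R) : 0 < eta ->
  (forall s t, Rabs (s - s0) < eta -> rdiff (fun u => K u t) s (K' s t)) ->
  (forall t, jcont K' s0 t) ->
  (forall s t, Rabs (s - s0) < eta -> rcont (K s) t) ->
  rdiff (fun s => Cint (K s) a b) s0 (Cint (K' s0) a b).
Proof.
  intros He Hd Hj Hc. split.
  - apply (is_derive_RInt_jcont (fun s t => Re (K s t)) (fun s t => Re (K' s t)) a b s0 eta); auto.
    + intros s t Hs. now apply Hd.
    + intros t e Hep. destruct (jcont_eps _ _ _ (Hj t) e Hep) as [d [Hd' B]]. exists d. split; auto.
      intros u v Hu Hv. eapply Rle_lt_trans; [|apply (B u v Hu Hv)].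
      exact (re_le_Cmod (K' u v - K' s0 t)%C).
    + intros s Hs. apply (ex_RInt_re (K s)). auto.
  - apply (is_derive_RInt_jcont (fun s t => Im (K s t)) (fun s t => Im (K' s t)) a b s0 eta); auto.
    + intros s t Hs. now apply Hd.
    + intros t e Hep. destruct (jcont_eps _ _ _ (Hj t) e Hep) as [d [Hd' B]]. exists d. split; auto.
      intros u v Hu Hv. eapply Rle_lt_trans; [|apply (B u v Hu Hv)].
      exact (im_le_Cmod (K' u v - K' s0 t)%C).
    + intros s Hs. apply (ex_RInt_im (K s)). auto.
Qed.

(** A remainder that is quadratic in [w - z] uniformly in [t] stays so after integration. For the
    Cauchy kernels it is explicit; for primitives [taylor2_bound] supplies it. *)
Lemma cdiff_Cint_param (K : R -> C -> C) (K' : R -> C) (a b : R) (z : C) (d B : R) :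
  a <= b -> 0 < d ->
  (forall t w, Cmod (w - z) < d -> rcont (fun t => K t w) t) -> (forall t, rcont K' t) ->
  (forall t w, Cmod (w - z) < d ->
     Cmod (K t w - K t z - K' t * (w - z)) <= B * (Cmod (w - z) * Cmod (w - z))) ->
  cdiff (fun w => Cint (fun t => K t w) a b) z (Cint K' a b).
Proof.
  intros Hab Hd Hc Hc' HB e He.
  assert (HB0 : 0 <= Rabs B * (b - a)) by (apply Rmult_le_pos; [apply Rabs_pos|lra]).
  exists (Rmin d (e / (Rabs B * (b - a) + 1))). split.
  - apply Rmin_glb_lt; auto. apply Rdiv_lt_0_compat; lra.
  - intros w Hw. destruct (Rlt_Rmin _ _ _ Hw) as [Hw1 Hw2].
    assert (H0 : Cmod (z - z) < d) by now rewrite Cmod_sub_eq_0.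
    assert (c1 : forall t, rcont (fun t => K t w) t) by (intros; now apply Hc).
    assert (c2 : forall t, rcont (fun t => K t z) t) by (intros; now apply Hc).
    rewrite (Cmult_comm (Cint K' a b)), <- Cint_scal, <- !Cint_minus; auto.
    2: { intros t. now apply rcont_minus. }
    2: { intros t. apply rcont_mult; auto. apply rcont_const. }
    eapply Rle_trans.
    + apply Cint_norm with (M := Rabs B * (Cmod (w - z) * Cmod (w - z))); auto.
      * intros t. apply rcont_minus; [now apply rcont_minus|]. apply rcont_mult; auto. apply rcont_const.
      * intros t. rewrite (Cmult_comm (w - z)). eapply Rle_trans; [now apply HB|].
        apply Rmult_le_compat_r; [|apply Rle_abs]. apply Rmult_le_pos; apply Cmod_ge_0.
    + apply Rlt_div_r in Hw2; [|lra]. assert (P := Cmod_ge_0 (w - z)). nra.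
Qed.

(** * Cauchy's formula *)

(** Continuity of [f'] is built in because the proof of Cauchy's formula differentiates [f] under
    the integral sign; [regularity] shows that the notion passes on to [f']. *)
Definition hol (A : C -> Prop) (f f' : C -> C) : Prop :=
  forall z, A z -> cdiff f z (f' z) /\ ccont f' z.

Definition circ (c : C) (r t : R) : C := (c + RtoC r * (cos t, sin t))%C.

Lemma circ_rdiff (c : C) (r t : R) : rdiff (circ c r) t (Ci * (circ c r t - c))%C.
Proof. split; destruct c; simpl; auto_derive; auto; ring. Qed.

Lemma circ_rcont (c : C) (r t : R) : rcont (circ c r) t.
Proof. eapply rdiff_cont, circ_rdiff. Qed.

Lemma circ_mod (c : C) (r t : R) : 0 <= r -> Cmod (circ c r t - c) = r.
Proof.
  intros Hr. unfold circ. replace (c + r * (cos t, sin t) - c)%C with (r * (cos t, sin t))%C by ring.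
  rewrite Cmod_mult, Cmod_R, Rabs_pos_eq by auto.
  assert (E : Cmod (cos t, sin t) = 1).
  { apply sqrt_lem_1; simpl; [|lra|].
    - generalize (pow2_ge_0 (cos t)) (pow2_ge_0 (sin t)). simpl. lra.
    - generalize (sin2_cos2 t). unfold Rsqr. lra. }
  rewrite E. ring.
Qed.

Lemma circ_period (c : C) (r : R) : circ c r (2 * PI) = circ c r 0.
Proof. unfold circ. now rewrite cos_2PI, sin_2PI, cos_0, sin_0. Qed.

Lemma circ_sub_neq (c z : C) (r t : R) : Cmod (z - c) < r -> (circ c r t - z)%C <> 0%C.
Proof.
  intros Hz H. assert (E : circ c r t = z) by (replace (circ c r t) with ((circ c r t - z) + z)%C by ring; rewrite H; ring).
  assert (P := Cmod_ge_0 (z - c)%C). generalize (circ_mod c r t). rewrite E. intros; lra.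
Qed.

(** Transforms of a boundary density [k] by the powers 1, 2, 3 of the Cauchy kernel. The factor
    [Ci * (circ c r t - c)] from the parametrisation is left to [k]. Each transform is, up to a
    constant, the derivative of the one before. *)
Definition cauchy1 (k : R -> C) (c : C) (r : R) (z : C) : C :=
  Cint (fun t => k t * / (circ c r t - z))%C 0 (2 * PI).
Definition cauchy2 (k : R -> C) (c : C) (r : R) (z : C) : C :=
  Cint (fun t => k t * (/ (circ c r t - z) * / (circ c r t - z)))%C 0 (2 * PI).
Definition cauchy3 (k : R -> C) (c : C) (r : R) (z : C) : C :=
  Cint (fun t => k t * (/ (circ c r t - z) * / (circ c r t - z) * / (circ c r t - z)))%C 0 (2 * PI).

Lemma kernel_rcont (c z : C) (r t : R) : Cmod (z - c) < r ->
  rcont (fun t => / (circ c r t - z))%C t.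
Proof.
  intros Hz. apply rcont_inv; [now apply circ_sub_neq|].
  apply rcont_minus; [apply circ_rcont | apply rcont_const].
Qed.

Lemma kernel_bound (c z w : C) (r t : R) : Cmod (z - c) < r -> Cmod (w - z) < (r - Cmod (z - c)) / 2 ->
  Cmod (/ (circ c r t - w)) <= 2 / (r - Cmod (z - c)).
Proof.
  intros Hz Hw. assert (P := Cmod_ge_0 (z - c)%C).
  assert (Hwc : Cmod (w - c) < r) by (generalize (Cmod_sub_trans w z c); lra).
  rewrite Cmod_inv by now apply circ_sub_neq.
  assert (T := Cmod_sub_trans (circ c r t) w c). rewrite circ_mod in T by lra.
  assert (T2 := Cmod_sub_trans w z c).
  replace (2 / (r - Cmod (z - c))) with (/ ((r - Cmod (z - c)) / 2)) by (field; lra).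
  apply Rinv_le_contravar; lra.
Qed.

Lemma kernel_diff (c z w : C) (r t : R) : Cmod (z - c) < r -> Cmod (w - c) < r ->
  (/ (circ c r t - w) - / (circ c r t - z))%C
    = ((w - z) * (/ (circ c r t - z) * / (circ c r t - w)))%C.
Proof.
  intros Hz Hw. assert (H1 := circ_sub_neq c z r t Hz). assert (H2 := circ_sub_neq c w r t Hw).
  field. auto.
Qed.

(** All remainders below are reduced by repeated use of [b - a = (w - z) * (a * b)] and then bounded
    by powers of the common [A]. *)
Lemma kernel_estimates (c z w : C) (r t : R) : Cmod (z - c) < r -> Cmod (w - z) < (r - Cmod (z - c)) / 2 ->
  let a := (/ (circ c r t - z))%C in let b := (/ (circ c r t - w))%C in let A := 2 / (r - Cmod (z - c)) in
  (0 <= Cmod a <= A /\ 0 <= Cmod b <= A) /\ (b - a)%C = ((w - z) * (a * b))%C.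
Proof.
  intros Hz Hw a b A. split; [split; split; try apply Cmod_ge_0|].
  - apply (kernel_bound c z z); rewrite ?Cmod_sub_eq_0; lra.
  - now apply kernel_bound.
  - apply kernel_diff; auto. generalize (Cmod_sub_trans w z c). lra.
Qed.

Section Cauchy_transform.
Variables (k : R -> C) (c : C) (r M : R).
Hypothesis k_cont : forall t, rcont k t.
Hypothesis k_bound : forall t, Cmod (k t) <= M.

Lemma two_PI_pos : 0 <= 2 * PI.
Proof. generalize PI_RGT_0. lra. Qed.

Lemma cauchy1_cdiff (z : C) : Cmod (z - c) < r ->
  cdiff (cauchy1 k c r) z (cauchy2 k c r z).
Proof.
  intros Hz. set (A := 2 / (r - Cmod (z - c))).
  assert (HA : 0 < A) by (apply Rdiv_lt_0_compat; lra).
  apply cdiff_Cint_param with (K := fun t w => (k t * / (circ c r t - w))%C)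
    (d := (r - Cmod (z - c)) / 2) (B := M * (A * A * A)); [apply two_PI_pos | lra | | |].
  - intros t w Hw. apply rcont_mult; auto. apply kernel_rcont.
    generalize (Cmod_sub_trans w z c). lra.
  - intros t. apply rcont_mult; auto. apply rcont_mult; now apply kernel_rcont.
  - intros t w Hw. destruct (kernel_estimates c z w r t Hz Hw) as [[[Pa Ha] [Pb Hb]] E].
    fold A in Ha, Hb. set (a := (/ (circ c r t - z))%C) in *. set (b := (/ (circ c r t - w))%C) in *.
    replace (k t * b - k t * a - k t * (a * a) * (w - z))%C
      with (k t * ((b - a) - (w - z) * (a * a)))%C by ring.
    rewrite E.
    replace (k t * ((w - z) * (a * b) - (w - z) * (a * a)))%C with (k t * ((w - z) * (a * (b - a))))%C by ring.
    rewrite E, !Cmod_mult.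
    assert (Pk := Cmod_ge_0 (k t)).
    assert (Ph := Cmod_ge_0 (w - z)).
    replace (Cmod (k t) * (Cmod (w - z) * (Cmod a * (Cmod (w - z) * (Cmod a * Cmod b)))))
      with (Cmod (k t) * (Cmod a * Cmod a * Cmod b) * (Cmod (w - z) * Cmod (w - z))) by ring.
    apply Rmult_le_compat_r; [now apply Rmult_le_pos|].
    repeat apply Rmult_le_compat; auto; repeat apply Rmult_le_pos; auto.
Qed.

Lemma cauchy2_cdiff (z : C) : Cmod (z - c) < r ->
  cdiff (cauchy2 k c r) z (2 * cauchy3 k c r z)%C.
Proof.
  intros Hz. set (A := 2 / (r - Cmod (z - c))).
  assert (HA : 0 < A) by (apply Rdiv_lt_0_compat; lra).
  unfold cauchy3. rewrite <- Cint_scal.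
  2: { intros t. apply rcont_mult; auto. repeat apply rcont_mult; now apply kernel_rcont. }
  apply cdiff_Cint_param with (K := fun t w => (k t * (/ (circ c r t - w) * / (circ c r t - w)))%C)
    (d := (r - Cmod (z - c)) / 2) (B := M * (A * A * A * (3 * A))); [apply two_PI_pos | lra | | |].
  - intros t w Hw. assert (Hwc : Cmod (w - c) < r) by (generalize (Cmod_sub_trans w z c); lra).
    apply rcont_mult; auto. apply rcont_mult; now apply kernel_rcont.
  - intros t. apply rcont_mult; [apply rcont_const|].
    apply rcont_mult; auto. repeat apply rcont_mult; now apply kernel_rcont.
  - intros t w Hw. destruct (kernel_estimates c z w r t Hz Hw) as [[[Pa Ha] [Pb Hb]] E].
    fold A in Ha, Hb. set (a := (/ (circ c r t - z))%C) in *. set (b := (/ (circ c r t - w))%C) in *.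
    replace (k t * (b * b) - k t * (a * a) - 2 * (k t * (a * a * a)) * (w - z))%C
      with (k t * ((w - z) * (w - z) * (a * a * b * (2 * a + b))))%C.
    2: { assert (E2 : b = (a + (w - z) * (a * b))%C) by (rewrite <- E; ring).
      transitivity (k t * ((b - a) * (b + a) - 2 * (w - z) * (a * a * a)))%C; [|ring].
      rewrite E.
      transitivity (k t * ((w - z) * a * ((b - a) * (b + 2 * a))))%C; [rewrite E; ring|ring]. }
    rewrite !Cmod_mult.
    assert (Hab : Cmod (2 * a + b) <= 3 * A).
    { eapply Rle_trans; [apply Cmod_triangle|]. rewrite Cmod_mult, Cmod_R, Rabs_pos_eq by lra. lra. }
    assert (Pk := Cmod_ge_0 (k t)).
    assert (Pab := Cmod_ge_0 (2 * a + b)%C). assert (Ph := Cmod_ge_0 (w - z)).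
    replace (Cmod (k t) * (Cmod (w - z) * Cmod (w - z) * (Cmod a * Cmod a * Cmod b * Cmod (2 * a + b))))
      with (Cmod (k t) * (Cmod a * Cmod a * Cmod b * Cmod (2 * a + b)) * (Cmod (w - z) * Cmod (w - z))) by ring.
    apply Rmult_le_compat_r; [now apply Rmult_le_pos|].
    repeat apply Rmult_le_compat; auto; repeat apply Rmult_le_pos; auto.
Qed.

Lemma cauchy3_ccont (z : C) : Cmod (z - c) < r -> ccont (cauchy3 k c r) z.
Proof.
  intros Hz e He. set (A := 2 / (r - Cmod (z - c))).
  assert (HA : 0 < A) by (apply Rdiv_lt_0_compat; lra).
  assert (HM : 0 <= M) by (eapply Rle_trans; [apply Cmod_ge_0 | apply (k_bound 0)]).
  assert (P2 := two_PI_pos).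
  set (B := M * (A * A * (A * A + A * A + A * A)) * (2 * PI - 0)).
  assert (HB : 0 <= B).
  { assert (0 <= A * A) by (apply Rmult_le_pos; lra).
    unfold B. apply Rmult_le_pos; [|lra]. apply Rmult_le_pos; auto. apply Rmult_le_pos; lra. }
  exists (Rmin ((r - Cmod (z - c)) / 2) (e / (B + 1))). split.
  - apply Rmin_glb_lt; [lra|]. apply Rdiv_lt_0_compat; lra.
  - intros w Hw. destruct (Rlt_Rmin _ _ _ Hw) as [Hw1 Hw2].
    assert (Hwc : Cmod (w - c) < r) by (generalize (Cmod_sub_trans w z c); lra).
    assert (Ph := Cmod_ge_0 (w - z)).
    assert (Hcw : forall w, Cmod (w - c) < r -> forall t,
      rcont (fun t => k t * (/ (circ c r t - w) * / (circ c r t - w) * / (circ c r t - w)))%C t).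
    { intros w' Hw' t. apply rcont_mult; auto. repeat apply rcont_mult; now apply kernel_rcont. }
    unfold cauchy3. rewrite <- Cint_minus by auto.
    apply Rle_lt_trans with (M * (A * A * (A * A + A * A + A * A)) * Cmod (w - z) * (2 * PI - 0)).
    + apply Cint_norm; [apply two_PI_pos | intros t; apply rcont_minus; auto |].
      intros t. destruct (kernel_estimates c z w r t Hz Hw1) as [[[Pa Ha] [Pb Hb]] E].
      fold A in Ha, Hb. set (a := (/ (circ c r t - z))%C) in *. set (b := (/ (circ c r t - w))%C) in *.
      replace (k t * (b * b * b) - k t * (a * a * a))%C
        with (k t * ((b - a) * (a * a + a * b + b * b)))%C by ring.
      rewrite E.
      replace (k t * ((w - z) * (a * b) * (a * a + a * b + b * b)))%C
        with (k t * (a * b * (a * a + a * b + b * b)) * (w - z))%C by ring.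
      rewrite (Cmod_mult _ (w - z)). apply Rmult_le_compat_r; auto.
      assert (Pk := Cmod_ge_0 (k t)).
      assert (Hs : Cmod (a * a + a * b + b * b) <= A * A + A * A + A * A).
      { eapply Rle_trans; [apply Cmod_triangle|]. apply Rplus_le_compat.
        - eapply Rle_trans; [apply Cmod_triangle|]. rewrite !Cmod_mult.
          apply Rplus_le_compat; apply Rmult_le_compat; auto.
        - rewrite Cmod_mult. apply Rmult_le_compat; auto. }
      rewrite !Cmod_mult.
      assert (Ps := Cmod_ge_0 (a * a + a * b + b * b)%C).
      repeat apply Rmult_le_compat; auto; repeat apply Rmult_le_pos; auto.
    + apply Rlt_div_r in Hw2; [|lra].
      replace (M * (A * A * (A * A + A * A + A * A)) * Cmod (w - z) * (2 * PI - 0)) with (B * Cmod (w - z))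
        by (unfold B; ring). lra.
Qed.

Lemma cauchy1_hol : hol (cdisc c r) (cauchy1 k c r) (cauchy2 k c r).
Proof.
  intros z Hz. split; [now apply cauchy1_cdiff|]. eapply cdiff_cont, cauchy2_cdiff, Hz.
Qed.

Lemma cauchy2_hol : hol (cdisc c r) (cauchy2 k c r) (fun z => 2 * cauchy3 k c r z)%C.
Proof.
  intros z Hz. split; [now apply cauchy2_cdiff|].
  apply ccont_mult; [apply ccont_const | now apply cauchy3_ccont].
Qed.
End Cauchy_transform.

(** The [z]-derivative integrates the exact derivative of [- / (circ c r t - w)] over a period and
    so vanishes; at the centre the integrand is the constant [Ci]. *)
Lemma cauchy_kernel_integral (c z : C) (r : R) : Cmod (z - c) < r ->
  cauchy1 (fun t => Ci * (circ c r t - c))%C c r z = (2 * PI * Ci)%C.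
Proof.
  intros Hz. assert (P := Cmod_ge_0 (z - c)%C).
  set (k := fun t => (Ci * (circ c r t - c))%C).
  assert (k_cont : forall t, rcont k t).
  { intros t. apply rcont_mult; [apply rcont_const|]. apply rcont_minus; [apply circ_rcont|apply rcont_const]. }
  assert (k_bound : forall t, Cmod (k t) <= r).
  { intros t. unfold k. rewrite Cmod_mult, Cmod_Ci, circ_mod by lra. lra. }
  assert (Hd : forall w, cdisc c r w -> cauchy2 k c r w = 0%C).
  { intros w Hw. unfold cauchy2.
    rewrite (Cint_derive (fun t => - / (circ c r t - w))%C); [now rewrite circ_period; ring| |].
    - intros t. replace (k t * (/ (circ c r t - w) * / (circ c r t - w)))%C
        with ((- - (/ (circ c r t - w) * / (circ c r t - w))) * (Ci * (circ c r t - c)))%C by (unfold k; ring).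
      apply (cdiff_rdiff (fun v => - / (v - w))%C (circ c r)); [|apply circ_rdiff].
      assert (N := circ_sub_neq c w r t Hw). set (v := circ c r t) in *.
      replace (- - (/ (v - w) * / (v - w)))%C with (0 - (- ((1 - 0) * (/ (v - w) * / (v - w)))))%C by ring.
      apply cdiff_ext_loc with (f := fun v => (0 - / (v - w))%C) (r := 1); [lra | intros; ring |].
      apply (cdiff_minus (fun _ => 0%C)); [apply cdiff_const|].
      apply (cdiff_inv (fun v => v - w)%C); auto.
      apply cdiff_minus; [apply cdiff_id|apply cdiff_const].
    - intros t. apply rcont_mult; auto. apply rcont_mult; now apply kernel_rcont. }
  assert (E : cauchy1 k c r z = cauchy1 k c r c).
  { apply Cmod_sub_le_0.
    apply Rle_trans with (0 * Cmod (z - c)); [|lra].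
    apply (mean_value (cdisc c r) _ (cauchy2 k c r)); auto.
    - apply cdisc_convex.
    - intros w Hw. now apply cauchy1_cdiff with (M := r).
    - intros w Hw. rewrite Hd by auto. rewrite Cmod_0. lra.
    - apply cdisc_center; lra. }
  rewrite E. unfold cauchy1.
  rewrite (Cint_derive (fun t => 0 + t * Ci)%C); [rewrite RtoC_mult; ring| |].
  - intros t. replace (k t * / (circ c r t - c))%C with Ci; [apply rdiff_line|].
    unfold k. field. apply circ_sub_neq. rewrite Cmod_sub_eq_0. lra.
  - intros t. apply rcont_mult; auto. apply kernel_rcont. rewrite Cmod_sub_eq_0. lra.
Qed.

(** Contract the circle to [z]: replace [f] by its value at [z + s * (circ c r t - z)]. The
    [s]-derivative of the integral is the integral of an exact derivative over a period, so the
    values at [s = 1] and [s = 0] agree, and the latter is [cauchy_kernel_integral]. *)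
Lemma cauchy_formula (f f' : C -> C) (c z : C) (r R0 : R) :
  hol (cdisc c R0) f f' -> r < R0 -> Cmod (z - c) < r ->
  cauchy1 (fun t => f (circ c r t) * (Ci * (circ c r t - c)))%C c r z = (2 * PI * Ci * f z)%C.
Proof.
  intros Hf Hr Hz. assert (P := Cmod_ge_0 (z - c)%C).
  (* The parameter [s] runs slightly beyond [[0, 1]], so that two-sided derivatives exist at both
     ends; this margin keeps the contracted points inside radius [R0]. *)
  assert (He : 0 < (R0 - r) / (4 * r)) by (apply Rdiv_lt_0_compat; lra).
  assert (Hin : forall s t, - ((R0 - r) / (4 * r)) < s < 1 + (R0 - r) / (4 * r) ->
    cdisc c R0 (z + s * (circ c r t - z))%C).
  { intros s t Hs. unfold cdisc.
    replace (z + s * (circ c r t - z) - c)%C with ((1 - s)%R * (z - c) + s * (circ c r t - c))%C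
      by (rewrite RtoC_minus; ring).
    eapply Rle_lt_trans; [apply Cmod_triangle|]. rewrite !Cmod_mult, !Cmod_R, circ_mod by lra.
    assert (Q : (R0 - r) / (4 * r) * r = (R0 - r) / 4) by (field; lra).
    assert (T1 : Rabs (1 - s) * Cmod (z - c) <= Rabs (1 - s) * r)
      by (apply Rmult_le_compat_l; [apply Rabs_pos|lra]).
    assert (T2 : Rabs (1 - s) + Rabs s <= 1 + 2 * ((R0 - r) / (4 * r))).
    { unfold Rabs. destruct (Rcase_abs (1 - s)), (Rcase_abs s); lra. }
    apply (Rmult_le_compat_r r) in T2; [|lra]. lra. }
  set (K := fun (s t : R) => (f (z + s * (circ c r t - z)) * (Ci * (circ c r t - c) * / (circ c r t - z)))%C).
  set (K' := fun (s t : R) => (f' (z + s * (circ c r t - z)) * (Ci * (circ c r t - c)))%C).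
  assert (cP : forall s t, rcont (fun t => z + s * (circ c r t - z))%C t).
  { intros s t. apply rcont_plus; [apply rcont_const|]. apply rcont_mult; [apply rcont_const|].
    apply rcont_minus; [apply circ_rcont|apply rcont_const]. }
  assert (cz : forall t, rcont (fun t => Ci * (circ c r t - c))%C t).
  { intros t. apply rcont_mult; [apply rcont_const|].
    apply rcont_minus; [apply circ_rcont|apply rcont_const]. }
  assert (HJ : forall s, 0 <= s <= 1 -> rdiff (fun s => Cint (K s) 0 (2 * PI)) s (Cint (K' s) 0 (2 * PI))).
  { intros s Hs. apply rdiff_Cint_param with (eta := (R0 - r) / (4 * r)); auto.
    - intros u t Hu. apply Rabs_lt_between' in Hu. unfold K, K'.
      assert (N := circ_sub_neq c z r t Hz).
      apply rdiff_ext_loc with (r := 1)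
        (z := fun u => ((fun w => f w * (Ci * (circ c r t - c) * / (circ c r t - z))) (z + u * (circ c r t - z)))%C);
        [lra | auto |].
      replace (f' (z + u * (circ c r t - z)) * (Ci * (circ c r t - c)))%C with
        ((f' (z + u * (circ c r t - z)) * (Ci * (circ c r t - c) * / (circ c r t - z))
          + f (z + u * (circ c r t - z)) * 0) * (circ c r t - z))%C by (field; auto).
      apply (cdiff_rdiff (fun w => f w * (Ci * (circ c r t - c) * / (circ c r t - z)))%C
        (fun u => z + u * (circ c r t - z))%C); [|apply rdiff_line].
      apply (cdiff_mult f (fun _ => (Ci * (circ c r t - c) * / (circ c r t - z))%C)); [|apply cdiff_const].
      apply Hf, Hin. lra.
    - intros t. unfold jcont, K'. 
      apply (ccont_mult (fun p => f' (z + Re p * (circ c r (Im p) - z))%C)).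
      + apply (ccont_comp f' (fun p => z + Re p * (circ c r (Im p) - z))%C).
        * exact (proj2 (Hf _ (Hin s t ltac:(lra)))).
        * apply ccont_plus; [apply ccont_const|]. apply ccont_mult; [apply (jcont_fst s t)|].
          apply ccont_minus; [|apply ccont_const]. apply (jcont_snd (circ c r) s t), circ_rcont.
      + apply (jcont_snd (fun t => Ci * (circ c r t - c))%C s t), cz.
    - intros u t Hu. apply Rabs_lt_between' in Hu. unfold K. apply rcont_mult.
      + apply (ccont_rcont f (fun t => z + u * (circ c r t - z))%C); [|apply cP].
        eapply cdiff_cont, Hf, Hin. lra.
      + apply rcont_mult; [apply cz | now apply kernel_rcont]. }
  assert (HJ0 : forall s, 0 <= s <= 1 -> Cint (K' s) 0 (2 * PI) = 0%C).
  { intros s Hs. destruct (Req_dec s 0) as [E|E].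
    - subst s. rewrite (Cint_derive (fun t => f' z * circ c r t)%C); [rewrite circ_period; ring| |].
      + intros t. unfold K'. replace (z + 0 * (circ c r t - z))%C with z by ring.
        apply (cdiff_rdiff (fun w => f' z * w)%C); [|apply circ_rdiff].
        assert (D := cdiff_cscal (f' z) (fun w => w) (circ c r t) 1 (cdiff_id _)).
        now rewrite Cmult_1_r in D.
      + intros t. unfold K'. apply rcont_mult; [|apply cz].
        apply (ccont_rcont f' (fun t => z + 0 * (circ c r t - z))%C); [|apply cP].
        exact (proj2 (Hf _ (Hin 0 t ltac:(lra)))).
    - assert (Es : RtoC s <> 0%C) by (intro H; apply E; now apply RtoC_inj).
      rewrite (Cint_derive (fun t => / s * f (z + s * (circ c r t - z)))%C); [rewrite circ_period; ring| |].
      + intros t. unfold K'.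
        apply rdiff_ext_loc with (r := 1)
          (z := fun t => ((fun w => / s * f (z + s * (w - z))) (circ c r t))%C); [lra|auto|].
        apply (cdiff_rdiff (fun w => / s * f (z + s * (w - z)))%C); [|apply circ_rdiff].
        set (w := circ c r t).
        assert (D : cdiff (fun w => z + s * (w - z))%C w (0 + s * (1 - 0))%C).
        { apply cdiff_plus; [apply cdiff_const|]. apply cdiff_cscal.
          apply cdiff_minus; [apply cdiff_id|apply cdiff_const]. }
        replace (f' (z + s * (w - z)))%C with (/ s * ((0 + s * (1 - 0)) * f' (z + s * (w - z))))%C
          by (field; auto).
        apply (cdiff_cscal (/ s)%C (fun w => f (z + s * (w - z))%C)).
        apply (cdiff_comp f (fun w => z + s * (w - z))%C); auto. apply Hf, Hin; lra.
      + intros t. unfold K'. apply rcont_mult; [|apply cz].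
        apply (ccont_rcont f' (fun t => z + s * (circ c r t - z))%C); [|apply cP].
        exact (proj2 (Hf _ (Hin s t ltac:(lra)))). }
  assert (E : Cint (K 1) 0 (2 * PI) = Cint (K 0) 0 (2 * PI)).
  { apply Cmod_sub_le_0. apply Rle_trans with (0 * (1 - 0)); [|lra].
    apply (curve_mean_value (fun s => Cint (K s) 0 (2 * PI)) (fun s => Cint (K' s) 0 (2 * PI))); auto; [lra|].
    intros t Ht. rewrite HJ0 by auto. rewrite Cmod_0. lra. }
  transitivity (Cint (K 1) 0 (2 * PI)).
  - apply Cint_ext. intros t. unfold K.
    replace (z + 1 * (circ c r t - z))%C with (circ c r t) by ring. ring.
  - rewrite E, <- (cauchy_kernel_integral c z r Hz), Cmult_comm.
    unfold cauchy1. rewrite <- Cint_scal.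
    + apply Cint_ext. intros t. unfold K. replace (z + 0 * (circ c r t - z))%C with z by ring. ring.
    + intros t. apply rcont_mult; auto. now apply kernel_rcont.
Qed.

(** * Consequences of Cauchy's formula *)

Lemma hol_subset (A B : C -> Prop) (f f' : C -> C) :
  (forall z, B z -> A z) -> hol A f f' -> hol B f f'.
Proof. intros HAB H z Hz. apply H, HAB, Hz. Qed.

Lemma hol_ccont (A : C -> Prop) (f f' : C -> C) (z : C) : hol A f f' -> A z -> ccont f z.
Proof. intros H Hz. eapply cdiff_cont, H, Hz. Qed.

Lemma hol_mult (A : C -> Prop) (f f' g g' : C -> C) : hol A f f' -> hol A g g' ->
  hol A (fun z => f z * g z)%C (fun z => f' z * g z + f z * g' z)%C.
Proof.
  intros Hf Hg z Hz. destruct (Hf z Hz) as [F1 F2]. destruct (Hg z Hz) as [G1 G2]. split.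
  - now apply cdiff_mult.
  - apply ccont_plus; apply ccont_mult; auto; eapply cdiff_cont; eauto.
Qed.

Lemma hol_inv (A : C -> Prop) (f f' : C -> C) : (forall z, A z -> f z <> 0%C) -> hol A f f' ->
  hol A (fun z => / f z)%C (fun z => - (f' z * (/ f z * / f z)))%C.
Proof.
  intros Hn Hf z Hz. destruct (Hf z Hz) as [F1 F2]. split.
  - apply cdiff_inv; auto.
  - assert (c : ccont (fun z => / f z)%C z) by (apply ccont_inv; auto; eapply cdiff_cont; eauto).
    apply ccont_opp, ccont_mult; auto. now apply ccont_mult.
Qed.

Lemma hol_sub_const (A : C -> Prop) (f f' : C -> C) (a : C) : hol A f f' ->
  hol A (fun z => f z - a)%C f'.
Proof.
  intros Hf z Hz. destruct (Hf z Hz) as [F1 F2]. split; auto.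
  replace (f' z) with (f' z - 0)%C by ring. apply (cdiff_minus f (fun _ => a)); auto. apply cdiff_const.
Qed.

Lemma hol_ext (A : C -> Prop) (f g f' : C -> C) : Defs.open_set A ->
  (forall z, A z -> f z = g z) -> hol A f f' -> hol A g f'.
Proof.
  intros HA E Hf z Hz. destruct (Hf z Hz) as [F1 F2]. split; auto.
  destruct (HA z Hz) as [r [Hr B]]. apply cdiff_ext_loc with f r; auto.
Qed.

Lemma two_pi_i_neq : (2 * PI * Ci)%C <> 0%C.
Proof.
  intros H. apply (f_equal Im) in H. simpl in H. generalize PI_RGT_0. lra.
Qed.

Section Circle.
Variables (f f' : C -> C) (c : C) (r R0 : R).
Hypothesis f_hol : hol (cdisc c R0) f f'.
Hypothesis r_pos : 0 < r.
Hypothesis r_lt : r < R0.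

Definition circle_data (t : R) : C := (f (circ c r t) * (Ci * (circ c r t - c)))%C.

Lemma circ_in_disc (t : R) : cdisc c R0 (circ c r t).
Proof. unfold cdisc. rewrite circ_mod; lra. Qed.

Lemma circle_data_cont (t : R) : rcont circle_data t.
Proof.
  apply rcont_mult.
  - apply (ccont_rcont f (circ c r)); [|apply circ_rcont]. eapply hol_ccont; eauto. apply circ_in_disc.
  - apply rcont_mult; [apply rcont_const|]. apply rcont_minus; [apply circ_rcont|apply rcont_const].
Qed.

Lemma circle_data_bound (M : R) : (forall z, Cmod (z - c) = r -> Cmod (f z) <= M) ->
  forall t, Cmod (circle_data t) <= M * r.
Proof.
  intros HM t. unfold circle_data. rewrite !Cmod_mult, Cmod_Ci, circ_mod, Rmult_1_l by lra.
  apply Rmult_le_compat_r; [lra|]. apply HM, circ_mod. lra.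
Qed.

Lemma circle_data_bounded : exists M, forall t, Cmod (circle_data t) <= M.
Proof.
  destruct (closed_disc_bounded f c r) as [M HM].
  - intros z Hz. eapply hol_ccont; eauto. unfold cdisc. lra.
  - exists (M * r). apply circle_data_bound. intros z Hz. apply HM. lra.
Qed.

Lemma cauchy_formula_div (z : C) : Cmod (z - c) < r ->
  f z = (/ (2 * PI * Ci) * cauchy1 circle_data c r z)%C.
Proof.
  intros Hz. unfold circle_data. rewrite (cauchy_formula f f' c z r R0) by auto.
  field. split; intros H; apply two_pi_i_neq; rewrite H; ring.
Qed.

Lemma derive_cauchy2 (z : C) : Cmod (z - c) < r ->
  f' z = (/ (2 * PI * Ci) * cauchy2 circle_data c r z)%C.
Proof.
  intros Hz. destruct circle_data_bounded as [M HM].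
  apply (cdiff_unique f z); [apply f_hol; unfold cdisc; lra|].
  apply cdiff_ext_loc with (f := fun w => (/ (2 * PI * Ci) * cauchy1 circle_data c r w)%C)
    (r := r - Cmod (z - c)); [lra| |].
  - intros w Hw. symmetry. apply cauchy_formula_div. generalize (Cmod_sub_trans w z c). lra.
  - apply cdiff_cscal. apply cauchy1_cdiff with (M := M); auto. exact circle_data_cont.
Qed.
End Circle.

(** Locally [f'] is a Cauchy transform, hence differentiable with continuous derivative. The local
    derivatives are glued by choice and agree by [cdiff_unique]. *)
Lemma regularity (A : C -> Prop) (f f' : C -> C) : Defs.open_set A -> hol A f f' ->
  exists f'', hol A f' f''.
Proof.
  intros HA Hf.
  assert (HL : forall c, A c -> exists r f2, 0 < r /\ hol (cdisc c r) f' f2).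
  { intros c Hc. destruct (HA c Hc) as [R0 [HR B]].
    assert (Hd : hol (cdisc c R0) f f') by (apply (hol_subset A); auto).
    destruct (circle_data_bounded f f' c (R0 / 2) R0) as [M HM]; auto; try lra.
    set (k := circle_data f c (R0 / 2)) in *.
    exists (R0 / 2), (fun z => (/ (2 * PI * Ci) * (2 * cauchy3 k c (R0 / 2) z))%C).
    split; [lra|].
    apply hol_ext with (fun z => (/ (2 * PI * Ci) * cauchy2 k c (R0 / 2) z)%C).
    - apply cdisc_open.
    - intros z Hz. symmetry. apply (derive_cauchy2 f f' c (R0 / 2) R0); auto; lra.
    - assert (Hk : forall t, rcont k t) by (intros t; apply (circle_data_cont f f' c (R0 / 2) R0); auto; lra).
      intros z Hz. destruct (cauchy2_hol k c (R0 / 2) M Hk HM z Hz) as [D1 D2]. split.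
      + apply cdiff_cscal. auto.
      + apply ccont_mult; auto. apply ccont_const. }
  assert (HD : forall z, exists l, A z -> cdiff f' z l).
  { intros z. destruct (classic (A z)) as [Hz|Hz].
    - destruct (HL z Hz) as [r [f2 [Hr H]]]. exists (f2 z). intros _. apply H. now apply cdisc_center.
    - exists 0%C. tauto. }
  exists (fun z => proj1_sig (constructive_indefinite_description _ (HD z))).
  set (F := fun z => proj1_sig (constructive_indefinite_description _ (HD z))).
  assert (HF : forall z, A z -> cdiff f' z (F z)).
  { intros z. unfold F. destruct (constructive_indefinite_description _ (HD z)). auto. }
  intros z Hz. split; auto.
  destruct (HL z Hz) as [r [f2 [Hr H]]]. destruct (HA z Hz) as [r' [Hr' B]].
  apply ccont_ext_loc with f2 (Rmin r r'); [now apply Rmin_glb_lt| |].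
  - intros w Hw. apply (cdiff_unique f' w).
    + apply H. eapply Rlt_le_trans; [apply Hw|apply Rmin_l].
    + apply HF, B. eapply Rlt_le_trans; [apply Hw|apply Rmin_r].
  - apply H. now apply cdisc_center.
Qed.

(** The hypotheses concern the open disc, so Cauchy's formula is used on circles of radius [r < R0]
    and [r] then tends to [R0]. *)
Lemma cauchy_estimate (f f' : C -> C) (c : C) (R0 M : R) : 0 < R0 ->
  hol (cdisc c R0) f f' -> (forall z, cdisc c R0 z -> Cmod (f z) <= M) -> Cmod (f' c) * R0 <= M.
Proof.
  intros HR Hf HM.
  assert (P := Cmod_ge_0 (f' c)).
  assert (HM0 : 0 <= M) by (eapply Rle_trans; [apply Cmod_ge_0 | apply (HM c), cdisc_center; auto]).
  assert (H : forall r, 0 < r < R0 -> Cmod (f' c) * r <= M).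
  { intros r Hr. assert (Pi := PI_RGT_0).
    assert (Hc : Cmod (c - c) < r) by (rewrite Cmod_sub_eq_0; lra).
    rewrite (derive_cauchy2 f f' c r R0) by (auto; lra).
    assert (Hb := circle_data_bound f c r ltac:(lra) M).
    assert (Hn : Cmod (cauchy2 (circle_data f c r) c r c) <= M * r * (/ r * / r) * (2 * PI - 0)).
    { apply Cint_norm; [lra| |].
      - intros t. apply rcont_mult; [apply (circle_data_cont f f' c r R0); auto; lra|].
        apply rcont_mult; now apply kernel_rcont.
      - intros t. rewrite Cmod_mult. apply Rmult_le_compat; try apply Cmod_ge_0.
        + apply Hb. intros z Hz. apply HM. unfold cdisc. lra.
        + right. rewrite Cmod_mult, Cmod_inv, circ_mod by (try lra; now apply circ_sub_neq). reflexivity. }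
    rewrite Cmod_mult, Cmod_inv, !Cmod_mult, Cmod_Ci, !Cmod_R by apply two_pi_i_neq.
    rewrite !Rabs_pos_eq by lra.
    apply (Rmult_le_compat_l (/ (2 * PI * 1) * r)) in Hn.
    - replace (/ (2 * PI * 1) * r * (M * r * (/ r * / r) * (2 * PI - 0))) with M in Hn by (field; lra). lra.
    - apply Rmult_le_pos; [|lra]. apply Rlt_le, Rinv_0_lt_compat. lra. }
  apply Rnot_lt_le. intro HN.
  assert (Hp : 0 < Cmod (f' c)) by (destruct (Req_dec (Cmod (f' c)) 0) as [E|E]; [rewrite E in HN; lra | lra]).
  set (q := M / Cmod (f' c)).
  assert (Hq : Cmod (f' c) * q = M) by (unfold q; field; lra).
  assert (Hq2 : q < R0) by nra.
  assert (Hq0 : 0 <= q) by (apply Rmult_le_pos; [auto|apply Rlt_le, Rinv_0_lt_compat; auto]).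
  specialize (H ((q + R0) / 2) ltac:(lra)). nra.
Qed.

Lemma max_principle_center (f f' : C -> C) (c : C) (r R0 M : R) : 0 < r < R0 ->
  hol (cdisc c R0) f f' -> (forall z, Cmod (z - c) = r -> Cmod (f z) <= M) -> Cmod (f c) <= M.
Proof.
  intros Hr Hf HM. assert (Pi := PI_RGT_0).
  assert (Hc : Cmod (c - c) < r) by (rewrite Cmod_sub_eq_0; lra).
  rewrite (cauchy_formula_div f f' c r R0) by (auto; lra).
  assert (Hb := circle_data_bound f c r ltac:(lra) M HM).
  assert (Hn : Cmod (cauchy1 (circle_data f c r) c r c) <= M * r * / r * (2 * PI - 0)).
  { apply Cint_norm; [lra| |].
    - intros t. apply rcont_mult; [apply (circle_data_cont f f' c r R0); auto; lra|].
      now apply kernel_rcont.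
    - intros t. rewrite Cmod_mult. apply Rmult_le_compat; try apply Cmod_ge_0; auto.
      right. rewrite Cmod_inv, circ_mod by (try lra; now apply circ_sub_neq). reflexivity. }
  rewrite Cmod_mult, Cmod_inv, !Cmod_mult, Cmod_Ci, !Cmod_R by apply two_pi_i_neq.
  rewrite !Rabs_pos_eq by lra.
  apply (Rmult_le_compat_l (/ (2 * PI * 1))) in Hn.
  - replace (/ (2 * PI * 1) * (M * r * / r * (2 * PI - 0))) with M in Hn by (field; lra). lra.
  - apply Rlt_le, Rinv_0_lt_compat. lra.
Qed.

(** Subtracting Cauchy's formulas at [z] and [w] exhibits the quotient as the Cauchy transform of
    the density divided by [circ c r t - w], which is holomorphic across [z = w]. *)
Lemma difference_quotient (f f' : C -> C) (c w : C) (r R0 : R) : 0 < r < R0 ->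
  hol (cdisc c R0) f f' -> cdisc c r w ->
  exists Q Q', hol (cdisc c r) Q Q' /\ Q w = f' w /\
    forall z, cdisc c r z -> (f z - f w)%C = (Q z * (z - w))%C.
Proof.
  intros Hr Hf Hw.
  destruct (circle_data_bounded f f' c r R0) as [M HM]; auto; try lra.
  assert (Hk : forall t, rcont (circle_data f c r) t)
    by (intros t; apply (circle_data_cont f f' c r R0); auto; lra).
  set (k := fun t => (/ (2 * PI * Ci) * (circle_data f c r t * / (circ c r t - w)))%C).
  assert (Hkc : forall t, rcont k t).
  { intros t. apply rcont_mult; [apply rcont_const|]. apply rcont_mult; auto. now apply kernel_rcont. }
  assert (Hkb : forall t, Cmod (k t) <= Cmod (/ (2 * PI * Ci)) * (M * (2 / (r - Cmod (w - c))))).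
  { intros t. unfold k. rewrite !Cmod_mult. apply Rmult_le_compat_l; [apply Cmod_ge_0|].
    apply Rmult_le_compat; auto; try apply Cmod_ge_0.
    apply kernel_bound; auto. rewrite Cmod_sub_eq_0. unfold cdisc in Hw. lra. }
  exists (cauchy1 k c r), (cauchy2 k c r). split; [|split].
  - apply cauchy1_hol with (M := Cmod (/ (2 * PI * Ci)) * (M * (2 / (r - Cmod (w - c))))); auto.
  - rewrite (derive_cauchy2 f f' c r R0 Hf (proj1 Hr) (proj2 Hr) w) by auto.
    unfold cauchy1, cauchy2. rewrite <- Cint_scal.
    + apply Cint_ext. intros t. unfold k. ring.
    + intros t. apply rcont_mult; auto. apply rcont_mult; now apply kernel_rcont.
  - intros z Hz.
    rewrite (cauchy_formula_div f f' c r R0 Hf (proj2 Hr) z) by auto.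
    rewrite (cauchy_formula_div f f' c r R0 Hf (proj2 Hr) w) by auto.
    rewrite (Cmult_comm _ (z - w)). unfold cauchy1.
    assert (h1 : forall u, cdisc c r u -> forall t, rcont (fun t => circle_data f c r t * / (circ c r t - u))%C t).
    { intros u Hu t. apply rcont_mult; auto. now apply kernel_rcont. }
    rewrite <- !Cint_scal by (auto; intros t; apply rcont_mult; auto; now apply kernel_rcont).
    rewrite <- Cint_minus by (intros t; apply rcont_mult; [apply rcont_const|]; auto).
    apply Cint_ext. intros t. unfold k.
    transitivity (/ (2 * PI * Ci) * circle_data f c r t * (/ (circ c r t - z) - / (circ c r t - w)))%C; [ring|].
    rewrite (kernel_diff c w z r t) by auto. ring.
Qed.

(* If [f' z0 = 0], then the quotients [(f z0 - f w) / (z0 - w)] tend to [0] as [w -> z0].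
   But for [f' w <> 0] the function [z |-> (f z - f w) / (z - w)] has no zero, so the maximum
   principle for its inverse bounds it below at [z0], uniformly in [w]. *)
Lemma injective_derive_neq (A : C -> Prop) (f f' : C -> C) : Defs.open_set A -> hol A f f' ->
  (forall z w, A z -> A w -> f z = f w -> z = w) -> forall z, A z -> f' z <> 0%C.
Proof.
  intros HA Hf Hi z0 Hz0 E0. destruct (HA z0 Hz0) as [R0 [HR B]].
  assert (Hd : hol (cdisc z0 R0) f f') by (apply (hol_subset A); auto).
  set (r1 := R0 / 4). set (r := R0 / 2).
  destruct (compact_bounded (fun z => Cmod (z - z0) = r1) (fun z => / (f z - f z0))%C (Cmod z0 + r1)) as [m Hm].
  - intros z Hz. generalize (Cmod_triangle_rev z z0). lra.
  - intros z Hz. exists (Rabs (Cmod (z - z0) - r1)). split; [apply Rabs_pos_lt; lra|].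
    intros w Hw E. assert (T1 := Cmod_sub_trans z w z0). assert (T2 := Cmod_sub_trans w z z0).
    rewrite (Cmod_sub_sym z w) in T1. revert Hw. unfold Rabs. destruct Rcase_abs; lra.
  - intros z Hz. assert (Az : A z) by (apply B; unfold r1 in *; lra).
    apply ccont_inv.
    + intros E. assert (z = z0).
      { apply Hi; auto. replace (f z) with (f z - f z0 + f z0)%C by ring. rewrite E. ring. }
      subst z. rewrite Cmod_sub_eq_0 in Hz. unfold r1 in *. lra.
    + apply ccont_minus; [apply (hol_ccont A f f'); auto | apply ccont_const].
  - set (m1 := Rmax m 1).
    assert (Hm1 : 1 <= m1) by apply Rmax_r.
    assert (Hm' : forall z, Cmod (z - z0) = r1 -> / m1 <= Cmod (f z - f z0)).
    { intros z Hz. specialize (Hm z Hz). assert (Az : A z) by (apply B; unfold r1 in *; lra).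
      assert (N : (f z - f z0)%C <> 0%C).
      { intros E. assert (z = z0).
        { apply Hi; auto. replace (f z) with (f z - f z0 + f z0)%C by ring. rewrite E. ring. }
        subst z. rewrite Cmod_sub_eq_0 in Hz. unfold r1 in *. lra. }
      rewrite Cmod_inv in Hm by auto. apply Cmod_gt_0 in N.
      rewrite <- (Rinv_inv (Cmod (f z - f z0))). apply Rinv_le_contravar.
      - now apply Rinv_0_lt_compat.
      - eapply Rle_trans; [apply Hm|apply Rmax_l]. }
    assert (Hmp : 0 < / m1) by (apply Rinv_0_lt_compat; lra).
    assert (Hr1 : 0 < r1) by (unfold r1; lra).
    (* The constant [/ (8 * r1 * m1)] is half of the lower bound [/ (4 * r1 * m1)] for [|Q z0|] to
       come from the maximum principle. The second condition keeps [f w] within half of [/ m1] from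
       [f z0]. *)
    destruct (near_and z0 _ _ (near_and z0 _ _
      (proj1 (Hd z0 (cdisc_center z0 R0 HR)) (/ (8 * r1 * m1)) ltac:(apply Rinv_0_lt_compat; nra))
      (hol_ccont _ _ _ z0 Hd (cdisc_center z0 R0 HR) (/ m1 / 2) ltac:(lra)))
      (ex_intro _ r1 (conj Hr1 (fun w (H : Cmod (w - z0) < r1) => H)))) as [d [Hdp B0]].
    (* If [f'] vanished on the disc, [f] would be constant there, against injectivity. *)
    assert (HE : exists w, Cmod (w - z0) < d /\ f' w <> 0%C).
    { apply NNPP. intros HN.
      assert (Hz : forall w, cdisc z0 d w -> f' w = 0%C).
      { intros w Hw. apply NNPP. intro Q. apply HN. exists w. auto. }
      assert (Hw : cdisc z0 d (z0 + (d / 2)%R)%C).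
      { unfold cdisc. replace (z0 + (d / 2)%R - z0)%C with (RtoC (d / 2)%R) by ring.
        rewrite Cmod_R, Rabs_pos_eq; lra. }
      assert (E : f (z0 + (d / 2)%R)%C = f z0).
      { apply Cmod_sub_le_0. apply Rle_trans with (0 * Cmod (z0 + (d / 2)%R - z0)); [|lra].
        apply (mean_value (cdisc z0 d) f f'); auto.
        - apply cdisc_convex.
        - intros w Hw'. apply Hd. destruct (B0 w Hw'). unfold cdisc, r1 in *. lra.
        - intros w Hw'. rewrite Hz by auto. rewrite Cmod_0. lra.
        - apply cdisc_center; lra. }
      apply Hi in E; auto.
      - apply (f_equal Re) in E. rewrite re_plus in E. simpl in E. lra.
      - apply B. destruct (B0 _ Hw). unfold r1 in *. lra. }
    destruct HE as [w [Hw Hw']]. destruct (B0 w Hw) as [[B1 B2] Hwr].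
    destruct (difference_quotient f f' z0 w r R0) as [Q [Q' [HQ [HQw HQz]]]]; auto;
      [unfold r; lra | unfold cdisc, r, r1 in *; lra |].
    assert (HQn : forall z, cdisc z0 r z -> Q z <> 0%C).
    { intros z Hz Ez. destruct (classic (z = w)) as [e|n]; [subst; congruence|].
      apply n. apply Hi; [apply B; unfold cdisc, r in *; lra | apply B; unfold r1 in *; lra |].
      specialize (HQz z Hz). rewrite Ez in HQz.
      replace (f z) with (f z - f w + f w)%C by ring. rewrite HQz. ring. }
    assert (Hmax := max_principle_center (fun z => / Q z)%C _ z0 r1 r (2 * r1 * (2 * m1)) ltac:(unfold r1, r; lra)
      (hol_inv _ _ _ HQn HQ)).
    assert (Hz0r : cdisc z0 r z0) by (apply cdisc_center; unfold r; lra).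
    assert (Hlow : Cmod (/ Q z0) <= 2 * r1 * (2 * m1)).
    { apply Hmax. intros z Hz.
      assert (Hzr : cdisc z0 r z) by (unfold cdisc, r, r1 in *; lra).
      specialize (HQz z Hzr). apply (f_equal Cmod) in HQz. rewrite Cmod_mult in HQz.
      assert (T := Hm' z Hz). assert (T2 := Cmod_sub_trans (f z) (f w) (f z0)).
      assert (T3 := Cmod_sub_trans z z0 w). rewrite (Cmod_sub_sym z0 w) in T3.
      rewrite Cmod_inv by auto.
      assert (HQp := proj1 (Cmod_gt_0 _) (HQn z Hzr)).
      assert (K : / m1 / 2 <= Cmod (Q z) * (2 * r1)).
      { rewrite HQz in T2. assert (Cmod (Q z) * Cmod (z - w) <= Cmod (Q z) * (2 * r1))
          by (apply Rmult_le_compat_l; lra). lra. }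
      apply Rmult_le_reg_l with (Cmod (Q z)); auto. rewrite Rinv_r by lra.
      apply Rmult_le_reg_l with (/ m1 / 2); [lra|].
      replace (/ m1 / 2 * (Cmod (Q z) * (2 * r1 * (2 * m1)))) with (Cmod (Q z) * (2 * r1)) by (field; lra). lra. }
    rewrite Cmod_inv in Hlow by auto.
    assert (HQp := proj1 (Cmod_gt_0 _) (HQn z0 Hz0r)).
    specialize (HQz z0 Hz0r). apply (f_equal Cmod) in HQz. rewrite Cmod_mult in HQz.
    rewrite E0 in B1.
    replace (f w - f z0 - 0 * (w - z0))%C with (f w - f z0)%C in B1 by ring.
    rewrite Cmod_sub_sym in B1. rewrite HQz in B1. rewrite (Cmod_sub_sym z0 w) in B1.
    assert (Hwp : 0 < Cmod (w - z0)).
    { apply Cmod_gt_0. intros E. apply Hw'. replace w with (w - z0 + z0)%C by ring. rewrite E.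
      now replace (0 + z0)%C with z0 by ring. }
    apply Rmult_le_reg_r in B1; auto.
    assert (F : / (4 * r1 * m1) <= Cmod (Q z0)).
    { rewrite <- (Rinv_inv (Cmod (Q z0))). apply Rinv_le_contravar; [now apply Rinv_0_lt_compat | lra]. }
    assert (F2 : / (8 * r1 * m1) < / (4 * r1 * m1)).
    { assert (0 < r1 * m1) by nra. apply Rinv_lt_contravar; [apply Rmult_lt_0_compat|]; lra. }
    lra.
Qed.

(** * Local inverses and the exponential *)

Lemma almost_linear (A : C -> Prop) (f f' : C -> C) (d : C) (e : R) (a b : C) : convex A ->
  (forall z, A z -> cdiff f z (f' z)) -> (forall z, A z -> Cmod (f' z - d) <= e) ->
  A a -> A b -> Cmod (f b - f a - d * (b - a)) <= e * Cmod (b - a).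
Proof.
  intros HA Hf Hd Ha Hb.
  replace (f b - f a - d * (b - a))%C with ((f b - d * b) - (f a - d * a))%C by ring.
  apply (mean_value A (fun z => f z - d * z)%C (fun z => f' z - d)%C); auto.
  intros z Hz. replace (f' z - d)%C with (f' z - d * 1)%C by ring.
  apply cdiff_minus; auto. apply cdiff_cscal, cdiff_id.
Qed.

Lemma almost_linear_lower (A : C -> Prop) (f f' : C -> C) (d : C) (a b : C) : convex A ->
  (forall z, A z -> cdiff f z (f' z)) -> (forall z, A z -> Cmod (f' z - d) <= Cmod d / 2) ->
  A a -> A b -> Cmod d / 2 * Cmod (b - a) <= Cmod (f b - f a).
Proof.
  intros HA Hf Hd Ha Hb. assert (H := almost_linear A f f' d _ a b HA Hf Hd Ha Hb).
  assert (T := Cmod_triangle_rev (d * (b - a))%C (f b - f a)%C).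
  rewrite (Cmod_sub_sym (d * (b - a))%C (f b - f a)%C), Cmod_mult in T. lra.
Qed.

(* A Newton step [z - (f z - w) / d] stays in the closed disc and halves [|f z - w|], so
   [|f z - w|] cannot be bounded away from [0] there. *)
Lemma newton_covering (f f' : C -> C) (a d w : C) (r : R) :
  (forall z, cdisc a r z -> cdiff f z (f' z)) ->
  (forall z, cdisc a r z -> Cmod (f' z - d) <= Cmod d / 2) ->
  d <> 0%C -> Cmod (w - f a) < r * (Cmod d / 2) -> exists z, cdisc a r z /\ f z = w.
Proof.
  intros Hf Hd Hd0 Hw. assert (Pd := proj1 (Cmod_gt_0 d) Hd0).
  assert (Pw := Cmod_ge_0 (w - f a)).
  set (q := Cmod (w - f a) / Cmod d).
  assert (Hq : q * Cmod d = Cmod (w - f a)) by (unfold q; field; lra).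
  assert (Hq0 : 0 <= q) by (apply Rmult_le_pos; [auto|apply Rlt_le, Rinv_0_lt_compat; auto]).
  assert (Hqr : 2 * q < r) by nra.
  apply NNPP. intro HN.
  (* From the closed disc of radius [r'] a Newton step lands within [r' / 2 + q] of [a], which is at
     most [r'] as soon as [r' >= 2 * q]; [r' < r] keeps the disc in the domain. *)
  set (r' := (2 * q + r) / 2).
  assert (Hin : forall z, Cmod (z - a) <= r' -> cdisc a r z) by (intros z Hz; unfold cdisc, r' in *; lra).
  assert (Hne : forall z, Cmod (z - a) <= r' -> (f z - w)%C <> 0%C).
  { intros z Hz E. apply HN. exists z. split; auto. replace (f z) with (f z - w + w)%C by ring. rewrite E. ring. }
  destruct (compact_bounded (fun z => Cmod (z - a) <= r') (fun z => / (f z - w))%C (Cmod a + r')) as [m Hm].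
  - intros z Hz. generalize (Cmod_triangle_rev z a). lra.
  - apply closed_cdisc_avoid.
  - intros z Hz. apply ccont_inv; auto. apply ccont_minus; [|apply ccont_const].
    eapply cdiff_cont, Hf; auto.
  - assert (Ha : Cmod (a - a) <= r') by (rewrite Cmod_sub_eq_0; unfold r'; lra).
    assert (Hm0 : 0 < m).
    { eapply Rlt_le_trans; [|apply (Hm a Ha)]. apply Cmod_gt_0. intro E.
      assert (E1 := Cinv_r _ (Hne a Ha)). rewrite E in E1. apply (f_equal Re) in E1. revert E1.
      rewrite re_mult. simpl. lra. }
    assert (Hstep : forall z, Cmod (z - a) <= r' -> exists z', Cmod (z' - a) <= r' /\
      Cmod (f z' - w) <= / 2 * Cmod (f z - w)).
    { intros z Hz. exists (z - (f z - w) / d)%C.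
      assert (Hz' : Cmod (z - (f z - w) / d - a) <= r').
      { replace (z - (f z - w) / d - a)%C with ((- / d) * ((f z - f a - d * (z - a)) - (w - f a)))%C by (field; auto).
        rewrite Cmod_mult, Cmod_opp, Cmod_inv by auto.
        assert (T := almost_linear (cdisc a r) f f' d _ a z (cdisc_convex a r) Hf Hd ltac:(auto) ltac:(auto)).
        assert (T2 := Cmod_triangle (f z - f a - d * (z - a))%C (- (w - f a))%C). rewrite Cmod_opp in T2.
        apply Rmult_le_reg_l with (Cmod d); auto.
        rewrite <- Rmult_assoc, Rinv_r, Rmult_1_l by lra.
        assert (Cmod d / 2 * Cmod (z - a) <= Cmod d / 2 * r') by (apply Rmult_le_compat_l; lra).
        unfold Cminus in *. unfold r' in *. nra. }
      split; auto.
      assert (T := almost_linear (cdisc a r) f f' d _ z _ (cdisc_convex a r) Hf Hd ltac:(auto) (Hin _ Hz')).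
      replace (z - (f z - w) / d - z)%C with (- ((f z - w) / d))%C in T by ring.
      replace (f (z - (f z - w) / d) - f z - d * - ((f z - w) / d))%C
        with (f (z - (f z - w) / d) - w)%C in T by (field; auto).
      eapply Rle_trans; [apply T|]. rewrite Cmod_opp, Cmod_div by auto. right. field. lra. }
    assert (Hit : forall n, exists z, Cmod (z - a) <= r' /\ Cmod (f z - w) <= (/ 2) ^ n * Cmod (f a - w)).
    { intros n. induction n as [|n [z [Hz IH]]].
      - exists a. split; auto. simpl. lra.
      - destruct (Hstep z Hz) as [z' [Hz' H]]. exists z'. split; auto. simpl. lra. }
    destruct (pow_lt_1_zero (/ 2)) with (y := / (m * (Cmod (f a - w) + 1))) as [N HNn].
    { rewrite Rabs_pos_eq; lra. }
    { apply Rinv_0_lt_compat, Rmult_lt_0_compat; auto. generalize (Cmod_ge_0 (f a - w)). lra. }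
    destruct (Hit N) as [z [Hz Hb]]. specialize (HNn N ltac:(lia)).
    rewrite Rabs_pos_eq in HNn by (apply pow_le; lra).
    specialize (Hm z Hz). rewrite Cmod_inv in Hm by auto.
    assert (Pz := proj1 (Cmod_gt_0 _) (Hne z Hz)).
    assert (Pa := Cmod_ge_0 (f a - w)).
    apply (Rmult_le_compat_r _ _ _ (Rlt_le _ _ Pz)) in Hm. rewrite Rinv_l in Hm by lra.
    set (x := Cmod (f a - w)) in *.
    assert ((/ 2) ^ N * x <= / (m * (x + 1)) * x) by (apply Rmult_le_compat_r; lra).
    assert (F : m * (/ (m * (x + 1)) * x) < 1).
    { replace (m * (/ (m * (x + 1)) * x)) with (x / (x + 1)) by (field; lra).
      apply Rlt_div_l; lra. }
    assert (m * Cmod (f z - w) <= m * (/ (m * (x + 1)) * x)) by (apply Rmult_le_compat_l; lra). lra.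
Qed.

(** The Lipschitz bound on [psi] converts the remainder of [f], small relative to [psi w - psi v],
    into one small relative to [w - v]. *)
Lemma inverse_cdiff (f psi : C -> C) (v d : C) (r K : R) : 0 < r -> d <> 0%C ->
  cdiff f (psi v) d ->
  (forall w, Cmod (w - v) < r -> f (psi w) = w /\ Cmod (psi w - psi v) <= K * Cmod (w - v)) ->
  cdiff psi v (/ d)%C.
Proof.
  intros Hr Hd Hf H e He. assert (Pd := proj1 (Cmod_gt_0 d) Hd).
  set (K1 := Rabs K + 1). assert (HK1 : 0 < K1) by (unfold K1; generalize (Rabs_pos K); lra).
  destruct (Hf (e * Cmod d / K1)) as [s [Hs B]].
  { apply Rdiv_lt_0_compat; auto. now apply Rmult_lt_0_compat. }
  exists (Rmin r (s / K1)). split; [apply Rmin_glb_lt; auto; now apply Rdiv_lt_0_compat|].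
  intros w Hw. destruct (Rlt_Rmin _ _ _ Hw) as [Hw1 Hw2]. apply Rlt_div_r in Hw2; auto.
  destruct (H w Hw1) as [E1 E2].
  destruct (H v) as [E3 _]; [now rewrite Cmod_sub_eq_0|].
  assert (Pw := Cmod_ge_0 (w - v)).
  assert (E2' : Cmod (psi w - psi v) <= K1 * Cmod (w - v)).
  { eapply Rle_trans; [apply E2|]. apply Rmult_le_compat_r; auto. unfold K1. generalize (Rle_abs K). lra. }
  specialize (B (psi w) ltac:(lra)). rewrite E1, E3 in B.
  replace (psi w - psi v - / d * (w - v))%C with ((- / d) * (w - v - d * (psi w - psi v)))%C by (field; auto).
  rewrite Cmod_mult, Cmod_opp, Cmod_inv by auto.
  apply Rmult_le_reg_l with (Cmod d); auto.
  rewrite <- Rmult_assoc, Rinv_r, Rmult_1_l by lra.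
  eapply Rle_trans; [apply B|].
  apply Rle_trans with (e * Cmod d / K1 * (K1 * Cmod (w - v))).
  - apply Rmult_le_compat_l; auto. apply Rlt_le, Rdiv_lt_0_compat; auto. now apply Rmult_lt_0_compat.
  - right. field. lra.
Qed.

(** The image disc has the explicit radius [r * (Cmod d / 2)]: the flow needs it for a uniform life
    span, and the family of orbits for a whole interval of values of [Im G]. *)
Lemma local_inverse (f f' : C -> C) (a d : C) (r : R) :
  (forall z, cdisc a r z -> cdiff f z (f' z)) ->
  (forall z, cdisc a r z -> Cmod (f' z - d) <= Cmod d / 2) ->
  d <> 0%C ->
  exists psi, (0 < r -> psi (f a) = a) /\ forall w, cdisc (f a) (r * (Cmod d / 2)) w ->
    cdisc a r (psi w) /\ f (psi w) = w /\ f' (psi w) <> 0%C /\ cdiff psi w (/ f' (psi w))%C.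
Proof.
  intros Hf Hd Hd0. assert (Pd := proj1 (Cmod_gt_0 d) Hd0).
  assert (Hex : forall w, exists z, cdisc (f a) (r * (Cmod d / 2)) w -> cdisc a r z /\ f z = w).
  { intros w. destruct (classic (cdisc (f a) (r * (Cmod d / 2)) w)) as [H|H].
    - destruct (newton_covering f f' a d w r Hf Hd Hd0 H) as [z Hz]. exists z. auto.
    - exists a. tauto. }
  set (psi := fun w => proj1_sig (constructive_indefinite_description _ (Hex w))).
  assert (Hpsi : forall w, cdisc (f a) (r * (Cmod d / 2)) w -> cdisc a r (psi w) /\ f (psi w) = w).
  { intros w. unfold psi. destruct (constructive_indefinite_description _ (Hex w)). auto. }
  assert (Hlow : forall x y, cdisc a r x -> cdisc a r y -> Cmod d / 2 * Cmod (y - x) <= Cmod (f y - f x)).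
  { intros x y Hx Hy. apply (almost_linear_lower (cdisc a r) f f' d x y (cdisc_convex a r)); auto. }
  exists psi. split.
  - intros Hr. destruct (Hpsi (f a)) as [P1 P2].
    { apply cdisc_center. apply Rmult_lt_0_compat; lra. }
    apply Cmod_sub_le_0. specialize (Hlow a (psi (f a)) (cdisc_center a r Hr) P1).
    rewrite P2, Cmod_sub_eq_0 in Hlow. nra.
  - intros w Hw. destruct (Hpsi w Hw) as [P1 P2].
    assert (N : f' (psi w) <> 0%C).
    { intros E. specialize (Hd _ P1). rewrite E in Hd.
      replace (0 - d)%C with (- d)%C in Hd by ring. rewrite Cmod_opp in Hd. lra. }
    repeat split; auto.
    apply inverse_cdiff with (f := f) (r := r * (Cmod d / 2) - Cmod (w - f a)) (K := 2 / Cmod d); auto.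
    + unfold cdisc in Hw. lra.
    + intros w' Hw'. assert (Hw2 : cdisc (f a) (r * (Cmod d / 2)) w').
      { unfold cdisc in *. generalize (Cmod_sub_trans w' w (f a)). lra. }
      destruct (Hpsi w' Hw2) as [P3 P4]. split; auto.
      specialize (Hlow _ _ P1 P3). rewrite P2, P4 in Hlow.
      apply Rmult_le_reg_l with (Cmod d / 2); [lra|].
      replace (Cmod d / 2 * (2 / Cmod d * Cmod (w' - w))) with (Cmod (w' - w)) by (field; lra). auto.
Qed.

Lemma derive_near (A : C -> Prop) (f f' : C -> C) (a : C) : Defs.open_set A -> hol A f f' ->
  A a -> f' a <> 0%C -> exists r, 0 < r /\ forall z, cdisc a r z -> A z /\ Cmod (f' z - f' a) <= Cmod (f' a) / 2.
Proof.
  intros HA Hf Ha Hn. apply Cmod_gt_0 in Hn.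
  destruct (HA a Ha) as [r1 [Hr1 B1]].
  destruct (proj2 (Hf a Ha) (Cmod (f' a) / 2)) as [r2 [Hr2 B2]]; [lra|].
  exists (Rmin r1 r2). split; [now apply Rmin_glb_lt|]. intros z Hz. split.
  - apply B1. eapply Rlt_le_trans; [apply Hz|apply Rmin_l].
  - apply Rlt_le, B2. eapply Rlt_le_trans; [apply Hz|apply Rmin_r].
Qed.

Lemma cexp_plus (u v : C) : cexp (u + v) = (cexp u * cexp v)%C.
Proof.
  unfold cexp. rewrite re_plus, im_plus, exp_plus, cos_plus, sin_plus.
  apply injective_projections; simpl; ring.
Qed.

Lemma cexp_0 : cexp 0 = 1%C.
Proof. unfold cexp. simpl. rewrite exp_0, cos_0, sin_0. apply injective_projections; simpl; ring. Qed.

Lemma Cmod_cexp (v : C) : Cmod (cexp v) = exp (Re v).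
Proof.
  unfold cexp. replace (exp (Re v) * cos (Im v), exp (Re v) * sin (Im v))%R
    with (RtoC (exp (Re v)) * circ 0 1 (Im v) - RtoC (exp (Re v)) * 0)%C
    by (unfold circ; apply injective_projections; simpl; ring).
  replace (RtoC (exp (Re v)) * circ 0 1 (Im v) - RtoC (exp (Re v)) * 0)%C
    with (RtoC (exp (Re v)) * (circ 0 1 (Im v) - 0))%C by ring.
  rewrite Cmod_mult, circ_mod, Cmod_R, Rabs_pos_eq by (first [lra | apply Rlt_le, exp_pos]). ring.
Qed.

Lemma cexp_neq_0 (v : C) : cexp v <> 0%C.
Proof. apply Cmod_gt_0. rewrite Cmod_cexp. apply exp_pos. Qed.

Lemma cexp_2PI : cexp (2 * PI * Ci) = 1%C.
Proof.
  unfold cexp. replace (2 * PI * Ci)%C with (0, 2 * PI)%R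
    by (apply injective_projections; simpl; ring).
  simpl. rewrite exp_0, cos_2PI, sin_2PI. apply injective_projections; simpl; ring.
Qed.

Lemma cexp_ray_rdiff (w : C) (t : R) : rdiff (fun t => cexp (t * w)) t (w * cexp (t * w))%C.
Proof. destruct w. split; simpl; auto_derive; auto; unfold Rminus; ring. Qed.

Lemma cexp_cdiff_0 : cdiff cexp 0 1.
Proof.
  assert (B1 : forall w t, Cmod w <= 1 -> 0 <= t <= 1 -> Cmod (cexp (t * w) - 1) <= 3 * Cmod w).
  { intros w t Hw Ht.
    assert (I := curve_mean_value (fun t => cexp (t * w)) (fun t => w * cexp (t * w))%C 0 t (3 * Cmod w) (proj1 Ht)
      (fun s _ => cexp_ray_rdiff w s)). cbv beta in I.
    rewrite Cmult_0_l, cexp_0 in I. assert (P := Cmod_ge_0 w).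
    eapply Rle_trans; [apply I|nra].
    intros s Hs. rewrite Cmod_mult, Rmult_comm, Cmod_cexp, re_scal_l. apply Rmult_le_compat_r; auto.
    apply Rle_trans with (exp 1); [|apply exp_le_3].
    assert (Q := re_le_Cmod w). apply Rabs_le_between in Q.
    assert (T : s * Re w <= 1) by nra.
    destruct T as [T|T]; [left; now apply exp_increasing|right; now rewrite T]. }
  intros e He. exists (Rmin (e / 3) 1). split; [apply Rmin_glb_lt; lra|]. intros w Hw.
  rewrite cexp_0. replace (w - 0)%C with w in * by ring.
  apply Rlt_Rmin in Hw. assert (P := Cmod_ge_0 w).
  assert (I := curve_mean_value (fun t => cexp (t * w) - t * w)%C (fun t => w * cexp (t * w) - w)%C 0 1
    (3 * Cmod w * Cmod w) Rle_0_1). cbv beta in I.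
  replace (cexp w - 1 - 1 * w)%C with (cexp (1 * w) - 1 * w - (cexp (0 * w) - 0 * w))%C
    by (rewrite Cmult_1_l, Cmult_0_l, cexp_0; ring).
  eapply Rle_trans; [apply I|nra].
  - intros t _. apply rdiff_minus; [apply cexp_ray_rdiff|apply rdiff_ray].
  - intros t Ht. replace (w * cexp (t * w) - w)%C with ((cexp (t * w) - 1) * w)%C by ring.
    rewrite Cmod_mult. apply Rmult_le_compat_r; auto. apply B1; lra.
Qed.

Lemma cexp_cdiff (v : C) : cdiff cexp v (cexp v).
Proof.
  apply cdiff_ext_loc with (fun w => (cexp v * cexp (w - v))%C) 1; [lra| |].
  - intros w _. rewrite <- cexp_plus. f_equal. ring.
  - assert (D : cdiff (fun w => cexp (w - v)) v ((1 - 0) * 1)%C).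
    { apply (cdiff_comp cexp (fun w => w - v)%C).
      - replace (v - v)%C with (RtoC 0) by ring. apply cexp_cdiff_0.
      - apply cdiff_minus; [apply cdiff_id|apply cdiff_const]. }
    apply (cdiff_cscal (cexp v)) in D.
    replace (cexp v * ((1 - 0) * 1))%C with (cexp v) in D by ring. exact D.
Qed.

(** * Primitives on discs *)

Definition ramp (t : R) : R := (1 - cos t) / 2.

Lemma ramp_bound (t : R) : 0 <= ramp t <= 1.
Proof. unfold ramp. generalize (COS_bound t). lra. Qed.

Lemma ramp_rdiff (t : R) : rdiff (fun t => RtoC (ramp t)) t (RtoC (sin t / 2)).
Proof. unfold ramp. split; simpl; auto_derive; auto; lra. Qed.

Lemma ramp_rcont (t : R) : rcont (fun t => RtoC (ramp t)) t.
Proof. eapply rdiff_cont, ramp_rdiff. Qed.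

Lemma sin_rcont (t : R) : rcont (fun t => RtoC (sin t / 2)) t.
Proof.
  apply (rdiff_cont _ _ (RtoC (cos t / 2))). split; simpl; auto_derive; auto; lra.
Qed.

Lemma taylor2_bound (f f' f'' : C -> C) (c a b : C) (r B : R) :
  (forall z, cdisc c r z -> cdiff f z (f' z)) -> (forall z, cdisc c r z -> cdiff f' z (f'' z)) ->
  (forall z, cdisc c r z -> Cmod (f'' z) <= B) -> cdisc c r a -> cdisc c r b ->
  Cmod (f b - f a - f' a * (b - a)) <= B * (Cmod (b - a) * Cmod (b - a)).
Proof.
  intros Hf Hf' HB Ha Hb.
  (* On this convex set [f'] differs from [f' a] by at most [B * |b - a|], as [almost_linear]
     requires. *)
  set (A := fun z => cdisc c r z /\ Cmod (z - a) <= Cmod (b - a)).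
  assert (HA : convex A).
  { intros x y s [X1 X2] [Y1 Y2] Hs. split; [now apply cdisc_convex|].
    replace (x + s * (y - x) - a)%C with (RtoC (1 - s) * (x - a) + RtoC s * (y - a))%C
      by (rewrite RtoC_minus; ring).
    eapply Rle_trans; [apply Cmod_triangle|]. rewrite !Cmod_mult, !Cmod_R, !Rabs_pos_eq by lra.
    assert (s * Cmod (y - a) <= s * Cmod (b - a)) by (apply Rmult_le_compat_l; lra).
    assert ((1 - s) * Cmod (x - a) <= (1 - s) * Cmod (b - a)) by (apply Rmult_le_compat_l; lra). lra. }
  rewrite <- Rmult_assoc.
  apply (almost_linear A f f'); auto.
  - intros z Hz. apply Hf, Hz.
  - intros z [Z1 Z2]. apply Rle_trans with (B * Cmod (z - a)).
    + apply (mean_value (cdisc c r) f' f''); auto. apply cdisc_convex.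
    + apply Rmult_le_compat_l; auto. eapply Rle_trans; [apply Cmod_ge_0|apply (HB a Ha)].
  - split; auto. rewrite Cmod_sub_eq_0. apply Cmod_ge_0.
  - split; auto. lra.
Qed.

(* The primitive is the integral along radii, parametrised by [ramp] over [[0, PI]]: this way the
   integrand is defined and continuous for all real parameters. *)
Lemma disc_primitive (f f' : C -> C) (c : C) (r R0 : R) : 0 < r < R0 -> hol (cdisc c R0) f f' ->
  exists q : C -> C, q c = 0%C /\ forall z, cdisc c r z -> cdiff q z (f z).
Proof.
  intros Hr Hf.
  destruct (regularity _ f f' (cdisc_open c R0) Hf) as [f'' Hf'].
  destruct (closed_disc_bounded f'' c r) as [B HB].
  { intros z Hz. apply Hf'. unfold cdisc. lra. }
  set (K := fun (t : R) (z : C) => (f (c + ramp t * (z - c)) * RtoC (sin t / 2))%C).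
  set (p := fun (z : C) (t : R) => (c + ramp t * (z - c))%C).
  assert (Hp : forall z t, cdisc c r z -> cdisc c r (p z t)).
  { intros z t Hz. apply cdisc_convex; auto; [apply cdisc_center; lra|apply ramp_bound]. }
  assert (Hsub : forall z, cdisc c r z -> cdisc c R0 z) by (intros z; unfold cdisc; lra).
  assert (cp : forall z t, rcont (p z) t).
  { intros z t. apply rcont_plus; [apply rcont_const|].
    apply rcont_mult; [apply ramp_rcont|apply rcont_const]. }
  assert (cf : forall z t, cdisc c r z -> rcont (fun t => f (p z t)) t).
  { intros z t Hz. apply (ccont_rcont f (p z)); [|apply cp].
    apply (hol_ccont _ f f' _ Hf). auto. }
  assert (cf' : forall z t, cdisc c r z -> rcont (fun t => f' (p z t)) t).
  { intros z t Hz. apply (ccont_rcont f' (p z)); [|apply cp].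
    apply (hol_ccont _ f' f'' _ Hf'). auto. }
  exists (fun z => (z - c) * Cint (fun t => K t z) 0 PI)%C. split; [ring|].
  intros z Hz.
  assert (D : cdiff (fun z => Cint (fun t => K t z) 0 PI) z
    (Cint (fun t => f' (p z t) * (ramp t * RtoC (sin t / 2)))%C 0 PI)).
  { apply cdiff_Cint_param with (d := r - Cmod (z - c)) (B := B); [generalize PI_RGT_0; lra | unfold cdisc in Hz; lra | | |].
    - intros t w Hw. apply rcont_mult; [|apply sin_rcont]. apply cf.
      unfold cdisc in *. generalize (Cmod_sub_trans w z c). lra.
    - intros t. apply rcont_mult; [now apply cf'|]. apply rcont_mult; [apply ramp_rcont|apply sin_rcont].
    - intros t w Hw. assert (Hw' : cdisc c r w).
      { unfold cdisc in *. generalize (Cmod_sub_trans w z c). lra. }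
      assert (T := taylor2_bound f f' f'' c (p z t) (p w t) r B
        (fun z Hz => proj1 (Hf z (Hsub z Hz))) (fun z Hz => proj1 (Hf' z (Hsub z Hz)))
        (fun z Hz => HB z (Rlt_le _ _ Hz)) (Hp z t Hz) (Hp w t Hw')).
      replace (p w t - p z t)%C with (ramp t * (w - z))%C in T by (unfold p; ring).
      replace (K t w - K t z - f' (p z t) * (ramp t * RtoC (sin t / 2)) * (w - z))%C
        with ((f (p w t) - f (p z t) - f' (p z t) * (ramp t * (w - z))) * RtoC (sin t / 2))%C
        by (unfold K, p; ring).
      rewrite Cmod_mult, Cmod_R. rewrite !Cmod_mult, !Cmod_R in T.
      assert (Hs : Rabs (sin t / 2) <= 1) by (apply Rabs_le; generalize (SIN_bound t); lra).
      assert (Hrp := ramp_bound t). rewrite (Rabs_pos_eq (ramp t)) in T by lra.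
      assert (HB0 : 0 <= B) by (eapply Rle_trans; [apply Cmod_ge_0|apply (HB z (Rlt_le _ _ Hz))]).
      assert (Pz := Cmod_ge_0 (w - z)).
      set (x := Cmod (f (p w t) - f (p z t) - f' (p z t) * (ramp t * (w - z)))) in *.
      apply Rle_trans with (x * 1).
      + apply Rmult_le_compat_l; auto. apply Cmod_ge_0.
      + rewrite Rmult_1_r. eapply Rle_trans; [apply T|]. apply Rmult_le_compat_l; auto.
        apply Rmult_le_compat; try apply Rmult_le_pos; try lra;
        rewrite <- (Rmult_1_l (Cmod (w - z))) at 2; apply Rmult_le_compat_r; lra. }
  assert (D2 := cdiff_mult (fun z => z - c)%C _ z _ _
    (cdiff_minus _ _ z _ _ (cdiff_id z) (cdiff_const c z)) D).
  cbv beta in D2.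
  assert (ck : forall t, rcont (fun t => K t z) t).
  { intros t. apply rcont_mult; [now apply cf|apply sin_rcont]. }
  assert (ck' : forall t, rcont (fun t => f' (p z t) * (ramp t * RtoC (sin t / 2)))%C t).
  { intros t. apply rcont_mult; [now apply cf'|]. apply rcont_mult; [apply ramp_rcont|apply sin_rcont]. }
  assert (E : ((1 - 0) * Cint (fun t => K t z) 0 PI + (z - c) *
    Cint (fun t => f' (p z t) * (ramp t * RtoC (sin t / 2))) 0 PI)%C = f z); [|rewrite E in D2; exact D2].
  rewrite <- (Cint_scal (z - c)) by auto.
  replace ((1 - 0) * Cint (fun t => K t z) 0 PI)%C with (Cint (fun t => K t z) 0 PI) by ring.
  assert (ck2 : forall t, rcont (fun t => (z - c) * (f' (p z t) * (ramp t * RtoC (sin t / 2))))%C t).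
  { intros t. apply rcont_mult; auto. apply rcont_const. }
  rewrite <- Cint_plus by auto.
  (* The sum of the two integrands is the [t]-derivative of [ramp t * f (p z t)], which runs from 0
     to [f z]. *)
  rewrite (Cint_derive (fun t => RtoC (ramp t) * f (p z t))%C).
  - unfold ramp, p. rewrite cos_PI, cos_0.
    replace (ramp PI) with 1 by (unfold ramp; rewrite cos_PI; lra).
    replace ((1 - -1) / 2) with 1 by lra. replace ((1 - 1) / 2) with 0 by lra.
    replace (c + 1 * (z - c))%C with z by ring. ring.
  - intros t.
    set (u := RtoC (ramp t)).
    assert (D1 : cdiff (fun u => c + u * (z - c))%C u (z - c)%C).
    { replace (z - c)%C with (0 + (1 * (z - c) + u * 0))%C by ring.
      apply (cdiff_plus (fun _ => c)); [apply cdiff_const|].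
      replace (0 + (1 * (z - c) + u * 0))%C with (z - c)%C by ring.
      apply (cdiff_mult (fun u => u) (fun _ => (z - c)%C)); [apply cdiff_id|apply cdiff_const]. }
    assert (D3 := cdiff_comp f (fun u => c + u * (z - c))%C u _ _ (proj1 (Hf _ (Hsub _ (Hp z t Hz)))) D1).
    assert (D4 := cdiff_mult (fun u => u) _ u _ _ (cdiff_id u) D3).
    assert (D5 := cdiff_rdiff _ (fun t => RtoC (ramp t)) t _ _ D4 (ramp_rdiff t)).
    match type of D5 with rdiff _ _ ?l => match goal with |- rdiff _ _ ?l' => replace l' with l end end.
    + exact D5.
    + unfold K, p, u. ring.
  - intros t. apply rcont_plus; auto.
Qed.

(** * Distortion of univalent functions *)

(** Take for [q] the primitive of [f' / f] that vanishes at [c]; then [f * cexp (- q)] has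
    derivative 0. *)
Lemma logarithm (f f' : C -> C) (c : C) (r R0 : R) : 0 < r < R0 -> hol (cdisc c R0) f f' ->
  (forall z, cdisc c R0 z -> f z <> 0%C) ->
  exists q : C -> C, q c = 0%C /\ forall z, cdisc c r z ->
    cdiff q z (f' z * / f z)%C /\ f z = (f c * cexp (q z))%C.
Proof.
  intros Hr Hf Hn.
  destruct (regularity _ f f' (cdisc_open c R0) Hf) as [f'' Hf'].
  destruct (disc_primitive _ _ c r R0 Hr (hol_mult _ _ _ _ _ Hf' (hol_inv _ _ _ Hn Hf))) as [q [Hq0 Hq]].
  exists q. split; auto. intros z Hz. split; [now apply Hq|].
  assert (Hsub : forall z, cdisc c r z -> cdisc c R0 z) by (intros w; unfold cdisc; lra).
  assert (D : forall w, cdisc c r w -> cdiff (fun w => f w * cexp (- q w))%C w 0).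
  { intros w Hw.
    assert (D1 := cdiff_comp cexp (fun w => (0 - q w)%C) w _ _ (cexp_cdiff _)
      (cdiff_minus (fun _ => 0%C) q w _ _ (cdiff_const 0 w) (Hq w Hw))).
    assert (D2 := cdiff_mult f _ w _ _ (proj1 (Hf w (Hsub w Hw))) D1). cbv beta in D2.
    assert (Nw := Hn w (Hsub w Hw)).
    match type of D2 with cdiff _ _ ?l => replace l with (RtoC 0) in D2 by (field; auto) end.
    apply cdiff_ext_loc with (f := fun w => (f w * cexp (0 - q w))%C) (r := 1); auto; [lra|].
    intros v _. do 2 f_equal. ring. }
  assert (E : (f z * cexp (- q z))%C = (f c * cexp (- q c))%C).
  { apply Cmod_sub_le_0. apply Rle_trans with (0 * Cmod (z - c)); [|lra].
    apply (mean_value (cdisc c r) (fun w => f w * cexp (- q w))%C (fun _ => 0%C)); auto.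
    - apply cdisc_convex.
    - intros w Hw. rewrite Cmod_0. lra.
    - apply cdisc_center; lra. }
  rewrite Hq0 in E. replace (- 0)%C with (RtoC 0) in E by ring. rewrite cexp_0, Cmult_1_r in E.
  rewrite <- E, <- Cmult_assoc, <- cexp_plus.
  replace (- q z + q z)%C with (RtoC 0) by ring. rewrite cexp_0. ring.
Qed.

(* Take [a] almost maximising [(R0 / 2 - |z - c|) |f' z / f z|].  If the maximum is large, [f' / f]
   is nearly constant on a large disc about [a], so a branch of [log f] there attains the value at
   [a] plus [2 pi i], contradicting injectivity. *)
Lemma univalent_nonvanishing (f f' : C -> C) (c : C) (R0 : R) : 0 < R0 ->
  hol (cdisc c R0) f f' -> (forall z, cdisc c R0 z -> f z <> 0%C) ->
  (forall z w, cdisc c R0 z -> cdisc c R0 w -> f z = f w -> z = w) ->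
  Cmod (f' c) * R0 <= 2048 * Cmod (f c).
Proof.
  intros HR Hf Hn Hi.
  destruct (regularity _ f f' (cdisc_open c R0) Hf) as [f'' Hf'].
  set (k := fun z => (f' z * / f z)%C).
  assert (Hk := hol_mult _ _ _ _ _ Hf' (hol_inv _ _ _ Hn Hf)). fold k in Hk.
  set (k' := fun z => (f'' z * / f z + f' z * - (f' z * (/ f z * / f z)))%C) in Hk.
  set (r := R0 / 2).
  destruct (closed_disc_bounded k c r) as [m Hm].
  { intros z Hz. apply (hol_ccont _ _ _ _ Hk). unfold cdisc, r in *. lra. }
  set (E := fun x => exists z, cdisc c r z /\ x = (r - Cmod (z - c)) * Cmod (k z)).
  assert (Hr : 0 < r) by (unfold r; lra).
  assert (Ec : E (r * Cmod (k c))).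
  { exists c. split; [now apply cdisc_center|]. rewrite Cmod_sub_eq_0. ring. }
  destruct (completeness E) as [S [HS1 HS2]].
  { exists (r * m). intros x [z [Hz ->]]. unfold cdisc in Hz. assert (P := Cmod_ge_0 (z - c)).
    assert (P2 := Cmod_ge_0 (k z)). specialize (Hm z ltac:(lra)).
    apply Rmult_le_compat; lra. }
  { exists (r * Cmod (k c)). auto. }
  assert (Sc := HS1 _ Ec).
  assert (Hfc : Cmod (f' c) = Cmod (k c) * Cmod (f c)).
  { unfold k. rewrite <- Cmod_mult. f_equal. field. apply Hn, cdisc_center, HR. }
  (* With [S > 1024] one gets [rho * d > 256] below, hence [rho / 16 * (d / 2) > 8 >= 2 * PI]: room
     enough for the logarithm to reach [2 * PI * Ci]. *)
  destruct (Rle_lt_dec S 1024) as [Hs|Hs].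
  { rewrite Hfc. replace (Cmod (k c) * Cmod (f c) * R0) with (2 * (r * Cmod (k c)) * Cmod (f c))
      by (unfold r; field). apply Rmult_le_compat_r; [apply Cmod_ge_0|lra]. }
  exfalso.
  assert (Ha : exists a, cdisc c r a /\ S / 2 < (r - Cmod (a - c)) * Cmod (k a)).
  { apply NNPP. intro N. assert (S <= S / 2); [|lra]. apply HS2.
    intros x [z [Hz ->]]. apply Rnot_lt_le. intro Q. apply N. exists z. auto. }
  destruct Ha as [a [Ha HSa]].
  (* In the disc of radius [rho] about [a] the weight [r - |z - c|] is still at least [rho], so
     near-maximality at [a] gives [|k z| <= S / rho <= 4 * d] there. *)
  set (rho := (r - Cmod (a - c)) / 2). set (d := Cmod (k a)) in *.
  assert (Hrho : 0 < rho) by (unfold rho, cdisc in *; lra).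
  assert (Hrd : S / 4 < rho * d) by (unfold rho; lra).
  assert (Hd : 0 < d) by (destruct (Rle_lt_dec d 0); auto; nra).
  assert (Hin : forall z, cdisc a rho z -> cdisc c R0 z /\ Cmod (k z) <= 4 * d).
  { intros z Hz. unfold cdisc in Hz, Ha. assert (T := Cmod_sub_trans z a c).
    assert (Hzc : cdisc c r z) by (unfold cdisc, rho in *; lra).
    split; [unfold cdisc, r in *; lra|].
    assert (Q : (r - Cmod (z - c)) * Cmod (k z) <= S) by (apply HS1; exists z; auto).
    assert (P := Cmod_ge_0 (k z)).
    assert (rho * Cmod (k z) <= (r - Cmod (z - c)) * Cmod (k z)).
    { apply Rmult_le_compat_r; auto. unfold rho. unfold rho in Hz. lra. }
    apply Rmult_le_reg_l with rho; lra. }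
  assert (Hk2 : hol (cdisc a rho) k k') by (apply (hol_subset (cdisc c R0)); auto; intros z Hz; now apply Hin).
  assert (Hk'b : forall z, cdisc a (rho / 2) z -> Cmod (k' z) <= 8 * d / rho).
  { intros z Hz. assert (Hsub : forall w, cdisc z (rho / 2) w -> cdisc a rho w).
    { intros w Hw. unfold cdisc in *. generalize (Cmod_sub_trans w z a). lra. }
    assert (Q := cauchy_estimate k k' z (rho / 2) (4 * d) ltac:(lra)
      (hol_subset _ _ _ _ Hsub Hk2) (fun w Hw => proj2 (Hin w (Hsub w Hw)))).
    apply Rle_div_r; lra. }
  assert (Hkk : forall z, cdisc a (rho / 16) z -> Cmod (k z - k a) <= Cmod (k a) / 2).
  { intros z Hz. assert (Q : Cmod (k z - k a) <= 8 * d / rho * Cmod (z - a)).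
    { apply (mean_value (cdisc a (rho / 2)) k k'); auto.
      - apply cdisc_convex.
      - intros w Hw. apply Hk2. unfold cdisc in *. lra.
      - apply cdisc_center. lra.
      - unfold cdisc in *. lra. }
    unfold cdisc in Hz. fold d. eapply Rle_trans; [apply Q|].
    apply Rle_trans with (8 * d / rho * (rho / 16)).
    - apply Rmult_le_compat_l; [|lra]. apply Rlt_le, Rdiv_lt_0_compat; lra.
    - right. field. lra. }
  destruct (logarithm f f' a (rho / 16) rho ltac:(lra)) as [q [Hq0 Hq]].
  { apply (hol_subset (cdisc c R0)); auto. intros z Hz. now apply Hin. }
  { intros z Hz. now apply Hn, Hin. }
  (* On this disc [k] varies by at most [8 * d / rho * (rho / 16) = d / 2], which is the covering
     hypothesis for [q] with derivative [k]. *)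
  destruct (newton_covering q k a (k a) (2 * PI * Ci)%C (rho / 16)) as [z [Hz1 Hz2]].
  - intros z Hz. now apply Hq.
  - exact Hkk.
  - now apply Cmod_gt_0.
  - rewrite Hq0. replace (2 * PI * Ci - 0)%C with (2 * PI * Ci)%C by ring.
    rewrite !Cmod_mult, Cmod_Ci, !Cmod_R, !Rabs_pos_eq by (generalize PI_RGT_0; lra).
    fold d. generalize PI_4. lra.
  - assert (Ez : z = a).
    { apply Hi.
      - apply Hin. unfold cdisc in *. lra.
      - apply Hin. now apply cdisc_center.
      - destruct (Hq z Hz1) as [_ F]. rewrite Hz2, cexp_2PI in F. rewrite F. ring. }
    subst z. rewrite Hq0 in Hz2. apply two_pi_i_neq. now rewrite <- Hz2.
Qed.

Definition halfplane (m : R) (v : C) : Prop := m < Re v.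

Lemma halfplane_disc (m : R) (v w : C) : cdisc v (Re v - m) w -> halfplane m w.
Proof.
  unfold cdisc, halfplane. intros H. assert (T := re_le_Cmod (w - v)).
  unfold Cminus in T at 1. rewrite re_plus, re_opp in T.
  apply Rabs_le_between in T. lra.
Qed.

Lemma halfplane_open (m : R) : Defs.open_set (halfplane m).
Proof.
  intros v Hv. exists (Re v - m). split; [unfold halfplane in Hv; lra|].
  intros w Hw. now apply (halfplane_disc m v).
Qed.

Lemma halfplane_convex (m : R) : convex (halfplane m).
Proof.
  intros a b s Ha Hb Hs. unfold halfplane in *.
  rewrite re_plus, re_scal_l. unfold Cminus. rewrite re_plus, re_opp.
  destruct (Req_dec s 0); [subst; lra|].
  assert (s * m < s * Re b) by (apply Rmult_lt_compat_l; lra).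
  assert ((1 - s) * m <= (1 - s) * Re a) by (apply Rmult_le_compat_l; lra). lra.
Qed.

(** Twice the factor in [derive_growth], because Cauchy's estimate is applied to [phi'] on a disc of
    half the radius. No attempt at sharpness. *)
Definition distortion : R := 16384 * exp 2048.

Section Distortion.
Variables (U : C -> Prop) (L L' phi phi' : C -> C) (m : R).
Hypothesis U_open : Defs.open_set U.
Hypothesis L_hol : hol U L L'.
Hypothesis phi_hol : hol (halfplane m) phi phi'.
Hypothesis phi_U : forall v, halfplane m v -> U (phi v) /\ L (phi v) = v.
Hypothesis L_H : forall z, U z -> halfplane m (L z) /\ phi (L z) = z.

Lemma inverse_derive (v : C) : halfplane m v -> (phi' v * L' (phi v))%C = 1%C.
Proof.
  intros Hv. destruct (phi_U v Hv) as [H1 H2].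
  apply (cdiff_unique (fun w => L (phi w)) v).
  - apply cdiff_comp; [now apply L_hol|now apply phi_hol].
  - destruct (halfplane_open m v Hv) as [r [Hr B]].
    apply cdiff_ext_loc with (fun w => w) r; auto; [|apply cdiff_id].
    intros w Hw. symmetry. now apply phi_U, B.
Qed.

Lemma phi'_neq_0 (v : C) : halfplane m v -> phi' v <> 0%C.
Proof.
  intros Hv E. assert (H := inverse_derive v Hv). rewrite E in H.
  apply (f_equal Re) in H. revert H. rewrite re_mult. simpl. lra.
Qed.

Lemma phi_inj (v w : C) : halfplane m v -> halfplane m w -> phi v = phi w -> v = w.
Proof. intros Hv Hw E. destruct (phi_U v Hv) as [_ <-]. destruct (phi_U w Hw) as [_ <-]. now rewrite E. Qed.

(* Otherwise [L] would map the disc of radius [2 |phi' v| (Re v - m)] about [phi v] into a disc of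
   radius [Re v - m], against Cauchy's estimate for [L' (phi v) = 1 / phi' v]. *)
Lemma omitted_value (v : C) : halfplane m v ->
  exists a, Cmod (a - phi v) < 2 * Cmod (phi' v) * (Re v - m) /\
    forall w, cdisc v (Re v - m) w -> phi w <> a.
Proof.
  intros Hv. apply NNPP. intro N. assert (Hv' := Hv). unfold halfplane in Hv'.
  assert (Hp := proj1 (Cmod_gt_0 _) (phi'_neq_0 v Hv)).
  set (rho := 2 * Cmod (phi' v) * (Re v - m)) in *.
  assert (Hrho : 0 < rho) by (unfold rho; repeat apply Rmult_lt_0_compat; lra).
  assert (H : forall a, cdisc (phi v) rho a -> U a /\ Cmod (L a - v) <= Re v - m).
  { intros a Ha. apply NNPP. intro Q. apply N. exists a. split; auto.
    intros w Hw E. apply Q. destruct (phi_U w (halfplane_disc m v w Hw)) as [P1 P2].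
    rewrite E in P1, P2. split; auto. rewrite P2. unfold cdisc in Hw. lra. }
  assert (Q := cauchy_estimate (fun z => L z - v)%C L' (phi v) rho (Re v - m) Hrho).
  assert (Q' : Cmod (L' (phi v)) * rho <= Re v - m).
  { apply Q.
    - apply hol_sub_const. apply (hol_subset U); auto. intros z Hz. now apply H.
    - intros z Hz. now apply H. }
  assert (D := f_equal Cmod (inverse_derive v Hv)). rewrite Cmod_mult, Cmod_1 in D.
  unfold rho in Q'. nra.
Qed.

(** For an omitted value [a], [univalent_nonvanishing] on discs of radius [r / 2] gives
    [|phi'| <= 4096 / r * |phi - a|]. Gronwall over a distance below [r / 2] costs the factor
    [exp 2048], and [|phi v - a| < 2 * |phi' v| * r] by the choice of [a]. *)
Lemma derive_growth (v z : C) : halfplane m v -> cdisc v ((Re v - m) / 2) z ->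
  Cmod (phi' z) <= 8192 * exp 2048 * Cmod (phi' v).
Proof.
  intros Hv Hz. assert (Hv' := Hv). unfold halfplane in Hv'. set (r := Re v - m) in *.
  assert (Hr : 0 < r) by (unfold r; lra).
  destruct (omitted_value v Hv) as [a [Ha Hav]]. fold r in Ha, Hav.
  assert (HK : forall w, cdisc v (r / 2) w -> Cmod (phi' w) <= 4096 / r * Cmod (phi w - a)).
  { intros w Hw.
    assert (Hsub : forall u, cdisc w (r / 2) u -> cdisc v r u).
    { intros u Hu. unfold cdisc in *. generalize (Cmod_sub_trans u w v). lra. }
    assert (Hsub2 : forall u, cdisc w (r / 2) u -> halfplane m u).
    { intros u Hu. apply (halfplane_disc m v). now apply Hsub. }
    assert (Q := univalent_nonvanishing (fun u => phi u - a)%C phi' w (r / 2) ltac:(lra)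
      (hol_sub_const _ _ _ a (hol_subset _ _ _ _ Hsub2 phi_hol))).
    assert (Q' : Cmod (phi' w) * (r / 2) <= 2048 * Cmod (phi w - a)).
    { apply Q.
      - intros u Hu E. apply (Hav u (Hsub u Hu)). replace (phi u) with (phi u - a + a)%C by ring. rewrite E. ring.
      - intros u1 u2 H1 H2 E. apply phi_inj; auto.
        replace (phi u1) with (phi u1 - a + a)%C by ring. rewrite E. ring. }
    replace (4096 / r * Cmod (phi w - a)) with (2048 * Cmod (phi w - a) / (r / 2)) by (field; lra).
    apply Rle_div_r; lra. }
  assert (Hvv : cdisc v (r / 2) v) by (apply cdisc_center; lra).
  assert (G : Cmod (phi z - a) <= Cmod (phi v - a) * exp (4096 / r * Cmod (z - v))).
  { apply (gronwall (cdisc v (r / 2)) (fun u => phi u - a)%C phi'); auto.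
    - apply cdisc_convex.
    - intros u Hu. apply (hol_sub_const (halfplane m) phi phi' a phi_hol).
      apply (halfplane_disc m v). fold r. unfold cdisc in *. lra. }
  assert (G2 : exp (4096 / r * Cmod (z - v)) <= exp 2048).
  { assert (T : 4096 / r * Cmod (z - v) <= 2048).
    { replace 2048 with (4096 / r * (r / 2)) by (field; lra).
      apply Rmult_le_compat_l; [apply Rlt_le, Rdiv_lt_0_compat; lra|]. unfold cdisc in Hz. lra. }
    destruct T as [T|T]; [left; now apply exp_increasing|right; now rewrite T]. }
  rewrite Cmod_sub_sym in Ha.
  assert (P1 := Cmod_ge_0 (phi v - a)). assert (P2 := exp_pos 2048).
  assert (P3 := exp_pos (4096 / r * Cmod (z - v))).
  eapply Rle_trans; [apply (HK z Hz)|].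
  apply Rle_trans with (4096 / r * (2 * Cmod (phi' v) * r * exp 2048)).
  - apply Rmult_le_compat_l; [apply Rlt_le, Rdiv_lt_0_compat; lra|].
    eapply Rle_trans; [apply G|]. apply Rmult_le_compat; lra.
  - right. field. lra.
Qed.

Lemma derive_distortion (phi'' : C -> C) (v : C) : hol (halfplane m) phi' phi'' -> halfplane m v ->
  Cmod (phi'' v) * (Re v - m) <= distortion * Cmod (phi' v).
Proof.
  intros H2 Hv. assert (Hv' := Hv). unfold halfplane in Hv'.
  assert (Q := cauchy_estimate phi' phi'' v ((Re v - m) / 2) (8192 * exp 2048 * Cmod (phi' v)) ltac:(lra)).
  assert (Q' : Cmod (phi'' v) * ((Re v - m) / 2) <= 8192 * exp 2048 * Cmod (phi' v)).
  { apply Q.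
    - apply (hol_subset (halfplane m)); auto. intros z Hz. apply (halfplane_disc m v). unfold cdisc in *. lra.
    - intros z Hz. now apply derive_growth. }
  unfold distortion. lra.
Qed.

(** Differentiating [phi' (L z) * L' z = 1] gives [L'' = - phi'' (L) * L'^3], which turns the
    distortion of [phi] into a bound by [|L'|^2], the scale natural to the flow. *)
Lemma inverse_distortion (L'' : C -> C) (z : C) : hol U L' L'' -> U z ->
  Cmod (L'' z) * (Re (L z) - m) <= distortion * (Cmod (L' z) * Cmod (L' z)).
Proof.
  intros HL2 Hz. destruct (L_H z Hz) as [Hv Ez].
  destruct (regularity _ phi phi' (halfplane_open m) phi_hol) as [phi'' H2].
  assert (D := derive_distortion phi'' (L z) H2 Hv).
  assert (I := inverse_derive (L z) Hv). rewrite Ez in I.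
  assert (J : (L' z * phi'' (L z) * L' z + phi' (L z) * L'' z)%C = 0%C).
  { apply (cdiff_unique (fun w => phi' (L w) * L' w)%C z).
    - apply (cdiff_mult (fun w => phi' (L w)) L').
      + apply (cdiff_comp phi' L); [now apply H2|now apply L_hol].
      + now apply HL2.
    - destruct (U_open z Hz) as [r [Hr B]].
      apply cdiff_ext_loc with (fun _ => 1%C) r; auto; [|apply cdiff_const].
      intros w Hw. symmetry. destruct (L_H w (B w Hw)) as [Hw1 Hw2].
      assert (Iw := inverse_derive (L w) Hw1). now rewrite Hw2 in Iw. }
  assert (E : L'' z = (- (phi'' (L z) * (L' z * L' z * L' z)))%C).
  { transitivity ((phi' (L z) * L' z) * L'' z)%C; [rewrite I; ring|].
    transitivity (L' z * ((L' z * phi'' (L z) * L' z + phi' (L z) * L'' z) - L' z * phi'' (L z) * L' z))%C; [ring|].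
    rewrite J. ring. }
  rewrite E, Cmod_opp, !Cmod_mult.
  assert (I' := f_equal Cmod I). rewrite Cmod_mult, Cmod_1 in I'.
  set (x := Cmod (phi'' (L z))) in *. set (y := Cmod (L' z)) in *. set (p := Cmod (phi' (L z))) in *.
  assert (Py : 0 <= y) by apply Cmod_ge_0.
  apply (Rmult_le_compat_r (y * y * y)) in D; [|repeat apply Rmult_le_pos; auto].
  replace (distortion * p * (y * y * y)) with (distortion * (y * y) * (p * y)) in D by ring.
  rewrite I' in D. lra.
Qed.
End Distortion.

(** * Components and poles *)

(** The inverse is chosen pointwise; by injectivity it coincides near each point with the local
    inverse of [L] and inherits its derivative. *)
Lemma inverse_hol (U : C -> Prop) (L L' : C -> C) (m : R) : Defs.open_set U -> hol U L L' ->
  (forall z w, U z -> U w -> L z = L w -> z = w) ->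
  (forall z, U z -> m < Re (L z)) -> (forall v, m < Re v -> exists z, U z /\ L z = v) ->
  exists phi phi', hol (halfplane m) phi phi' /\
    (forall v, halfplane m v -> U (phi v) /\ L (phi v) = v) /\
    (forall z, U z -> halfplane m (L z) /\ phi (L z) = z).
Proof.
  intros HU HL Hi Hre Hs.
  assert (Hex : forall v, exists z, halfplane m v -> U z /\ L z = v).
  { intros v. destruct (classic (halfplane m v)) as [H|H].
    - destruct (Hs v H) as [z Hz]. exists z. auto.
    - exists 0%C. tauto. }
  set (phi := fun v => proj1_sig (constructive_indefinite_description _ (Hex v))).
  assert (Hphi : forall v, halfplane m v -> U (phi v) /\ L (phi v) = v).
  { intros v. unfold phi. destruct (constructive_indefinite_description _ (Hex v)). auto. }
  assert (Hn := injective_derive_neq U L L' HU HL Hi).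
  assert (Hd : forall v, halfplane m v -> cdiff phi v (/ L' (phi v))%C).
  { intros v Hv. destruct (Hphi v Hv) as [Hp1 Hp2].
    destruct (derive_near U L L' (phi v) HU HL Hp1 (Hn _ Hp1)) as [r [Hr B]].
    destruct (local_inverse L L' (phi v) (L' (phi v)) r) as [psi [Q1 Q2]].
    - intros z Hz. apply HL, B, Hz.
    - intros z Hz. apply B, Hz.
    - now apply Hn.
    - assert (Pn := proj1 (Cmod_gt_0 _) (Hn _ Hp1)).
      set (s := r * (Cmod (L' (phi v)) / 2)) in *. rewrite Hp2 in Q1, Q2.
      assert (Hs0 : 0 < s) by (apply Rmult_lt_0_compat; lra).
      destruct (halfplane_open m v Hv) as [r2 [Hr2 B2]].
      apply cdiff_ext_loc with psi (Rmin s r2); [now apply Rmin_glb_lt| |].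
      + intros w Hw.
        destruct (Q2 w) as [q1 [q2 _]]; [eapply Rlt_le_trans; [apply Hw|apply Rmin_l]|].
        destruct (Hphi w) as [q3 q4]; [apply B2; eapply Rlt_le_trans; [apply Hw|apply Rmin_r]|].
        apply Hi; auto; [apply B, q1|congruence].
      + destruct (Q2 v) as [_ [_ [_ D]]]; [now apply cdisc_center|]. now rewrite Q1 in D. }
  exists phi, (fun v => / L' (phi v))%C. split; [|split]; auto.
  - intros v Hv. split; auto. apply ccont_inv; [apply Hn, Hphi, Hv|].
    apply (ccont_comp L' phi).
    + apply (proj2 (HL _ (proj1 (Hphi v Hv)))).
    + eapply cdiff_cont, Hd, Hv.
  - intros z Hz. assert (Hv : halfplane m (L z)) by now apply Hre.
    split; auto. destruct (Hphi _ Hv). apply Hi; auto.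
Qed.

(** Real induction along a segment from [O1] to [O2]: if the two open sets did not meet on [A], the
    segment could never leave [O1]. *)
Lemma convex_connected (A : C -> Prop) : convex A -> connected_set A.
Proof.
  intros HA O1 O2 H1 H2 Hcov [a [Aa Oa]] [b [Ab Ob]].
  apply NNPP. intro N.
  set (g := fun s : R => (a + s * (b - a))%C).
  assert (Hg : forall s, 0 <= s <= 1 -> A (g s)) by (intros; now apply HA).
  assert (gc : forall s, rcont g s) by (intros s; eapply rdiff_cont, rdiff_line).
  assert (H : forall s, 0 <= s <= 1 -> O1 (g s)).
  { apply real_induction.
    - intros s Hs Hlt. destruct (Hcov (g s) (Hg s Hs)) as [Q|Q]; auto.
      destruct (Req_dec s 0) as [e|e].
      { subst s. unfold g. now replace (a + 0 * (b - a))%C with a by ring. }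
      destruct (H2 _ Q) as [r [Hr B]]. destruct (gc s r Hr) as [d [Hd Bd]]. exfalso.
      assert (T1 := Rmax_l 0 (s - d / 2)). assert (T2 := Rmax_r 0 (s - d / 2)).
      assert (T3 : Rmax 0 (s - d / 2) < s) by (apply Rmax_lub_lt; lra).
      apply N. exists (g (Rmax 0 (s - d / 2))). split; [apply Hg; lra|]. split; [apply Hlt; lra|].
      apply B, Bd. rewrite Rabs_left; lra.
    - intros s Hs Hle. destruct (H1 _ (Hle s ltac:(lra))) as [r [Hr B]].
      destruct (gc s r Hr) as [d [Hd Bd]]. exists d. split; auto.
      intros u Hu _. apply B, Bd. rewrite Rabs_pos_eq; lra. }
  specialize (H 1 ltac:(lra)). unfold g in H. replace (a + 1 * (b - a))%C with b in H by ring.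
  apply N. now exists b.
Qed.

(** The union of [U] with a disc that meets it is connected, so maximality applies. Both the
    openness of [U] and the closedness of its far part rest on this. *)
Lemma component_absorbs_disc (U S : C -> Prop) (p : C) (r : R) : component_of U S ->
  (forall w, cdisc p r w -> S w) -> (exists w, U w /\ cdisc p r w) -> forall w, cdisc p r w -> U w.
Proof.
  intros [_ [HUS [Hcon Hmax]]] HS [w0 [Uw0 Dw0]] w Hw.
  apply (Hmax (fun z => U z \/ cdisc p r z)); [|now left| |now right].
  - intros O1 O2 H1 H2 Hcov [a [Ha Oa]] [b [Hb Ob]].
    assert (Hd := convex_connected _ (cdisc_convex p r)).
    assert (KU : (exists z, U z /\ O1 z) -> (exists z, U z /\ O2 z) -> exists z, (U z \/ cdisc p r z) /\ O1 z /\ O2 z).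
    { intros X Y. destruct (Hcon O1 O2 H1 H2 (fun z Hz => Hcov z (or_introl Hz)) X Y) as [z [Hz Oz]]. exists z. auto. }
    assert (KD : (exists z, cdisc p r z /\ O1 z) -> (exists z, cdisc p r z /\ O2 z) -> exists z, (U z \/ cdisc p r z) /\ O1 z /\ O2 z).
    { intros X Y. destruct (Hd O1 O2 H1 H2 (fun z Hz => Hcov z (or_intror Hz)) X Y) as [z [Hz Oz]]. exists z. auto. }
    destruct (Hcov w0 (or_introl Uw0)) as [O|O].
    + destruct Hb as [Hb|Hb]; [apply KU|apply KD]; first [now (exists w0) | now (exists b)].
    + destruct Ha as [Ha|Ha]; [apply KU|apply KD]; first [now (exists w0) | now (exists a)].
  - intros z [Hz|Hz]; auto.
Qed.

Lemma meromorphic_regular_open (f : C -> C) (P : C -> Prop) : meromorphic f P ->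
  Defs.open_set (fun z => ~ P z).
Proof.
  intros [H1 [H2 H3]] z Hz. destruct (H1 z) as [r [Hr B]]. exists r. split; auto.
  intros w Hw. destruct (Req_dec (Cmod (w - z)) 0) as [E|E].
  - replace w with z; auto. symmetry. apply Cmod_sub_le_0. lra.
  - apply B. generalize (Cmod_ge_0 (w - z)). lra.
Qed.

Lemma meromorphic_ccont (f : C -> C) (P : C -> Prop) (z : C) : meromorphic f P -> ~ P z -> ccont f z.
Proof.
  intros [H1 [H2 H3]] Hz. destruct (H2 z Hz) as [l Hl]. apply is_C_deriv_cdiff in Hl.
  eapply cdiff_cont; eauto.
Qed.

Lemma meromorphic_superlevel_open (f : C -> C) (P : C -> Prop) (M : R) : meromorphic f P ->
  Defs.open_set (fun z => P z \/ M < Cmod (f z)).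
Proof.
  intros Hm z Hz. destruct (classic (P z)) as [Pz|Pz].
  - destruct Hm as [H1 [H2 H3]]. destruct (H3 z Pz M) as [r [Hr B]]. exists r. split; auto.
    intros w Hw. destruct (Req_dec (Cmod (w - z)) 0) as [E|E].
    + left. replace w with z; auto. symmetry. apply Cmod_sub_le_0. lra.
    + right. apply B. generalize (Cmod_ge_0 (w - z)). lra.
  - destruct Hz as [|Hz]; [tauto|].
    destruct (meromorphic_ccont f P z Hm Pz (Cmod (f z) - M)) as [r [Hr B]]; [lra|].
    exists r. split; auto. intros w Hw. right. specialize (B w Hw).
    rewrite Cmod_sub_sym in B. generalize (Cmod_triangle_rev (f z) (f w)). lra.
Qed.

(** * Poles of a function and of its primitive *)

Section Poles.
Variables (g G : C -> C) (Pg PG : C -> Prop).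
Hypothesis g_mero : meromorphic g Pg.
Hypothesis G_mero : meromorphic G PG.
Hypothesis G_derive : forall z, ~ PG z -> is_C_deriv G z (g z).

(** If [g] were regular at [p], it would be bounded nearby, and integration along a horizontal
    segment towards [p] would keep [G] bounded on it. *)
Lemma pole_of_primitive (p : C) : PG p -> Pg p.
Proof.
  intros HG. apply NNPP. intro Hg.
  destruct (ccont_loc_bound g p (meromorphic_ccont g Pg p g_mero Hg)) as [d [Hd B]].
  destruct (proj1 G_mero p) as [r [Hr Br]].
  set (rho := Rmin d r / 2).
  assert (Hrho : 0 < rho) by (unfold rho; generalize (Rmin_glb_lt _ _ _ Hd Hr); lra).
  assert (L1 := Rmin_l d r). assert (L2 := Rmin_r d r).
  set (m := Cmod (g p) + 1) in *.
  assert (Hm : 0 <= m) by (unfold m; generalize (Cmod_ge_0 (g p)); lra).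
  destruct (proj2 (proj2 G_mero) p HG (Cmod (G (p + rho)) + m * rho)) as [s [Hs Bs]].
  set (t := Rmin s rho / 2).
  assert (Ht : 0 < t) by (unfold t; generalize (Rmin_glb_lt _ _ _ Hs Hrho); lra).
  assert (L3 := Rmin_l s rho). assert (L4 := Rmin_r s rho).
  assert (Ep : forall x, 0 < x -> Cmod (p + x - p) = x).
  { intros x Hx. replace (p + x - p)%C with (RtoC x) by ring. rewrite Cmod_R, Rabs_pos_eq; lra. }
  specialize (Bs (p + t)%C). rewrite Ep in Bs by auto. specialize (Bs ltac:(unfold t in *; lra)).
  assert (K : Cmod (G (p + rho * 1)%C - G (p + t * 1)%C) <= m * (rho - t)).
  { apply (curve_mean_value (fun x => G (p + x * 1)%C) (fun x => (g (p + x * 1) * 1)%C)).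
    - unfold t; lra.
    - intros x Hx. apply (cdiff_rdiff G (fun x => p + x * 1)%C); [|apply rdiff_line].
      apply is_C_deriv_cdiff, G_derive, Br. rewrite Cmult_1_r, Ep; unfold rho in *; lra.
    - intros x Hx. rewrite !Cmult_1_r. apply B. rewrite Ep; unfold rho in *; lra. }
  rewrite !Cmult_1_r, Cmod_sub_sym in K.
  assert (T := Cmod_triangle_rev (G (p + t)%C) (G (p + rho)%C)). nra.
Qed.

(* [G] is Lipschitz at [p], so Cauchy's estimate on [D(w, |w - p| / 2)] bounds [g] near [p]. *)
Lemma pole_of_derivative (p : C) : Pg p -> PG p.
Proof.
  intros Hg. apply NNPP. intro HG.
  destruct (cdiff_lipschitz G p (g p) (proj1 (is_C_deriv_cdiff _ _ _) (G_derive p HG))) as [d [Hd B]].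
  set (K := Cmod (g p) + 1) in *.
  assert (HK : 0 < K) by (unfold K; generalize (Cmod_ge_0 (g p)); lra).
  destruct (proj1 G_mero p) as [r [Hr Br]]. destruct (proj1 g_mero p) as [r' [Hr' Br']].
  destruct (proj2 (proj2 g_mero) p Hg (4 * K)) as [s [Hs Bs]].
  set (q := Rmin (Rmin d s) (Rmin r r')).
  assert (Hq : 0 < q) by (unfold q; repeat apply Rmin_glb_lt; auto).
  assert (Q1 : q <= d) by (unfold q; eapply Rle_trans; [apply Rmin_l|apply Rmin_l]).
  assert (Q2 : q <= s) by (unfold q; eapply Rle_trans; [apply Rmin_l|apply Rmin_r]).
  assert (Q3 : q <= r) by (unfold q; eapply Rle_trans; [apply Rmin_r|apply Rmin_l]).
  assert (Q4 : q <= r') by (unfold q; eapply Rle_trans; [apply Rmin_r|apply Rmin_r]).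
  set (w := (p + (q / 2)%R)%C).
  assert (Ew : Cmod (w - p) = q / 2).
  { unfold w. replace (p + (q / 2)%R - p)%C with (RtoC (q / 2)%R) by ring. rewrite Cmod_R, Rabs_pos_eq; lra. }
  assert (Hin : forall z, cdisc w (q / 4) z -> 0 < Cmod (z - p) < q).
  { intros z Hz. unfold cdisc in Hz. assert (T1 := Cmod_sub_trans z w p).
    assert (T2 := Cmod_sub_trans w z p). rewrite (Cmod_sub_sym w z) in T2. lra. }
  assert (E := cauchy_estimate (fun z => G z - G p)%C g w (q / 4) (K * q) ltac:(lra)).
  assert (F : Cmod (g w) * (q / 4) <= K * q).
  { apply E.
    - apply hol_sub_const. intros z Hz. specialize (Hin z Hz). split.
      + apply is_C_deriv_cdiff, G_derive, Br. lra.
      + apply (meromorphic_ccont g Pg); auto. apply Br'. lra.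
    - intros z Hz. specialize (Hin z Hz). eapply Rle_trans; [apply B; lra|].
      apply Rmult_le_compat_l; lra. }
  specialize (Bs w). rewrite Ew in Bs. specialize (Bs ltac:(lra)). nra.
Qed.

Lemma primitive_hol : hol (fun z => ~ Pg z) G g.
Proof.
  intros z Hz. split.
  - apply is_C_deriv_cdiff, G_derive. intro H. apply Hz. now apply pole_of_primitive.
  - now apply (meromorphic_ccont g Pg).
Qed.
End Poles.

(** * Ordinary differential equations *)

Definition loc_lipschitz (F : C -> C) (p : C) : Prop :=
  exists r K, 0 < r /\ forall x y, cdisc p r x -> cdisc p r y -> Cmod (F x - F y) <= K * Cmod (x - y).

(** Real induction: equality passes to limits by continuity, and Gronwall with the local Lipschitz
    constant extends it a little to the right. *)
Lemma ode_unique_right (F : C -> C) (w1 w2 : R -> C) (t0 t1 : R) : t0 <= t1 ->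
  (forall t, t0 <= t <= t1 -> rdiff w1 t (F (w1 t))) ->
  (forall t, t0 <= t <= t1 -> rdiff w2 t (F (w2 t))) ->
  (forall t, t0 <= t <= t1 -> loc_lipschitz F (w1 t)) ->
  w1 t0 = w2 t0 -> w1 t1 = w2 t1.
Proof.
  intros H01 H1 H2 HF H0. apply (real_induction (fun t => w1 t = w2 t) t0 t1); [| |lra].
  - intros s Hs Hlt. destruct (Req_dec s t0) as [e|e]; [now rewrite e|].
    apply Cmod_sub_le_0. apply Rnot_lt_le. intro N.
    destruct (rdiff_cont _ _ _ (H1 s Hs) (Cmod (w1 s - w2 s) / 2)) as [d1 [Hd1 B1]]; [lra|].
    destruct (rdiff_cont _ _ _ (H2 s Hs) (Cmod (w1 s - w2 s) / 2)) as [d2 [Hd2 B2]]; [lra|].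
    set (m := Rmin (Rmin d1 d2) (s - t0)).
    assert (Hm : 0 < m) by (repeat apply Rmin_glb_lt; lra).
    assert (Q1 : m <= Rmin d1 d2) by apply Rmin_l. assert (Q2 : m <= s - t0) by apply Rmin_r.
    assert (Q3 := Rmin_l d1 d2). assert (Q4 := Rmin_r d1 d2).
    assert (Ha : Rabs (s - m / 2 - s) = m / 2)
      by (replace (s - m / 2 - s) with (- (m / 2)) by ring; rewrite Rabs_Ropp, Rabs_pos_eq; lra).
    specialize (B1 (s - m / 2)). specialize (B2 (s - m / 2)). rewrite Ha in B1, B2.
    specialize (B1 ltac:(lra)). specialize (B2 ltac:(lra)). rewrite Hlt in B1 by lra.
    assert (T := Cmod_sub_trans (w1 s) (w2 (s - m / 2)) (w2 s)).
    rewrite (Cmod_sub_sym (w1 s) (w2 (s - m / 2))) in T. lra.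
  - intros s Hs Hle. assert (Es := Hle s ltac:(lra)).
    destruct (HF s ltac:(lra)) as [r [K [Hr HK]]].
    destruct (rdiff_cont _ _ _ (H1 s ltac:(lra)) r Hr) as [d1 [Hd1 B1]].
    destruct (rdiff_cont _ _ _ (H2 s ltac:(lra)) r Hr) as [d2 [Hd2 B2]].
    exists (Rmin d1 d2). split; [now apply Rmin_glb_lt|]. intros u Hu Hu1.
    assert (Q3 := Rmin_l d1 d2). assert (Q4 := Rmin_r d1 d2).
    assert (G : Cmod (w1 u - w2 u) <= Cmod (w1 s - w2 s) * exp (K * (u - s))).
    { apply (curve_gronwall (fun x => w1 x - w2 x)%C (fun x => F (w1 x) - F (w2 x))%C s u K); [lra| |].
      - intros x Hx. apply rdiff_minus; [apply H1|apply H2]; lra.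
      - intros x Hx. apply HK.
        + apply B1. rewrite Rabs_pos_eq; lra.
        + unfold cdisc. rewrite Es. apply B2. rewrite Rabs_pos_eq; lra. }
    apply Cmod_sub_le_0. rewrite Es, Cmod_sub_eq_0 in G. lra.
Qed.

Lemma rdiff_reverse (w : R -> C) (t : R) (d : C) : rdiff w (- t) d -> rdiff (fun s => w (- s)) t (- d)%C.
Proof.
  intros [H1 H2]. split.
  - replace (Re (- d)%C) with (-1 * Re d) by (rewrite re_opp; ring).
    apply (is_derive_comp (fun s => Re (w s)) (fun s => - s)).
    + assumption.
    + auto_derive; auto.
  - replace (Im (- d)%C) with (-1 * Im d) by (rewrite im_opp; ring).
    apply (is_derive_comp (fun s => Im (w s)) (fun s => - s)).
    + assumption.
    + auto_derive; auto.
Qed.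

Lemma ode_unique (F : C -> C) (w1 w2 : R -> C) (a b t0 t : R) : a < t0 < b -> a < t < b ->
  (forall t, a < t < b -> rdiff w1 t (F (w1 t))) ->
  (forall t, a < t < b -> rdiff w2 t (F (w2 t))) ->
  (forall t, a < t < b -> loc_lipschitz F (w1 t)) ->
  w1 t0 = w2 t0 -> w1 t = w2 t.
Proof.
  intros H0 Ht H1 H2 HF E. destruct (Rle_lt_dec t0 t) as [Hl|Hl].
  - apply (ode_unique_right F w1 w2 t0 t); auto; intros s Hs; [apply H1|apply H2|apply HF]; lra.
  (* Times before [t0] are reached by reversing time, which changes the sign of the field. *)
  - rewrite <- (Ropp_involutive t).
    apply (ode_unique_right (fun z => - F z)%C (fun s => w1 (- s)) (fun s => w2 (- s)) (- t0) (- t)); [lra| | | |].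
    + intros s Hs. apply rdiff_reverse, H1. lra.
    + intros s Hs. apply rdiff_reverse, H2. lra.
    + intros s Hs. destruct (HF (- s)) as [r [K [Hr HK]]]; [lra|]. exists r, K. split; auto.
      intros x y Hx Hy. replace (- F x - - F y)%C with (- (F x - F y))%C by ring. rewrite Cmod_opp. auto.
    + now rewrite Ropp_involutive.
Qed.

Lemma inverse_is_derive (f psi : R -> R) (v d r K : R) : 0 < r -> d <> 0 ->
  is_derive f (psi v) d ->
  (forall w, Rabs (w - v) < r -> f (psi w) = w /\ Rabs (psi w - psi v) <= K * Rabs (w - v)) ->
  is_derive psi v (/ d).
Proof.
  intros Hr Hd Hf H. apply is_derive_eps. intros e He. assert (Pd := Rabs_pos_lt d Hd).
  set (K1 := Rabs K + 1). assert (HK1 : 0 < K1) by (unfold K1; generalize (Rabs_pos K); lra).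
  destruct (proj1 (is_derive_eps _ _ _) Hf (e * Rabs d / K1)) as [s [Hs B]].
  { apply Rdiv_lt_0_compat; auto. now apply Rmult_lt_0_compat. }
  exists (Rmin r (s / K1)). split; [apply Rmin_glb_lt; auto; now apply Rdiv_lt_0_compat|].
  intros w Hw. destruct (Rlt_Rmin _ _ _ Hw) as [Hw1 Hw2]. apply Rlt_div_r in Hw2; auto.
  destruct (H w Hw1) as [E1 E2].
  destruct (H v) as [E3 _]; [unfold Rminus; now rewrite Rplus_opp_r, Rabs_R0|].
  assert (Pw := Rabs_pos (w - v)).
  assert (E2' : Rabs (psi w - psi v) <= K1 * Rabs (w - v)).
  { eapply Rle_trans; [apply E2|]. apply Rmult_le_compat_r; auto. unfold K1. generalize (Rle_abs K). lra. }
  specialize (B (psi w) ltac:(lra)). rewrite E1, E3 in B.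
  replace (psi w - psi v - (w - v) * / d) with ((- / d) * (w - v - (psi w - psi v) * d)) by (field; auto).
  rewrite Rabs_mult, Rabs_Ropp, Rabs_inv.
  apply Rmult_le_reg_l with (Rabs d); auto.
  rewrite <- Rmult_assoc, Rinv_r, Rmult_1_l by lra.
  eapply Rle_trans; [apply B|].
  apply Rle_trans with (e * Rabs d / K1 * (K1 * Rabs (w - v))).
  - apply Rmult_le_compat_l; auto. apply Rlt_le, Rdiv_lt_0_compat; auto. now apply Rmult_lt_0_compat.
  - right. field. lra.
Qed.

Lemma real_mean_value_lower (f f' : R -> R) (a b m : R) : a <= b ->
  (forall t, a <= t <= b -> is_derive f t (f' t)) -> (forall t, a <= t <= b -> m <= f' t) ->
  m * (b - a) <= f b - f a.
Proof.
  intros Hab Hd Hm.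
  assert (I := real_increasing (fun t => f t - m * t) (fun t => f' t - m * 1) a b Hab). cbv beta in I.
  cut (f a - m * a <= f b - m * b); [lra|]. apply I.
  - intros t Ht. apply (is_derive_minus f (fun t => m * t)); auto.
    apply is_derive_scal. apply (is_derive_id (K := R_AbsRing)).
  - intros t Ht. specialize (Hm t Ht). lra.
Qed.

(* [xi] inverts a primitive of [h]. *)
Lemma reparametrisation (h : R -> R) (X m : R) : 0 < X -> 0 < m ->
  (forall x, Rabs x < X -> continuous h x) -> (forall x, Rabs x < X -> m <= h x) ->
  exists xi : R -> R, xi 0 = 0 /\ forall t, Rabs t < m * (X / 2) ->
    Rabs (xi t) < X /\ is_derive xi t (/ h (xi t)).
Proof.
  intros HX Hm Hc Hh.
  set (T := fun x => RInt h 0 x).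
  assert (Hex : forall x, Rabs x < X -> ex_RInt h 0 x).
  { intros x Hx. apply (ex_RInt_continuous (V := R_CompleteNormedModule)). intros z Hz. apply Hc.
    apply Rabs_def2 in Hx. apply Rabs_def1.
    - eapply Rle_lt_trans; [apply Hz|]. apply Rmax_lub_lt; lra.
    - eapply Rlt_le_trans; [|apply Hz]. apply Rmin_glb_lt; lra. }
  assert (HT : forall x, Rabs x < X -> is_derive T x (h x)).
  { intros x Hx. apply (is_derive_RInt h T 0 x); auto.
    assert (P : 0 < X - Rabs x) by lra. exists (mkposreal _ P). intros y Hy.
    apply (RInt_correct (V := R_CompleteNormedModule)). apply Hex.
    change (Rabs (y - x) < X - Rabs x) in Hy.
    replace y with ((y - x) + x) by ring. eapply Rle_lt_trans; [apply Rabs_triang|lra]. }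
  assert (HT0 : T 0 = 0) by (unfold T; now rewrite RInt_point).
  assert (Hlow : forall x y, Rabs x < X -> Rabs y < X -> x <= y -> m * (y - x) <= T y - T x).
  { intros x y Hx Hy Hxy. apply Rabs_def2 in Hx. apply Rabs_def2 in Hy.
    apply real_mean_value_lower with h; auto; intros t Ht; [apply HT|apply Hh]; apply Rabs_def1; lra. }
  assert (Hin : forall x, Rabs x <= X / 2 -> Rabs x < X) by (intros; lra).
  assert (HXa : Rabs (X / 2) <= X / 2) by (rewrite Rabs_pos_eq; lra).
  assert (HXb : Rabs (- (X / 2)) <= X / 2) by (rewrite Rabs_Ropp, Rabs_pos_eq; lra).
  assert (H0 : Rabs 0 < X) by (rewrite Rabs_R0; lra).
  assert (Hsol : forall t, exists x, Rabs t < m * (X / 2) -> Rabs x < X /\ T x = t).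
  { intros t. destruct (Rlt_le_dec (Rabs t) (m * (X / 2))) as [Ht|Ht]; [|exists 0; lra].
    apply Rabs_def2 in Ht.
    assert (U1 := Hlow 0 (X / 2) H0 (Hin _ HXa) ltac:(lra)).
    assert (U2 := Hlow (- (X / 2)) 0 (Hin _ HXb) H0 ltac:(lra)).
    destruct (IVT_interv (fun x => T x - t) (- (X / 2)) (X / 2)) as [x [Hx Ex]]; try lra.
    - intros a Ha. apply continuity_pt_filterlim. apply (ex_derive_continuous (fun x => T x - t) a).
      exists (h a - 0). apply (is_derive_minus T (fun _ => t)).
      + apply HT, Hin, Rabs_le. lra.
      + apply (is_derive_const (K := R_AbsRing) (V := R_NormedModule)).
    - exists x. intros _. split; [apply Hin, Rabs_le; lra|lra]. }
  set (xi := fun t => proj1_sig (constructive_indefinite_description _ (Hsol t))).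
  assert (Hxi : forall t, Rabs t < m * (X / 2) -> Rabs (xi t) < X /\ T (xi t) = t).
  { intros t. unfold xi. destruct (constructive_indefinite_description _ (Hsol t)). auto. }
  assert (Hlip : forall s t, Rabs s < m * (X / 2) -> Rabs t < m * (X / 2) ->
    Rabs (xi s - xi t) <= / m * Rabs (s - t)).
  { intros s t Hs Ht. destruct (Hxi s Hs) as [S1 S2]. destruct (Hxi t Ht) as [T1 T2].
    apply Rmult_le_reg_l with m; auto. rewrite <- Rmult_assoc, Rinv_r, Rmult_1_l by lra.
    destruct (Rle_lt_dec (xi s) (xi t)) as [Q|Q].
    - specialize (Hlow _ _ S1 T1 Q). rewrite S2, T2 in Hlow.
      rewrite !Rabs_left1; nra.
    - specialize (Hlow _ _ T1 S1 ltac:(lra)). rewrite S2, T2 in Hlow.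
      rewrite !Rabs_pos_eq; nra. }
  assert (Hm0 : Rabs 0 < m * (X / 2)) by (rewrite Rabs_R0; apply Rmult_lt_0_compat; lra).
  exists xi. split.
  - destruct (Hxi 0 Hm0) as [Q1 Q2].
    destruct (Rtotal_order (xi 0) 0) as [Q|[Q|Q]]; auto.
    + specialize (Hlow _ _ Q1 H0 ltac:(lra)). nra.
    + specialize (Hlow _ _ H0 Q1 ltac:(lra)). nra.
  - intros t Ht. destruct (Hxi t Ht) as [Q1 Q2]. split; auto.
    apply inverse_is_derive with (f := T) (r := m * (X / 2) - Rabs t) (K := / m); auto; [lra| |].
    + specialize (Hh _ Q1). lra.
    + intros w Hw. assert (Hw' : Rabs w < m * (X / 2)).
      { replace w with ((w - t) + t) by ring. eapply Rle_lt_trans; [apply Rabs_triang|lra]. }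
      split; [now apply Hxi|]. now apply Hlip.
Qed.

Lemma rdiff_comp_real (z : R -> C) (xi : R -> R) (t l : R) (d : C) :
  rdiff z (xi t) d -> is_derive xi t l -> rdiff (fun s => z (xi s)) t (RtoC l * d)%C.
Proof.
  intros [H1 H2] H. split.
  - rewrite re_scal_l. now apply (is_derive_comp (fun s => Re (z s)) xi).
  - rewrite im_scal_l. now apply (is_derive_comp (fun s => Im (z s)) xi).
Qed.

Lemma Rbar_between (x : Rbar) (y : R) : Rbar_lt x y -> exists u : R, Rbar_lt x u /\ u < y.
Proof.
  destruct x as [x| |]; simpl; intros H.
  - exists ((x + y) / 2). lra.
  - tauto.
  - exists (y - 1). split; auto. lra.
Qed.

Lemma Rbar_between' (x : Rbar) (y : R) : Rbar_lt y x -> exists u : R, Rbar_lt u x /\ y < u.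
Proof.
  destruct x as [x| |]; simpl; intros H.
  - exists ((x + y) / 2). lra.
  - exists (y + 1). split; auto. lra.
  - tauto.
Qed.

(** * The flow of the conjugate of [g] *)

Section Flow.
Variables (g G g' : C -> C) (P : C -> Prop).
Hypothesis P_open : Defs.open_set (fun z => ~ P z).
Hypothesis G_hol : hol (fun z => ~ P z) G g.
Hypothesis g_hol : hol (fun z => ~ P z) g g'.

Definition flows (z : R -> C) (a b : R) : Prop :=
  forall t, a < t < b -> ~ P (z t) /\ rdiff z t (Cconj (g (z t))).

Lemma flow_lipschitz (p : C) : ~ P p -> loc_lipschitz (fun z => Cconj (g z)) p.
Proof.
  intros Hp. destruct (P_open p Hp) as [r1 [Hr1 B1]].
  destruct (ccont_loc_bound g' p (proj2 (g_hol p Hp))) as [r2 [Hr2 B2]].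
  exists (Rmin r1 r2), (Cmod (g' p) + 1). split; [now apply Rmin_glb_lt|].
  intros x y Hx Hy. rewrite <- Cminus_conj, Cmod_conj.
  apply (mean_value (cdisc p (Rmin r1 r2)) g g'); auto.
  - apply cdisc_convex.
  - intros z Hz. apply g_hol, B1. eapply Rlt_le_trans; [apply Hz|apply Rmin_l].
  - intros z Hz. apply B2. eapply Rlt_le_trans; [apply Hz|apply Rmin_r].
Qed.

Lemma flow_unique (w1 w2 : R -> C) (a1 b1 a2 b2 t0 t : R) : flows w1 a1 b1 -> flows w2 a2 b2 ->
  a1 < t0 < b1 -> a2 < t0 < b2 -> a1 < t < b1 -> a2 < t < b2 -> w1 t0 = w2 t0 -> w1 t = w2 t.
Proof.
  intros H1 H2 I1 I2 J1 J2 E.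
  assert (M1 := Rmax_l a1 a2). assert (M2 := Rmax_r a1 a2).
  assert (M3 := Rmin_l b1 b2). assert (M4 := Rmin_r b1 b2).
  apply (ode_unique (fun z => Cconj (g z)) w1 w2 (Rmax a1 a2) (Rmin b1 b2) t0 t); auto.
  - split; [apply Rmax_lub_lt|apply Rmin_glb_lt]; lra.
  - split; [apply Rmax_lub_lt|apply Rmin_glb_lt]; lra.
  - intros s Hs. apply H1. lra.
  - intros s Hs. apply H2. lra.
  - intros s Hs. apply flow_lipschitz, H1. lra.
Qed.

(* On the horizontal line [G = G q + x] the local inverse of [G] traces the orbit of [q]; time and
   [x] are related by [dx/dt = |g|^2]. *)
Lemma flow_exists (q : C) (r t1 : R) : 0 < r ->
  (forall z, cdisc q r z -> ~ P z /\ Cmod (g z - g q) <= Cmod (g q) / 2) -> g q <> 0%C ->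
  exists w, w t1 = q /\ flows w (t1 - r / (16 * Cmod (g q))) (t1 + r / (16 * Cmod (g q))).
Proof.
  intros Hr Hq Hn. assert (Hd := proj1 (Cmod_gt_0 _) Hn). set (d := Cmod (g q)) in *.
  destruct (local_inverse G g q (g q) r) as [psi [Q1 Q2]]; auto.
  { intros z Hz. apply G_hol, Hq, Hz. }
  { intros z Hz. now apply Hq. }
  fold d in Q2.
  set (X := r * (d / 2)) in *. assert (HX : 0 < X) by (unfold X; apply Rmult_lt_0_compat; lra).
  set (c := fun x : R => psi (G q + x * 1)%C).
  assert (Hx : forall x, Rabs x < X -> cdisc (G q) X (G q + x * 1)%C).
  { intros x H. unfold cdisc. replace (G q + x * 1 - G q)%C with (RtoC x) by ring. now rewrite Cmod_R. }
  assert (Hc : forall x, Rabs x < X -> cdisc q r (c x) /\ g (c x) <> 0%C /\ rdiff c x (/ g (c x))%C).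
  { intros x H. destruct (Q2 _ (Hx x H)) as [A1 [A2 [A3 A4]]]. split; [exact A1|]. split; [exact A3|].
    assert (D := cdiff_rdiff psi (fun x => G q + x * 1)%C x _ _ A4 (rdiff_line _ _ _)).
    rewrite Cmult_1_r in D. exact D. }
  (* This is [dt/dx] along the orbit. Since [|g| <= 2 * d], it is at least [/ (4 * d * d)], so the
     half-length [X / 2] in [x] lasts for time at least [r / (16 * d)]. *)
  set (h := fun x => / (Cmod (g (c x)) * Cmod (g (c x)))).
  assert (Hb : forall x, Rabs x < X -> 0 < Cmod (g (c x)) <= 2 * d).
  { intros x H. destruct (Hc x H) as [A1 [A2 _]]. split; [now apply Cmod_gt_0|].
    generalize (proj2 (Hq _ A1)) (Cmod_triangle_rev (g (c x)) (g q)). fold d. lra. }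
  destruct (reparametrisation h X (/ (4 * d * d))) as [xi [Hxi0 Hxi]]; auto.
  { apply Rinv_0_lt_compat. repeat apply Rmult_lt_0_compat; lra. }
  { intros x H. destruct (Hc x H) as [A1 [A2 A3]].
    assert (K : rcont (fun x => / (RtoC (Cmod (g (c x))) * RtoC (Cmod (g (c x)))))%C x).
    { assert (K1 : rcont (fun x => RtoC (Cmod (g (c x)))) x).
      { apply (ccont_rcont (fun z => RtoC (Cmod (g z))) c); [|eapply rdiff_cont, A3].
        apply ccont_RtoC_Cmod. apply (hol_ccont _ _ _ _ g_hol). now apply Hq. }
      apply rcont_inv; [|now apply rcont_mult].
      rewrite <- RtoC_mult. intros Eq. apply RtoC_inj in Eq. specialize (Hb x H). nra. }
    apply rcont_re in K. eapply continuous_ext_loc; [|exact K].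
    assert (P0 : 0 < X - Rabs x) by lra. exists (mkposreal _ P0). intros y Hy.
    change (Rabs (y - x) < X - Rabs x) in Hy.
    assert (Hy' : Rabs y < X).
    { replace y with ((y - x) + x) by ring. eapply Rle_lt_trans; [apply Rabs_triang|lra]. }
    unfold h. specialize (Hb y Hy'). rewrite <- RtoC_mult, <- RtoC_inv by nra. reflexivity. }
  { intros x H. unfold h. specialize (Hb x H). apply Rinv_le_contravar; nra. }
  exists (fun t => c (xi (t - t1))). split.
  { replace (t1 - t1) with 0 by ring. rewrite Hxi0. unfold c.
    replace (G q + 0 * 1)%C with (G q) by ring. auto. }
  intros t Ht.
  assert (Ht' : Rabs (t - t1) < / (4 * d * d) * (X / 2)).
  { replace (/ (4 * d * d) * (X / 2)) with (r / (16 * d)) by (unfold X; field; lra). apply Rabs_def1; lra. }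
  destruct (Hxi _ Ht') as [X1 X2]. destruct (Hc _ X1) as [A1 [A2 A3]]. split; [now apply Hq|].
  assert (D : is_derive (fun t => xi (t - t1)) t (1 * / h (xi (t - t1)))).
  { apply (is_derive_comp xi (fun t => t - t1)); auto. auto_derive; auto. }
  assert (D2 := rdiff_comp_real c (fun t => xi (t - t1)) t _ _ A3 D).
  set (v := g (c (xi (t - t1)))) in *.
  replace (Cconj v) with (RtoC (1 * / h (xi (t - t1)%R))%R * / v)%C; [exact D2|].
  unfold h. fold v. rewrite Rmult_1_l, Rinv_inv.
  assert (E := Cmod2_conj v). simpl in E. rewrite Rmult_1_r in E. rewrite E. field. auto.
Qed.

(** The life span [tau] is uniform for starting points near [p]. It is this uniformity that prevents
    a trajectory from ending in finite time while it returns near [p]. *)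
Lemma flow_exists_locally (p : C) : ~ P p -> g p <> 0%C -> exists rho tau, 0 < rho /\ 0 < tau /\
  forall q t1, cdisc p rho q -> exists w, w t1 = q /\ flows w (t1 - tau) (t1 + tau).
Proof.
  intros Hp Hn. assert (Hd := proj1 (Cmod_gt_0 _) Hn).
  destruct (P_open p Hp) as [r1 [Hr1 B1]].
  destruct (hol_ccont _ _ _ p g_hol Hp (Cmod (g p) / 8)) as [r2 [Hr2 B2]]; [lra|].
  set (r := Rmin r1 r2 / 2). assert (Hr : 0 < r) by (unfold r; generalize (Rmin_glb_lt _ _ _ Hr1 Hr2); lra).
  assert (M1 := Rmin_l r1 r2). assert (M2 := Rmin_r r1 r2).
  exists r, (r / (32 * Cmod (g p))). split; auto. split.
  { apply Rdiv_lt_0_compat; lra. }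
  intros q t1 Hq.
  assert (Hgq := B2 q ltac:(unfold cdisc, r in *; lra)).
  assert (T1 := Cmod_triangle_rev (g p) (g q)). rewrite Cmod_sub_sym in T1.
  assert (T2 := Cmod_triangle_rev (g q) (g p)).
  destruct (flow_exists q r t1 Hr) as [w [W1 W2]].
  - intros z Hz. assert (Hzp : Cmod (z - p) < 2 * r).
    { unfold cdisc in *. generalize (Cmod_sub_trans z q p). lra. }
    split; [apply B1; unfold r in *; lra|].
    assert (Hgz := B2 z ltac:(unfold r in *; lra)).
    generalize (Cmod_sub_trans (g z) (g p) (g q)). rewrite (Cmod_sub_sym (g p) (g q)). lra.
  - apply Cmod_gt_0. lra.
  - exists w. split; auto. intros t Ht. apply W2.
    assert (r / (32 * Cmod (g p)) <= r / (16 * Cmod (g q))); [|lra].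
    apply Rmult_le_compat_l; [lra|]. apply Rinv_le_contravar; lra.
Qed.

Lemma flows_solves (z : R -> C) (a b : R) (A B : Rbar) : Rbar_le A a -> Rbar_le b B ->
  solves_on g P z A B -> flows z a b.
Proof.
  intros Ha Hb H t Ht. destruct (H t) as [H1 H2].
  - eapply Rbar_le_lt_trans; [apply Ha|]. simpl. lra.
  - eapply Rbar_lt_le_trans; [|apply Hb]. simpl. lra.
  - split; auto. now apply rdiff_is_derive.
Qed.

Lemma solves_flows (z : R -> C) (A B : Rbar) (t : R) : solves_on g P z A B ->
  Rbar_lt A 0 -> Rbar_lt 0 B -> Rbar_lt A t -> Rbar_lt t B ->
  exists a b, a < 0 < b /\ a < t < b /\ flows z a b.
Proof.
  intros H HA HB HAt HBt.
  assert (X0 : Rbar_lt A (Rmin t 0)) by (unfold Rmin; destruct Rle_dec; auto).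
  assert (Y0 : Rbar_lt (Rmax t 0) B) by (unfold Rmax; destruct Rle_dec; auto).
  destruct (Rbar_between _ _ X0) as [a [a1 a2]]. destruct (Rbar_between' _ _ Y0) as [b [b1 b2]].
  assert (M1 := Rmin_l t 0). assert (M2 := Rmin_r t 0).
  assert (M3 := Rmax_l t 0). assert (M4 := Rmax_r t 0).
  exists a, b. split; [lra|]. split; [lra|].
  apply flows_solves with A B; auto; now apply Rbar_lt_le.
Qed.

(** The union of all solutions through [z0] at time 0 on bounded intervals: uniqueness makes the
    value at each time of [J] well defined, and the ends are the bounds of [J]. *)
Lemma maximal_trajectory (z0 : C) : ~ P z0 -> g z0 <> 0%C ->
  exists z A B, trajectory g P z A B /\ Rbar_lt A 0 /\ Rbar_lt 0 B /\ z 0 = z0.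
Proof.
  intros Hz0 Hn.
  set (sol := fun (w : R -> C) a b => a < 0 < b /\ flows w a b /\ w 0 = z0).
  set (J := fun t => exists w a b, a < t < b /\ sol w a b).
  set (A := Glb_Rbar J). set (B := Lub_Rbar J).
  destruct (Glb_Rbar_correct J) as [A1 A2]. fold A in A1, A2.
  destruct (Lub_Rbar_correct J) as [B1 B2]. fold B in B1, B2.
  assert (HJ : forall t : R, Rbar_lt A t -> Rbar_lt t B -> J t).
  { intros t HA HB.
    destruct (Rle_lt_dec 0 t) as [Q|Q].
    - assert (Hhi : exists s, J s /\ t < s).
      { apply NNPP. intro N. apply (Rbar_lt_not_le _ _ HB). apply B2. intros s Hs.
        apply Rnot_lt_le. intro. apply N. now exists s. }
      destruct Hhi as [s [[w [a [b [I S]]]] H]]. exists w, a, b. split; auto. destruct S as [S _]. lra.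
    - assert (Hlo : exists s, J s /\ s < t).
      { apply NNPP. intro N. apply (Rbar_lt_not_le _ _ HA). apply A2. intros s Hs.
        apply Rnot_lt_le. intro. apply N. now exists s. }
      destruct Hlo as [s [[w [a [b [I S]]]] H]]. exists w, a, b. split; auto. destruct S as [S _]. lra. }
  assert (Hex : forall t, exists p, forall w a b, a < t < b -> sol w a b -> w t = p).
  { intros t. destruct (classic (J t)) as [[w [a [b [I S]]]]|N].
    - exists (w t). intros w' a' b' I' S'. destruct S as [S1 [S2 S3]]. destruct S' as [S1' [S2' S3']].
      apply (flow_unique w' w a' b' a b 0 t); auto. congruence.
    - exists 0%C. intros w a b I S. exfalso. apply N. now exists w, a, b. }
  set (z := fun t => proj1_sig (constructive_indefinite_description _ (Hex t))).
  assert (Hz : forall t w a b, a < t < b -> sol w a b -> w t = z t).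
  { intros t. unfold z. destruct (constructive_indefinite_description _ (Hex t)). auto. }
  destruct (flow_exists_locally z0 Hz0 Hn) as [rho [tau [Hrho [Htau Hloc]]]].
  destruct (Hloc z0 0 (cdisc_center _ _ Hrho)) as [w0 [W1 W2]].
  assert (S0 : sol w0 (0 - tau) (0 + tau)) by (split; [lra|split; auto]).
  assert (HA0 : Rbar_lt A 0).
  { apply Rbar_le_lt_trans with (- (tau / 2)); [|simpl; lra]. apply A1.
    exists w0, (0 - tau), (0 + tau). split; auto. lra. }
  assert (HB0 : Rbar_lt 0 B).
  { apply Rbar_lt_le_trans with (tau / 2); [simpl; lra|]. apply B1.
    exists w0, (0 - tau), (0 + tau). split; auto. lra. }
  assert (Ez : z 0 = z0).
  { rewrite <- (Hz 0 w0 (0 - tau) (0 + tau)); auto. lra. }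
  exists z, A, B. split; [|auto].
  split; [now apply Rbar_lt_trans with 0|]. split.
  - intros t HA HB. destruct (HJ t HA HB) as [w [a [b [I S]]]].
    assert (E := Hz t w a b I S). assert (S' := S). destruct S' as [S1 [S2 S3]].
    destruct (S2 t I) as [N D]. rewrite E in N, D. split; auto.
    apply rdiff_is_derive. apply rdiff_ext_loc with w (Rmin (t - a) (b - t)); auto.
    + apply Rmin_glb_lt; lra.
    + intros s Hs. apply Hz with a b; auto.
      destruct (Rlt_Rmin _ _ _ Hs) as [X1 X2].
      apply Rabs_def2 in X1. apply Rabs_def2 in X2. lra.
  - intros w a' b' Ha Hb Hw Hwz.
    assert (H0a : Rbar_lt a' 0) by now apply Rbar_le_lt_trans with A.
    assert (H0b : Rbar_lt 0 b') by now apply Rbar_lt_le_trans with B.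
    (* An extension is itself made of bounded solutions through [z0], so all its times already
       belong to [J]. *)
    assert (Hin : forall t : R, Rbar_lt a' t -> Rbar_lt t b' -> J t).
    { intros t Ht1 Ht2.
      destruct (solves_flows w a' b' t Hw H0a H0b Ht1 Ht2) as [a [b [I0 [I F]]]].
      exists w, a, b. split; [auto|]. split; [auto|]. split; [auto|].
      rewrite <- Ez. apply Hwz; auto. }
    split; apply Rbar_le_antisym; auto.
    + apply Rbar_not_lt_le. intro Q.
      assert (exists u : R, Rbar_lt a' u /\ Rbar_lt u A /\ u < 0).
      { destruct A as [x| |]; simpl in HA0; try tauto.
        - destruct (Rbar_between a' x Q) as [u [u1 u2]]. exists u. repeat split; auto. lra.
        - destruct a'; simpl in Q; tauto. }
      destruct H as [u [u1 [u2 u3]]]. apply (Rbar_lt_not_le _ _ u2), A1, Hin; auto.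
      apply Rbar_lt_trans with 0; auto.
    + apply Rbar_not_lt_le. intro Q.
      assert (exists u : R, Rbar_lt u b' /\ Rbar_lt B u /\ 0 < u).
      { destruct B as [x| |]; simpl in HB0; try tauto.
        - destruct (Rbar_between' b' x Q) as [u [u1 u2]]. exists u. repeat split; auto. lra.
      }
      destruct H as [u [u1 [u2 u3]]]. apply (Rbar_lt_not_le _ _ u2), B1, Hin; auto.
      apply Rbar_lt_trans with 0; auto.
Qed.

(** Near a point of [K] solutions live for a uniform time [tau], so maximality forces
    [beta - t >= tau] whenever the trajectory is there; near other points it never is. By
    compactness [/ (beta - t)] is bounded while [|z t| <= M], so the trajectory is outside that disc
    for [t] close to [beta]. *)
Lemma trajectory_escapes (z : R -> C) (A : Rbar) (beta t0 : R) (K : C -> Prop) :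
  trajectory g P z A beta -> Rbar_lt A t0 -> t0 < beta ->
  (forall t, t0 <= t < beta -> K (z t)) ->
  (forall p, K p -> ~ P p /\ g p <> 0%C) ->
  (forall p, ~ K p -> exists d, 0 < d /\ forall w, Cmod (w - p) < d -> ~ K w) ->
  escapes_finite_time z A beta.
Proof.
  intros [HAB [Hsol Hmax]] HA Hb HK HKr HKc. exists beta. split; auto. intros M.
  destruct (loc_bounded (fun w m => forall t, t0 <= t < beta -> z t = w -> / (beta - t) <= m) M) as [m Hm].
  - intros w m m' H Hmm t Ht E. specialize (H t Ht E). lra.
  - intros p. destruct (classic (K p)) as [Kp|Kp].
    + destruct (HKr p Kp) as [Pp gp].
      destruct (flow_exists_locally p Pp gp) as [rho [tau [Hrho [Htau Hloc]]]].
      exists rho. split; auto. exists (/ tau). intros w Hw t Ht E.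
      apply Rinv_le_contravar; auto. apply Rnot_lt_le. intro Q.
      destruct (Hloc w t Hw) as [v [V1 V2]].
      assert (HAt : Rbar_lt A t) by (apply Rbar_lt_le_trans with t0; auto; simpl; lra).
      destruct (Rbar_between A t HAt) as [a [a1 a2]].
      assert (Hz : flows z a beta).
      { apply flows_solves with A beta; auto; [now apply Rbar_lt_le | apply Rbar_le_refl]. }
      (* If [beta - t < tau], the local solution [v] continues [z] past [beta]; [W] is the glued
         curve that contradicts maximality. *)
      assert (Ezv : forall s, t <= s < beta -> z s = v s).
      { intros s Hs. apply (flow_unique z v a beta (t - tau) (t + tau) t s); auto; try lra. congruence. }
      set (W := fun s => if Rlt_dec s beta then z s else v s).
      destruct (Hmax W A (t + tau)) as [_ F].
      * apply Rbar_le_refl.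
      * simpl. lra.
      * intros s Hs1 Hs2. simpl in Hs2. unfold W at 1 3. destruct (Rlt_dec s beta) as [L|L].
        -- destruct (Hsol s Hs1 L) as [N D]. split; auto. apply rdiff_is_derive.
           apply rdiff_is_derive in D. apply rdiff_ext_loc with z (beta - s); auto; [lra|].
           intros u Hu. apply Rabs_def2 in Hu. unfold W. destruct (Rlt_dec u beta); auto. lra.
        -- destruct (V2 s ltac:(lra)) as [N D]. split; auto. apply rdiff_is_derive.
           apply rdiff_ext_loc with v (s - t); auto; [lra|].
           intros u Hu. apply Rabs_def2 in Hu. unfold W. destruct (Rlt_dec u beta); auto.
           symmetry. apply Ezv. lra.
      * intros s _ Hs. simpl in Hs. unfold W. destruct (Rlt_dec s beta); auto. lra.
      * apply (f_equal real) in F. simpl in F. lra.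
    + destruct (HKc p Kp) as [d [Hd B]]. exists d. split; auto. exists 0.
      intros w Hw t Ht E. exfalso. apply (B w Hw). rewrite <- E. auto.
  - set (m1 := Rabs m + 1). assert (Hm1 : 0 < m1) by (unfold m1; generalize (Rabs_pos m); lra).
    assert (Hi := Rinv_0_lt_compat _ Hm1).
    exists (Rmin (/ m1) (beta - t0)). split; [apply Rmin_glb_lt; lra|].
    intros t HAt Ht. assert (M1 := Rmin_l (/ m1) (beta - t0)). assert (M2 := Rmin_r (/ m1) (beta - t0)).
    apply Rnot_le_lt. intro Q. specialize (Hm (z t) Q t ltac:(lra) eq_refl).
    assert (Hlt : / m1 <= beta - t).
    { rewrite <- (Rinv_inv (beta - t)). apply Rinv_le_contravar.
      - apply Rinv_0_lt_compat. lra.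
      - unfold m1. generalize (Rle_abs m). lra. }
    lra.
Qed.

Lemma flow_primitive (z : R -> C) (a b t : R) : flows z a b -> a < t < b ->
  rdiff (fun s => G (z s)) t (RtoC (Cmod (g (z t)) ^ 2)).
Proof.
  intros H Ht. destruct (H t Ht) as [N D]. rewrite Cmod2_conj.
  apply cdiff_rdiff; auto. now apply G_hol.
Qed.

Lemma flow_Im_const (z : R -> C) (a b s t : R) : flows z a b -> a < s < b -> a < t < b ->
  Im (G (z s)) = Im (G (z t)).
Proof.
  intros H.
  assert (K : forall s t, a < s < b -> a < t < b -> s <= t -> Im (G (z t)) <= Im (G (z s)) /\ Im (G (z s)) <= Im (G (z t))).
  { intros u v Hu Hv Huv.
    assert (D : forall x, u <= x <= v -> is_derive (fun s => Im (G (z s))) x 0).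
    { intros x Hx. destruct (flow_primitive z a b x H ltac:(lra)) as [_ D]. now rewrite im_RtoC in D. }
    split.
    - assert (I := real_increasing (fun s => - Im (G (z s))) (fun _ => - 0) u v Huv). cbv beta in I.
      cut (- Im (G (z u)) <= - Im (G (z v))); [lra|]. apply I; [|intros; lra].
      intros x Hx. apply (is_derive_opp (fun s => Im (G (z s)))), D, Hx.
    - apply (real_increasing (fun s => Im (G (z s))) (fun _ => 0)); auto. intros; lra. }
  intros Hs Ht. destruct (Rle_lt_dec s t) as [Q|Q].
  - destruct (K s t Hs Ht Q). lra.
  - destruct (K t s Ht Hs ltac:(lra)). lra.
Qed.
End Flow.

(** * Blow-up in finite time *)

(** The inequality says that [/ s] falls at rate at least [1 / 4], yet it stays positive. *)
Lemma decreasing_inverse (s s' : R -> R) (T : R) : 0 <= T ->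
  (forall t, 0 <= t <= T -> is_derive s t (s' t) /\ 0 < s t /\ s t * s t / 4 <= s' t) ->
  T * s 0 <= 4.
Proof.
  intros HT H.
  assert (I := real_increasing (fun t => - / s t - t / 4) (fun t => - - (s' t / (s t) ^ 2) - / 4) 0 T HT).
  cbv beta in I.
  assert (K : - / s 0 - 0 / 4 <= - / s T - T / 4).
  { apply I; intros t Ht; destruct (H t Ht) as [D [P Q]].
    - apply (is_derive_minus (fun t => - / s t) (fun t => t / 4)); [|auto_derive; auto; lra].
      apply (is_derive_opp (fun t => / s t)).
      replace (- (s' t / (s t) ^ 2)) with (- s' t / (s t) ^ 2) by (field; lra).
      apply is_derive_inv; auto. lra.
    - assert (X : / 4 <= s' t / s t ^ 2).
      { apply Rle_div_r; [apply pow_lt; lra|]. simpl. lra. }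
      lra. }
  destruct (H 0 ltac:(lra)) as [_ [P0 _]]. destruct (H T ltac:(lra)) as [_ [PT _]].
  assert (X := Rinv_0_lt_compat _ PT).
  assert (Y : T / 4 <= / s 0) by lra.
  apply (Rmult_le_compat_r (s 0)) in Y; [|lra]. rewrite Rinv_l in Y by lra. lra.
Qed.

(* [u' = N x] is the quantity that blows up: [(N x)' >= (N x)^2 / 4]. *)
Lemma cone_estimate (u x y N a b n : R -> R) (T : R) : 0 <= T ->
  (forall t, 0 <= t <= T ->
    is_derive u t (N t * x t) /\
    is_derive x t (N t * (x t * x t + y t * y t) * a t) /\
    is_derive y t (N t * (x t * x t + y t * y t) * b t) /\
    is_derive N t (n t) /\ 0 < N t /\ Rabs (a t - 1) <= / 4 /\ Rabs (b t) <= / 4 /\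
    Rabs (n t) <= / 4 * (N t * N t) * sqrt (x t * x t + y t * y t)) ->
  0 < x 0 -> Rabs (y 0) <= x 0 / 2 ->
  u 0 <= u T /\ T * (N 0 * x 0) <= 4.
Proof.
  intros HT H Hx0 Hy0. apply Rabs_le_between in Hy0.
  (* The cone is invariant because [x / 2 - y] and [x / 2 + y] are nondecreasing: their derivatives
     are a nonnegative factor times [a / 2 - b] and [a / 2 + b], and [a / 2 >= 3 / 8] exceeds
     [|b| <= 1 / 4]. *)
  assert (Q : forall t, 0 <= t <= T -> x 0 <= x t /\ Rabs (y t) <= x t / 2).
  { intros t Ht.
    assert (I1 := real_increasing x (fun t => N t * (x t * x t + y t * y t) * a t) 0 t (proj1 Ht)).
    assert (I2 := real_increasing (fun t => x t / 2 - y t)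
      (fun t => N t * (x t * x t + y t * y t) * a t / 2 - N t * (x t * x t + y t * y t) * b t) 0 t (proj1 Ht)).
    assert (I3 := real_increasing (fun t => x t / 2 + y t)
      (fun t => N t * (x t * x t + y t * y t) * a t / 2 + N t * (x t * x t + y t * y t) * b t) 0 t (proj1 Ht)).
    assert (Hpos : forall s, 0 <= s <= t -> 0 <= N s * (x s * x s + y s * y s) /\ 3 / 4 <= a s /\ - / 4 <= b s <= / 4).
    { intros s Hs. destruct (H s ltac:(lra)) as [_ [_ [_ [_ [h1 [h2 [h3 _]]]]]]].
      apply Rabs_le_between in h2. apply Rabs_le_between in h3. repeat split; try lra.
      apply Rmult_le_pos; [lra|]. nra. }
    assert (Hhalf : forall s, 0 <= s <= t -> is_derive (fun t => x t / 2) s (N s * (x s * x s + y s * y s) * a s / 2)).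
    { intros s Hs. destruct (H s ltac:(lra)) as [_ [h _]]. unfold Rdiv.
      apply (is_derive_ext (fun t => / 2 * x t)); [intros; apply Rmult_comm|].
      rewrite (Rmult_comm _ (/ 2)). now apply is_derive_scal. }
    assert (J1 : x 0 <= x t).
    { apply I1; intros s Hs; [apply H; lra|]. destruct (Hpos s Hs) as [h1 [h2 h3]].
      apply Rmult_le_pos; lra. }
    assert (J2 : x 0 / 2 - y 0 <= x t / 2 - y t).
    { apply I2; intros s Hs.
      - apply (is_derive_minus (fun t => x t / 2) y); [now apply Hhalf|apply H; lra].
      - destruct (Hpos s Hs) as [h1 [h2 h3]]. set (W := N s * (x s * x s + y s * y s)) in *. nra. }
    assert (J3 : x 0 / 2 + y 0 <= x t / 2 + y t).
    { apply I3; intros s Hs.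
      - apply (is_derive_plus (fun t => x t / 2) y); [now apply Hhalf|apply H; lra].
      - destruct (Hpos s Hs) as [h1 [h2 h3]]. set (W := N s * (x s * x s + y s * y s)) in *. nra. }
    split; auto. apply Rabs_le. lra. }
  split.
  - apply (real_increasing u (fun t => N t * x t) 0 T HT); intros t Ht; [apply H; lra|].
    destruct (H t Ht) as [_ [_ [_ [_ [h _]]]]]. destruct (Q t Ht) as [q _]. apply Rmult_le_pos; lra.
  - apply (decreasing_inverse (fun t => N t * x t)
      (fun t => n t * x t + N t * (N t * (x t * x t + y t * y t) * a t)) T HT).
    intros t Ht. destruct (H t Ht) as [_ [D1 [_ [D2 [h1 [h2 [_ h4]]]]]]]. destruct (Q t Ht) as [q1 q2].
    split; [|split].
    + apply (is_derive_mult N x); auto. exact Rmult_comm.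
    + apply Rmult_lt_0_compat; lra.
    (* In the cone [x <= e <= 2 * x]. Hence [n * x >= - (N * x)^2 / 2], while the other term is at
       least [3 / 4 * (N * x)^2]; the difference leaves the factor [1 / 4]. *)
    + set (e := sqrt (x t * x t + y t * y t)) in *.
      assert (E1 : e * e = x t * x t + y t * y t) by (apply sqrt_sqrt; nra).
      assert (E2 : 0 <= e) by apply sqrt_pos.
      rewrite <- E1. apply Rabs_le_between in h2. apply Rabs_le_between in h4. apply Rabs_le_between in q2.
      assert (E3 : e <= 2 * x t).
      { apply Rsqr_incr_0_var; unfold Rsqr; [|lra]. rewrite E1. nra. }
      assert (E4 : x t * x t <= e * e) by (rewrite E1; nra).
      set (X := x t) in *. set (M := N t) in *.
      assert (PM : 0 < M * M) by now apply Rmult_lt_0_compat.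
      assert (F1 : - (/ 2 * (M * M) * X) <= n t).
      { eapply Rle_trans; [|apply h4]. apply Ropp_le_contravar.
        replace (/ 2 * (M * M) * X) with (/ 4 * (M * M) * (2 * X)) by field.
        apply Rmult_le_compat_l; [|lra]. lra. }
      apply (Rmult_le_compat_r X) in F1; [|lra].
      assert (F2 : M * M * (e * e) * (3 / 4) <= M * (M * (e * e) * a t)).
      { replace (M * (M * (e * e) * a t)) with (M * M * (e * e) * a t) by ring.
        apply Rmult_le_compat_l; [|lra]. apply Rmult_le_pos; [lra|]. nra. }
      assert (F3 : M * M * (X * X) <= M * M * (e * e)) by (apply Rmult_le_compat_l; lra).
      nra.
Qed.

(** * The flow in the logarithmic coordinate *)

Section Core.
Variables (U : C -> Prop) (L L' L'' E E' g : C -> C) (z : R -> C).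
Hypothesis L_hol : hol U L L'.
Hypothesis L'_hol : hol U L' L''.
Hypothesis E_hol : hol U E E'.
Hypothesis L'_neq : forall w, U w -> L' w <> 0%C.
Hypothesis E_neq : forall w, U w -> E w <> 0%C.
Hypothesis g_eq : forall w, U w -> g w = (L' w * E w)%C.

(** This is [cone_estimate] with [u = Re L], [x + i y = E], [N = |L'|^2] and
    [a + i b = p = E' / (E * L')]. From [z' = conj (L' * E)] the derivative of [L] is [N * conj E]
    and that of [E] is [N * |E|^2 * p]. The factor [1 / 8] becomes [1 / 4] because
    [|N'| <= 2 * |L'| * |L''| * |g|]. *)
Lemma trajectory_estimate (T : R) : 0 <= T ->
  (forall t, 0 <= t <= T -> rdiff z t (Cconj (g (z t))) /\ U (z t) /\
    Cmod (L'' (z t)) <= / 8 * (Cmod (L' (z t)) * Cmod (L' (z t))) /\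
    Cmod (E' (z t) - E (z t) * L' (z t)) <= / 4 * Cmod (E (z t) * L' (z t))) ->
  0 < Re (E (z 0)) -> Rabs (Im (E (z 0))) <= Re (E (z 0)) / 2 ->
  Re (L (z 0)) <= Re (L (z T)) /\ T * (Cmod (L' (z 0)) * Cmod (L' (z 0)) * Re (E (z 0))) <= 4.
Proof.
  intros HT H Hx Hy.
  set (p := fun t => (E' (z t) / (E (z t) * L' (z t)))%C).
  set (N := fun t => Cmod (L' (z t)) * Cmod (L' (z t))).
  set (D := fun t => (L'' (z t) * Cconj (g (z t)))%C).
  apply (cone_estimate (fun t => Re (L (z t))) (fun t => Re (E (z t))) (fun t => Im (E (z t))) N
    (fun t => Re (p t)) (fun t => Im (p t))
    (fun t => 2 * (Re (L' (z t)) * Re (D t) + Im (L' (z t)) * Im (D t))) T HT); auto.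
  intros t Ht. destruct (H t Ht) as [Hz [HU [H1 H2]]].
  assert (NL := L'_neq _ HU). assert (NE := E_neq _ HU). assert (Gq := g_eq _ HU).
  destruct (cdiff_rdiff L z t _ _ (proj1 (L_hol _ HU)) Hz) as [dL _].
  destruct (cdiff_rdiff E z t _ _ (proj1 (E_hol _ HU)) Hz) as [dE1 dE2].
  destruct (cdiff_rdiff L' z t _ _ (proj1 (L'_hol _ HU)) Hz) as [dN1 dN2].
  set (l := L' (z t)) in *. set (e := E (z t)) in *.
  assert (EN : N t = Re l * Re l + Im l * Im l) by apply Cmod_sqr.
  assert (X1 : (l * Cconj (g (z t)))%C = (RtoC (N t) * Cconj e)%C).
  { rewrite Gq, Cmult_conj, EN. destruct l, e. apply injective_projections; simpl; ring. }
  assert (X2 : (E' (z t) * Cconj (g (z t)))%C = (RtoC (N t * (Re e * Re e + Im e * Im e)) * p t)%C).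
  { assert (Ep : E' (z t) = (e * l * p t)%C) by (unfold p; fold e l; field; auto).
    rewrite Gq, Cmult_conj, Ep, EN. destruct l, e, (p t). apply injective_projections; simpl; ring. }
  assert (X3 : Cmod (p t - 1) <= / 4).
  { replace (p t - 1)%C with ((E' (z t) - e * l) / (e * l))%C by (unfold p; fold e l; field; auto).
    assert (Nel : (e * l)%C <> 0%C) by now apply Cmult_neq_0.
    rewrite Cmod_div by auto. apply Rle_div_l; [now apply Cmod_gt_0|exact H2]. }
  assert (Pl := proj1 (Cmod_gt_0 _) NL).
  assert (Ee : sqrt (Re e * Re e + Im e * Im e) = Cmod e).
  { rewrite <- Cmod_sqr. apply sqrt_square, Cmod_ge_0. }
  split; [|split; [|split; [|split; [|split; [|split; [|split]]]]]].
  - rewrite X1 in dL. replace (Re (N t * Cconj e)%C) with (N t * Re e) in dL by (rewrite re_scal_l, re_conj; ring). exact dL.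
  - rewrite X2, re_scal_l in dE1. exact dE1.
  - rewrite X2, im_scal_l in dE2. exact dE2.
  - apply (is_derive_ext (fun t => Re (L' (z t)) * Re (L' (z t)) + Im (L' (z t)) * Im (L' (z t)))).
    { intros s. symmetry. apply Cmod_sqr. }
    replace (2 * (Re l * Re (D t) + Im l * Im (D t))) with
      ((Re (D t) * Re l + Re l * Re (D t)) + (Im (D t) * Im l + Im l * Im (D t))) by ring.
    apply (is_derive_plus (fun t => Re (L' (z t)) * Re (L' (z t))) (fun t => Im (L' (z t)) * Im (L' (z t)))).
    + apply (is_derive_mult (fun t => Re (L' (z t))) (fun t => Re (L' (z t)))); auto. exact Rmult_comm.
    + apply (is_derive_mult (fun t => Im (L' (z t))) (fun t => Im (L' (z t)))); auto. exact Rmult_comm.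
  - unfold N. fold l. now apply Rmult_lt_0_compat.
  - eapply Rle_trans; [|apply X3].
    replace (Re (p t) - 1) with (Re (p t - 1)%C)
      by (unfold Cminus; rewrite re_plus, re_opp, re_RtoC; ring).
    apply re_le_Cmod.
  - eapply Rle_trans; [|apply X3].
    replace (Im (p t)) with (Im (p t - 1)%C)
      by (unfold Cminus; rewrite im_plus, im_opp, im_RtoC; ring).
    apply im_le_Cmod.
  - rewrite Ee.
    assert (Y := re_le_Cmod (Cconj l * D t)%C).
    replace (Re (Cconj l * D t)%C) with (Re l * Re (D t) + Im l * Im (D t)) in Y
      by (rewrite re_mult, re_conj, im_conj; ring).
    rewrite Cmod_mult, Cmod_conj in Y.
    assert (Z : Cmod (D t) <= / 8 * (Cmod l * Cmod l) * (Cmod l * Cmod e)).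
    { unfold D. rewrite Gq, Cmod_mult, Cmod_conj, (Cmod_mult l). apply Rmult_le_compat_r; auto.
      apply Rmult_le_pos; apply Cmod_ge_0. }
    apply (Rmult_le_compat_l (Cmod l)) in Z; [|lra].
    rewrite Rabs_mult, (Rabs_pos_eq 2) by lra. unfold N. fold l. lra.
Qed.
End Core.

(** * Finding starting points in the cone *)

Lemma polar_form (e : C) : exists al, Rabs al <= 4 /\ e = (RtoC (Cmod e) * cexp (RtoC al * Ci))%C.
Proof.
  destruct (Req_dec (Cmod e) 0) as [Z|Z].
  { exists 0. split; [rewrite Rabs_R0; lra|]. rewrite Z. apply Cmod_eq_0 in Z. rewrite Z. ring. }
  assert (P := Cmod_ge_0 e). set (m := Cmod e) in *.
  assert (S := Cmod_sqr e). fold m in S.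
  assert (Hx : -1 <= Re e / m <= 1).
  { assert (Q := re_le_Cmod e). fold m in Q. apply Rabs_le_between in Q. split.
    - apply Rle_div_r; lra.
    - apply Rle_div_l; lra. }
  assert (B := acos_bound (Re e / m)). assert (P4 := PI_4).
  assert (Hs : sin (acos (Re e / m)) = Rabs (Im e) / m).
  { rewrite sin_acos by auto. apply sqrt_lem_1.
    - unfold Rsqr. nra.
    - apply Rmult_le_pos; [apply Rabs_pos|]. apply Rlt_le, Rinv_0_lt_compat. lra.
    - assert (Q : Rabs (Im e) * Rabs (Im e) = Im e * Im e) by (symmetry; apply Rsqr_abs).
      replace (Rabs (Im e) / m * (Rabs (Im e) / m)) with (Rabs (Im e) * Rabs (Im e) / (m * m)) by (field; lra).
      rewrite Q. unfold Rsqr. replace (Im e * Im e) with (m * m - Re e * Re e) by lra. field. lra. }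
  assert (Ec : forall al, cexp (RtoC al * Ci) = (cos al, sin al)).
  { intros al. unfold cexp. replace (Re (al * Ci)%C) with 0 by (simpl; ring).
    replace (Im (al * Ci)%C) with al by (simpl; ring). rewrite exp_0.
    apply injective_projections; simpl; ring. }
  destruct (Rle_lt_dec 0 (Im e)) as [Q|Q].
  - exists (acos (Re e / m)). split; [apply Rabs_le; lra|].
    rewrite Ec, cos_acos, Hs, Rabs_pos_eq by auto. apply C_eq_Re_Im.
    + rewrite re_scal_l. simpl. field. lra.
    + rewrite im_scal_l. simpl. field. lra.
  - exists (- acos (Re e / m)). split; [apply Rabs_le; lra|].
    rewrite Ec, cos_neg, sin_neg, cos_acos, Hs, Rabs_left by auto. apply C_eq_Re_Im.
    + rewrite re_scal_l. simpl. field. lra.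
    + rewrite im_scal_l. simpl. field. lra.
Qed.

(* [e' ~ e] on a half-plane makes [e] comparable to [exp]; moving vertically by the argument of
   [e v] therefore turns its value almost onto the positive real axis. *)
Lemma almost_exponential_positive (e e' : C -> C) (u : R) (v : C) :
  hol (halfplane u) e e' -> (forall w, halfplane u w -> Cmod (e' w - e w) <= / 32 * Cmod (e w)) ->
  halfplane u v -> e v <> 0%C ->
  exists w, Re w = Re v /\ 0 < Re (e w) /\ Rabs (Im (e w)) < Re (e w) / 2.
Proof.
  intros He Hb Hv Hn. assert (Pe := proj1 (Cmod_gt_0 _) Hn).
  destruct (polar_form (e v)) as [al [Hal Epol]].
  set (w := (v + RtoC (- al) * Ci)%C).
  assert (Rw : Re w = Re v) by (unfold w; rewrite re_plus, re_scal_l; simpl; ring).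
  (* This quotient of [e] by the exponential is nearly constant, since [|q'| <= |q| / 32]. *)
  set (q := fun w => (e w * cexp (- w))%C).
  set (q' := fun w => ((e' w - e w) * cexp (- w))%C).
  set (A := fun w => halfplane u w /\ cdisc v 5 w).
  assert (HA : convex A).
  { intros a b s [A1 A2] [B1 B2] Hs. split; [now apply halfplane_convex|now apply cdisc_convex]. }
  assert (Hq : forall w, halfplane u w -> cdiff q w (q' w)).
  { intros x Hx. assert (D1 := cdiff_comp cexp (fun w => (0 - w)%C) x _ _ (cexp_cdiff _)
      (cdiff_minus (fun _ => 0%C) (fun w => w) x _ _ (cdiff_const 0 x) (cdiff_id x))).
    assert (D2 := cdiff_mult e _ x _ _ (proj1 (He x Hx)) D1). cbv beta in D2.
    apply cdiff_ext_loc with (f := fun w => (e w * cexp (0 - w))%C) (r := 1); [lra| |].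
    - intros y _. unfold q. do 2 f_equal. ring.
    - unfold q'. replace (- x)%C with (0 - x)%C by ring.
      replace ((e' x - e x) * cexp (0 - x))%C with (e' x * cexp (0 - x) + e x * ((0 - 1) * cexp (0 - x)))%C by ring.
      exact D2. }
  assert (Hq' : forall w, halfplane u w -> Cmod (q' w) <= / 32 * Cmod (q w)).
  { intros x Hx. unfold q, q'. rewrite !Cmod_mult, <- Rmult_assoc.
    apply Rmult_le_compat_r; [apply Cmod_ge_0|]. now apply Hb. }
  assert (Av : A v) by (split; auto; apply cdisc_center; lra).
  assert (Dw : Cmod (w - v) <= 4).
  { replace (w - v)%C with (RtoC (- al) * Ci)%C by (unfold w; ring).
    rewrite Cmod_mult, Cmod_R, Rabs_Ropp, Cmod_Ci. lra. }
  assert (Aw : A w) by (split; [unfold halfplane in *; lra|unfold cdisc; lra]).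
  (* Gronwall over a distance below 5 costs less than [exp (1 / 2) <= 2]. The move from [v] to [w]
     has length at most 4, so [q] changes by at most [1 / 32 * 2 * 4 = 1 / 4] of [|q v|], and [e w]
     lies within [|e v| / 4] of the positive number [|e v|]. *)
  assert (Hg : forall x, A x -> Cmod (q x) <= 2 * Cmod (q v)).
  { intros x [X1 X2].
    assert (G := gronwall (halfplane u) q q' (/ 32) v x (halfplane_convex u) Hq Hq' Hv X1).
    eapply Rle_trans; [apply G|]. rewrite Rmult_comm. apply Rmult_le_compat_r; [apply Cmod_ge_0|].
    unfold cdisc in X2. assert (P := Cmod_ge_0 (x - v)).
    assert (T : exp (/ 32 * Cmod (x - v)) < exp (/ 2)) by (apply exp_increasing; lra).
    assert (T2 : exp (/ 2) * exp (/ 2) <= 3).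
    { rewrite <- exp_plus. replace (/ 2 + / 2) with 1 by field. apply exp_le_3. }
    assert (T3 := exp_pos (/ 2)). assert (T4 : exp (/ 2) <= 2) by nra. lra. }
  assert (H32 : 0 <= / 32) by lra.
  assert (HM := mean_value A q q' (/ 32 * (2 * Cmod (q v))) v w HA (fun x Hx => Hq x (proj1 Hx))
    (fun x Hx => Rle_trans _ _ _ (Hq' x (proj1 Hx)) (Rmult_le_compat_l _ _ _ H32 (Hg x Hx))) Av Aw).
  assert (HM2 : Cmod (q w - q v) <= / 4 * Cmod (q v)).
  { eapply Rle_trans; [apply HM|]. assert (P := Cmod_ge_0 (q v)). nra. }
  apply (Rmult_le_compat_r (Cmod (cexp w))) in HM2; [|apply Cmod_ge_0].
  rewrite Rmult_assoc, <- !Cmod_mult in HM2.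
  assert (E1 : (q v * cexp w)%C = RtoC (Cmod (e v))).
  { unfold q. rewrite <- Cmult_assoc, <- cexp_plus, Epol at 1.
    rewrite <- Cmult_assoc, <- cexp_plus.
    replace (RtoC al * Ci + (- v + w))%C with (RtoC 0) by (unfold w; rewrite RtoC_opp; ring).
    rewrite cexp_0. ring. }
  assert (E2 : (q w * cexp w)%C = e w).
  { unfold q. rewrite <- Cmult_assoc, <- cexp_plus. replace (- w + w)%C with (RtoC 0) by ring.
    rewrite cexp_0. ring. }
  replace ((q w - q v) * cexp w)%C with (q w * cexp w - q v * cexp w)%C in HM2 by ring.
  rewrite E1, E2, Cmod_R, (Rabs_pos_eq (Cmod (e v))) in HM2 by lra.
  assert (R1 := re_le_Cmod (e w - RtoC (Cmod (e v)))%C).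
  assert (I1 := im_le_Cmod (e w - RtoC (Cmod (e v)))%C).
  unfold Cminus in R1 at 1. unfold Cminus in I1 at 1.
  rewrite re_plus, re_opp, re_RtoC in R1. rewrite im_plus, im_opp, im_RtoC in I1.
  apply Rabs_le_between in R1. apply Rabs_le_between in I1.
  exists w. split; auto. split; [lra|]. apply Rabs_def1; lra.
Qed.

Lemma ccont_re_lower (f : C -> C) (p : C) (c : R) : ccont f p -> c < Re (f p) ->
  near p (fun w => c < Re (f w)).
Proof.
  intros Hf Hc. destruct (Hf (Re (f p) - c)) as [d [Hd B]]; [lra|]. exists d. split; auto.
  intros w Hw. specialize (B w Hw). assert (T := re_le_Cmod (f w - f p)%C).
  unfold Cminus in T at 1. rewrite re_plus, re_opp in T. apply Rabs_le_between in T. lra.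
Qed.

(** * Escaping trajectories *)

Section Escape.
Variables (g G g' : C -> C) (P U : C -> Prop) (L L' L'' E E' : C -> C) (u1 u2 : R).
Hypothesis P_open : Defs.open_set (fun z => ~ P z).
Hypothesis G_hol : hol (fun z => ~ P z) G g.
Hypothesis g_hol : hol (fun z => ~ P z) g g'.
Hypothesis U_open : Defs.open_set U.
Hypothesis U_regular : forall z, U z -> ~ P z.
Hypothesis L_hol : hol U L L'.
Hypothesis L'_hol : hol U L' L''.
Hypothesis E_hol : hol U E E'.
Hypothesis L'_neq : forall z, U z -> L' z <> 0%C.
Hypothesis E_neq : forall z, U z -> E z <> 0%C.
Hypothesis g_eq : forall z, U z -> g z = (L' z * E z)%C.
Hypothesis L''_small : forall z, U z -> u1 < Re (L z) ->
  Cmod (L'' z) <= / 8 * (Cmod (L' z) * Cmod (L' z)).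
Hypothesis E'_near : forall z, U z -> u1 < Re (L z) ->
  Cmod (E' z - E z * L' z) <= / 32 * Cmod (E z * L' z).
Hypothesis u12 : u1 < u2.

(** The non-strict inequality makes a closed set, and the gap between [u1] and [u2] leaves an open
    margin around it where the derivative estimates still hold. *)
Definition far (z : C) : Prop := U z /\ u2 <= Re (L z).
Hypothesis far_closed : forall p, ~ far p -> exists d, 0 < d /\ forall w, Cmod (w - p) < d -> ~ far w.

Definition start (z : C) : Prop :=
  far z /\ 0 < Re (E z) /\ Rabs (Im (E z)) <= Re (E z) / 2.

(** A bootstrap by real induction. As long as the trajectory is in the open region [J], the estimate
    puts it into the smaller set [far]; closedness of [far] handles limits, openness of [J] the
    continuation. *)
Lemma start_stays_far (z : R -> C) (a b T : R) : a < 0 -> 0 <= T < b -> flows g P z a b -> start (z 0) ->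
  far (z T) /\ T * (Cmod (L' (z 0)) * Cmod (L' (z 0)) * Re (E (z 0))) <= 4.
Proof.
  intros Ha HT Hz [[S1 S2] [S3 S4]].
  set (J := fun s => U (z s) /\ u1 < Re (L (z s))).
  assert (zc : forall s, 0 <= s <= T -> rcont z s).
  { intros s Hs. eapply rdiff_cont. apply (proj2 (Hz s ltac:(lra))). }
  assert (est : forall s, 0 <= s <= T -> (forall u, 0 <= u <= s -> J u) ->
    far (z s) /\ s * (Cmod (L' (z 0)) * Cmod (L' (z 0)) * Re (E (z 0))) <= 4).
  { intros s Hs H.
    destruct (trajectory_estimate U L L' L'' E E' g z L_hol L'_hol E_hol L'_neq E_neq g_eq s) as [X1 X2]; auto; try lra.
    - intros t Ht. destruct (H t Ht) as [h1 h2]. split; [apply (proj2 (Hz t ltac:(lra)))|].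
      split; auto. split; auto. eapply Rle_trans; [now apply E'_near|].
      apply Rmult_le_compat_r; [apply Cmod_ge_0|lra].
    - destruct (H s ltac:(lra)) as [h1 _]. repeat split; auto; lra. }
  assert (HJ : forall s, 0 <= s <= T -> J s).
  { apply real_induction.
    - intros s Hs Hlt. assert (Fs : far (z s)); [|destruct Fs; split; auto; lra].
      apply NNPP. intro N. destruct (Req_dec s 0) as [e|e].
      + apply N. rewrite e. split; auto.
      + destruct (far_closed _ N) as [d [Hd B]]. destruct (zc s Hs d Hd) as [q [Hq Bq]].
        assert (T1 := Rmax_l 0 (s - q / 2)). assert (T2 := Rmax_r 0 (s - q / 2)).
        assert (T3 : Rmax 0 (s - q / 2) < s) by (apply Rmax_lub_lt; lra).
        apply (B (z (Rmax 0 (s - q / 2)))).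
        * apply Bq. rewrite Rabs_left; lra.
        * apply est; [lra|]. intros u Hu. apply Hlt. lra.
    - intros s Hs Hle. destruct (Hle s ltac:(lra)) as [F1 F2].
      destruct (U_open _ F1) as [r1 [Hr1 B1]].
      destruct (ccont_re_lower L (z s) u1) as [r2 [Hr2 B2]]; [apply (hol_ccont _ _ _ _ L_hol); auto|auto|].
      destruct (zc s ltac:(lra) (Rmin r1 r2)) as [q [Hq Bq]]; [now apply Rmin_glb_lt|].
      exists q. split; auto. intros u Hu _. specialize (Bq u ltac:(rewrite Rabs_pos_eq; lra)).
      apply Rmin_Rgt in Bq. split; [now apply B1|now apply B2]. }
  apply est; [lra|]. intros u Hu. apply HJ. lra.
Qed.

Lemma escaping_trajectory (z0 : C) : start z0 ->
  exists z A B, trajectory g P z A B /\ escapes_finite_time z A B /\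
    Rbar_lt A 0 /\ Rbar_lt 0 B /\ z 0 = z0 /\
    forall t, 0 <= t -> Rbar_lt t B -> far (z t).
Proof.
  intros Hs. assert (Hs' := Hs). destruct Hs' as [[S1 S2] [S3 S4]].
  destruct (maximal_trajectory g G g' P P_open G_hol g_hol z0) as [z [A [B [HT [HA [HB Hz]]]]]].
  { now apply U_regular. }
  { rewrite g_eq by auto. apply Cmult_neq_0; auto. }
  assert (Hst : forall t, 0 <= t -> Rbar_lt t B ->
    far (z t) /\ t * (Cmod (L' z0) * Cmod (L' z0) * Re (E z0)) <= 4).
  { intros t Ht HtB.
    destruct (solves_flows g P z A B t (proj1 (proj2 HT)) HA HB) as [a [b [h1 [h2 h3]]]]; auto.
    { apply Rbar_lt_le_trans with 0; auto. }
    rewrite <- Hz. apply (start_stays_far z a b t); auto; try lra. now rewrite Hz. }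
  set (k := Cmod (L' z0) * Cmod (L' z0) * Re (E z0)) in *.
  assert (Hk : 0 < k).
  { unfold k. assert (Q := proj1 (Cmod_gt_0 _) (L'_neq z0 S1)). repeat apply Rmult_lt_0_compat; auto. }
  assert (HBf : exists beta : R, B = beta).
  { destruct B as [beta| |]; [now exists beta| |simpl in HB; tauto].
    (* Every time [t] reached satisfies [t * k <= 4], which fails at [5 / k]. *)
    exfalso. destruct (Hst (5 / k)) as [_ Q].
    - apply Rlt_le, Rdiv_lt_0_compat; lra.
    - exact I.
    - replace (5 / k * k) with 5 in Q by (field; lra). lra. }
  destruct HBf as [beta ->].
  exists z, A, beta. split; [auto|]. split.
  - apply (trajectory_escapes g G g' P P_open G_hol g_hol z A beta 0 far); auto.
    + intros t Ht. apply Hst; simpl; lra.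
    + intros p [Up _]. split; [now apply U_regular|]. rewrite g_eq by auto. apply Cmult_neq_0; auto.
  - repeat split; auto; now apply Hst.
Qed.

(** One point strictly inside the cone has a whole disc of starting points around it, and [G] maps
    that disc onto a neighbourhood of its value. Starting points are picked there on a vertical
    segment, so that their orbits differ in the invariant [Im G]. *)
Lemma escaping_family (phi phi' : C -> C) (m : R) : m <= u1 ->
  hol (halfplane m) phi phi' -> (forall v, halfplane m v -> U (phi v) /\ L (phi v) = v) ->
  exists (Z : R -> R -> C) (A B : R -> Rbar),
    (forall Y : R, trajectory g P (Z Y) (A Y) (B Y) /\ escapes_finite_time (Z Y) (A Y) (B Y) /\
       exists t0 : R, Rbar_lt (A Y) t0 /\ Rbar_lt t0 (B Y) /\
         forall t : R, t0 <= t -> Rbar_lt t (B Y) -> far (Z Y t)) /\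
    (forall Y1 Y2 : R, Y1 <> Y2 -> forall t1 t2 : R,
       Rbar_lt (A Y1) t1 -> Rbar_lt t1 (B Y1) -> Rbar_lt (A Y2) t2 -> Rbar_lt t2 (B Y2) ->
       Z Y1 t1 <> Z Y2 t2).
Proof.
  intros Hm Hphi HphiU.
  assert (Hinv : forall v, halfplane m v -> (phi' v * L' (phi v))%C = 1%C)
    by (intros v Hv; eapply inverse_derive; eauto).
  assert (Hsub : forall v, halfplane u1 v -> halfplane m v) by (intros v; unfold halfplane; lra).
  (* The correction of the argument of [E] is purely vertical, so the real part [u2 + 1] and thus
     [Re L > u2] survive it. *)
  set (v := (u2 + 1, 0)%R : C).
  assert (Hv : halfplane u1 v) by (unfold halfplane, v; simpl; lra).
  destruct (almost_exponential_positive (fun w => E (phi w)) (fun w => (phi' w * E' (phi w))%C) u1 v)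
    as [v1 [V1 [V2 V3]]]; auto.
  { intros w Hw. destruct (HphiU w (Hsub w Hw)) as [h1 h2]. destruct (Hphi w (Hsub w Hw)) as [h3 h4].
    destruct (E_hol _ h1) as [h5 h6]. split; [now apply cdiff_comp|].
    apply (ccont_mult phi' (fun w => E' (phi w))); [exact h4|].
    apply (ccont_comp E' phi); [exact h6|eapply cdiff_cont, h3]. }
  { intros w Hw. destruct (HphiU w (Hsub w Hw)) as [h1 h2].
    assert (N := L'_neq _ h1). assert (I := Hinv w (Hsub w Hw)).
    assert (Q := E'_near (phi w) h1). rewrite h2 in Q. specialize (Q Hw).
    replace (E' (phi w) - E (phi w) * L' (phi w))%C
      with (L' (phi w) * (phi' w * E' (phi w) - E (phi w)))%C in Q.
    - rewrite !Cmod_mult in Q. assert (PN := proj1 (Cmod_gt_0 _) N).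
      apply Rmult_le_reg_l with (Cmod (L' (phi w))); auto. lra.
    - transitivity ((phi' w * L' (phi w)) * E' (phi w) - E (phi w) * L' (phi w))%C; [ring|rewrite I; ring]. }
  { apply E_neq, HphiU, Hsub, Hv. }
  assert (Hv1 : halfplane m v1) by (unfold halfplane in *; rewrite V1; unfold v; simpl; lra).
  destruct (HphiU v1 Hv1) as [Uz Lz]. set (z1 := phi v1) in *.
  assert (Far1 : u2 < Re (L z1)) by (rewrite Lz, V1; unfold v; simpl; lra).
  apply Rabs_def2 in V3.
  assert (Ec : ccont E z1) by now apply (hol_ccont _ _ _ _ E_hol).
  assert (gz1 : g z1 <> 0%C) by (rewrite g_eq by auto; apply Cmult_neq_0; auto).
  assert (N1 := near_and _ _ _ (U_open z1 Uz) (derive_near _ G g z1 P_open G_hol (U_regular _ Uz) gz1)).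
  assert (N2 := near_and _ _ _ (ccont_re_lower L z1 u2 (hol_ccont _ _ _ _ L_hol Uz) Far1)
    (ccont_re_lower E z1 0 Ec V2)).
  (* [Re ((1 / 2 + Ci) * E)] is [Re E / 2 - Im E]: each side of the cone becomes the positivity of a
     real part, an open condition. *)
  assert (N3 : near z1 (fun z => 0 < Re ((RtoC (/ 2) + Ci) * E z))).
  { apply (ccont_re_lower (fun z => (RtoC (/ 2) + Ci) * E z)%C); [apply ccont_mult; auto; apply ccont_const|].
    rewrite Cmult_plus_distr_r, re_plus, re_scal_l, (Cmult_comm Ci), re_mult_Ci. lra. }
  assert (N4 : near z1 (fun z => 0 < Re ((RtoC (/ 2) - Ci) * E z))).
  { apply (ccont_re_lower (fun z => (RtoC (/ 2) - Ci) * E z)%C); [apply ccont_mult; auto; apply ccont_const|].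
    replace ((RtoC (/ 2) - Ci) * E z1)%C with (RtoC (/ 2) * E z1 + - (E z1 * Ci))%C by ring.
    rewrite re_plus, re_scal_l, re_opp, re_mult_Ci. lra. }
  destruct (near_and _ _ _ (near_and _ _ _ N1 N2) (near_and _ _ _ N3 N4)) as [r [Hr Hnear]].
  assert (Hstart : forall z, cdisc z1 r z -> start z).
  { intros z Hz. destruct (Hnear z Hz) as [[[B1 _] [B2 B3]] [B4 B5]].
    rewrite Cmult_plus_distr_r, re_plus, re_scal_l, (Cmult_comm Ci), re_mult_Ci in B4.
    replace ((RtoC (/ 2) - Ci) * E z)%C with (RtoC (/ 2) * E z + - (E z * Ci))%C in B5 by ring.
    rewrite re_plus, re_scal_l, re_opp, re_mult_Ci in B5.
    split; [split; [auto|lra]|]. split; auto. apply Rabs_le. lra. }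
  destruct (local_inverse G g z1 (g z1) r) as [psi [_ Q]]; auto.
  { intros z Hz. apply G_hol, (proj2 (proj1 (proj1 (Hnear z Hz)))). }
  { intros z Hz. apply (proj2 (proj1 (proj1 (Hnear z Hz)))). }
  set (s := r * (Cmod (g z1) / 2)) in *.
  assert (Hs : 0 < s).
  { assert (X := proj1 (Cmod_gt_0 _) gz1). apply Rmult_lt_0_compat; lra. }
  (* [atan] squeezes the real line into a bounded interval; as [|atan Y| <= 2], the point stays
     within [s / 2] of [G z1]. *)
  set (pt := fun Y : R => (G z1 + RtoC (s / 4 * atan Y) * Ci)%C).
  assert (Hpt : forall Y, cdisc (G z1) s (pt Y)).
  { intros Y. unfold cdisc, pt. replace (G z1 + RtoC (s / 4 * atan Y) * Ci - G z1)%C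
      with (RtoC (s / 4 * atan Y) * Ci)%C by ring.
    rewrite Cmod_mult, Cmod_R, Cmod_Ci, Rmult_1_r, Rabs_mult, (Rabs_pos_eq (s / 4)) by lra.
    assert (T := atan_bound Y). assert (T2 := PI_4).
    assert (Rabs (atan Y) <= 2) by (apply Rabs_le; lra).
    assert (s / 4 * Rabs (atan Y) <= s / 4 * 2) by (apply Rmult_le_compat_l; lra). lra. }
  assert (Hex : forall Y, exists X : (R -> C) * Rbar * Rbar, let '(z, A, B) := X in
    trajectory g P z A B /\ escapes_finite_time z A B /\ Rbar_lt A 0 /\ Rbar_lt 0 B /\ z 0 = psi (pt Y) /\
    forall t, 0 <= t -> Rbar_lt t B -> far (z t)).
  { intros Y. destruct (escaping_trajectory (psi (pt Y))) as [z [A [B H]]].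
    - apply Hstart, Q, Hpt.
    - exists (z, A, B). exact H. }
  set (X := fun Y => proj1_sig (constructive_indefinite_description _ (Hex Y))).
  assert (HX : forall Y, let '(z, A, B) := X Y in
    trajectory g P z A B /\ escapes_finite_time z A B /\ Rbar_lt A 0 /\ Rbar_lt 0 B /\ z 0 = psi (pt Y) /\
    forall t, 0 <= t -> Rbar_lt t B -> far (z t)).
  { intros Y. unfold X. destruct (constructive_indefinite_description _ (Hex Y)). auto. }
  exists (fun Y => fst (fst (X Y))), (fun Y => snd (fst (X Y))), (fun Y => snd (X Y)).
  assert (HIm : forall Y (t : R), Rbar_lt (snd (fst (X Y))) t -> Rbar_lt t (snd (X Y)) ->
    Im (G (fst (fst (X Y)) t)) = Im (G z1) + s / 4 * atan Y).
  { intros Y t. specialize (HX Y). destruct (X Y) as [[z A] B]. simpl. intros HA HB.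
    destruct HX as [HT [_ [A0 [B0 [Hz _]]]]].
    destruct (solves_flows g P z A B t (proj1 (proj2 HT)) A0 B0 HA HB) as [a [b [h1 [h2 h3]]]].
    rewrite (flow_Im_const g G P G_hol z a b t 0 h3 h2 h1), Hz.
    destruct (Q _ (Hpt Y)) as [_ [-> _]]. unfold pt. rewrite im_plus, im_scal_l. simpl. ring. }
  split.
  - intros Y. specialize (HX Y). destruct (X Y) as [[z A] B]. simpl.
    destruct HX as [HT [HE [A0 [B0 [_ HF]]]]]. split; [auto|]. split; [auto|]. exists 0. auto.
  - intros Y1 Y2 HY t1 t2 a1 b1 a2 b2 Heq. apply HY.
    assert (h1 := HIm Y1 t1 a1 b1). assert (h2 := HIm Y2 t2 a2 b2). rewrite Heq in h1.
    assert (Hat : atan Y1 = atan Y2).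
    { apply Rmult_eq_reg_l with (s / 4); lra. }
    rewrite <- (tan_atan Y1), <- (tan_atan Y2). now rewrite Hat.
Qed.
End Escape.

(** * Logarithmic singularities and the theorem *)

Lemma logarithm_hol (U : C -> Prop) (h h' L : C -> C) : hol U h h' ->
  (forall z, U z -> ex_C_deriv L z) -> (forall z, U z -> cexp (L z) = h z) -> Defs.open_set U ->
  hol U L (fun z => h' z * / h z)%C.
Proof.
  intros Hh HL He HU z Hz. destruct (Hh z Hz) as [D c].
  assert (Nz : h z <> 0%C) by (rewrite <- He by auto; apply cexp_neq_0). split.
  - destruct (HL z Hz) as [l Hl]. apply is_C_deriv_cdiff in Hl.
    (* Only existence of a derivative [l] of the branch is given; differentiating [cexp (L z) = h z]
       identifies it as [h' / h], whose continuity is then visible. *)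
    assert (El : (l * h z)%C = h' z).
    { apply (cdiff_unique h z); auto. destruct (HU z Hz) as [r [Hr B]].
      apply cdiff_ext_loc with (fun w => cexp (L w)) r; auto.
      rewrite <- He by auto. apply (cdiff_comp cexp L); auto. apply cexp_cdiff. }
    replace (h' z * / h z)%C with l; auto. rewrite <- El. field. auto.
  - apply ccont_mult; auto. apply ccont_inv; auto. eapply cdiff_cont, D.
Qed.

(** Where [|h p| < exp c], continuity excludes far points nearby. Elsewhere [p] is in the superlevel
    set but not in [U], and a disc about [p] in that set cannot meet [U], which would absorb it. *)
Lemma superlevel_far_closed (h : C -> C) (P : C -> Prop) (M c : R) (U : C -> Prop) (L : C -> C) :
  meromorphic h P -> component_of U (fun z => P z \/ M < Cmod (h z)) -> (forall z, U z -> ~ P z) ->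
  (forall z, U z -> cexp (L z) = h z) -> M < exp c ->
  forall p, ~ far U L c p -> exists d, 0 < d /\ forall w, Cmod (w - p) < d -> ~ far U L c w.
Proof.
  intros Hm HU HUP He HM p Hp.
  assert (Habs : P p \/ M < Cmod (h p) -> ~ U p ->
    exists d, 0 < d /\ forall w, Cmod (w - p) < d -> ~ far U L c w).
  { intros HS HN. destruct (meromorphic_superlevel_open h P M Hm p HS) as [r [Hr B]].
    exists r. split; auto. intros w Hw [Uw _]. apply HN.
    apply (component_absorbs_disc U _ p r HU B); [now exists w|now apply cdisc_center]. }
  assert (Hmod : forall z, U z -> Cmod (h z) = exp (Re (L z))).
  { intros z Hz. rewrite <- He by auto. apply Cmod_cexp. }
  destruct (classic (P p)) as [Pp|Pp]; [apply Habs; auto; intro; now apply (HUP p)|].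
  destruct (Rlt_le_dec (Cmod (h p)) (exp c)) as [Q|Q].
  - destruct (meromorphic_ccont h P p Hm Pp (exp c - Cmod (h p))) as [d [Hd B]]; [lra|].
    exists d. split; auto. intros w Hw [Uw Lw]. specialize (B w Hw).
    assert (T := Cmod_triangle_rev (h w) (h p)). rewrite (Hmod w Uw) in T.
    assert (exp c <= exp (Re (L w))); [|lra].
    destruct Lw as [Lw|Lw]; [left; now apply exp_increasing|right; now rewrite Lw].
  - apply Habs; [right; lra|]. intros Up. apply Hp. split; auto.
    rewrite (Hmod p Up) in Q. apply Rnot_lt_le. intro N. apply exp_increasing in N. lra.
Qed.

Theorem theorem1p5 :
  forall (g G : C -> C) (Pg PG : C -> Prop),
    transcendental_meromorphic g Pg ->
    transcendental_meromorphic G PG ->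
    (forall z : C, ~ PG z -> is_C_deriv G z (g z)) ->
    forall (h : C -> C) (Ph : C -> Prop),
      ((h = G /\ Ph = PG) \/ (h = g /\ Ph = Pg)) ->
      forall (M : R) (U : C -> Prop), log_sing_infty h Ph M U ->
      forall M' : R, M <= M' ->
        exists (Z : R -> R -> C) (A B : R -> Rbar),
          (forall Y : R,
             trajectory g Pg (Z Y) (A Y) (B Y) /\
             escapes_finite_time (Z Y) (A Y) (B Y) /\
             (exists t0 : R, Rbar_lt (A Y) t0 /\ Rbar_lt t0 (B Y) /\
                forall t : R, t0 <= t -> Rbar_lt t (B Y) ->
                  sing_nbhd h U M' (Z Y t))) /\
          (forall Y1 Y2 : R, Y1 <> Y2 ->
             forall t1 t2 : R,
               Rbar_lt (A Y1) t1 -> Rbar_lt t1 (B Y1) ->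
               Rbar_lt (A Y2) t2 -> Rbar_lt t2 (B Y2) ->
               Z Y1 t1 <> Z Y2 t2).
Proof.
  intros g G Pg PG [Hg _] [HG _] HGg h Ph Hh M U [HM [Hcomp [HUP [L [HL1 [HL2 [HL3 [HL4 HL5]]]]]]]] M' HMM'.
  assert (Pg_open := meromorphic_regular_open g Pg Hg).
  assert (G_hol := primitive_hol g G Pg PG Hg HG HGg).
  destruct (regularity _ G g Pg_open G_hol) as [g' g_hol].
  assert (Hmero : meromorphic h Ph) by (destruct Hh as [[-> ->]|[-> ->]]; auto).
  (* In the case [h = G] the singularity excludes poles of [G] only; [pole_of_derivative] carries
     this over to [g]. *)
  assert (HUg : forall z, U z -> ~ Pg z).
  { intros z Hz HP. apply (HUP z Hz). destruct Hh as [[_ ->]|[_ ->]]; auto.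
    now apply (pole_of_derivative g G Pg PG). }
  assert (HUopen : Defs.open_set U).
  { intros z Hz.
    destruct (meromorphic_superlevel_open h Ph M Hmero z (proj1 (proj2 Hcomp) z Hz)) as [r [Hr B]].
    exists r. split; auto. apply (component_absorbs_disc U _ z r Hcomp B).
    exists z. split; auto. now apply cdisc_center. }
  assert (Hh' : exists h', hol U h h' /\ ((h = G /\ h' = g) \/ h = g)).
  { destruct Hh as [[-> _]|[-> _]].
    - exists g. split; auto. now apply (hol_subset (fun z => ~ Pg z)).
    - exists g'. split; auto. now apply (hol_subset (fun z => ~ Pg z)). }
  destruct Hh' as [h' [h_hol Hcase]].
  assert (h_neq : forall z, U z -> h z <> 0%C) by (intros z Hz; rewrite <- HL2 by auto; apply cexp_neq_0).
  assert (L_hol := logarithm_hol U h h' L h_hol HL1 HL2 HUopen).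
  set (L' := fun z => (h' z * / h z)%C) in *.
  assert (h'_eq : forall z, U z -> h' z = (L' z * h z)%C) by (intros z Hz; unfold L'; field; auto).
  destruct (regularity U L L' HUopen L_hol) as [L'' L'_hol].
  assert (L'_neq := injective_derive_neq U L L' HUopen L_hol HL3).
  destruct (inverse_hol U L L' (ln M) HUopen L_hol HL3 HL4 HL5) as [phi [phi' [phi_hol [phi_U L_H]]]].
  assert (Dpos : 0 < distortion).
  { unfold distortion. apply Rmult_lt_0_compat; [lra|apply exp_pos]. }
  (* To the right of [u1] the distortion bound reads [|L''| <= |L'|^2 / 32]. Taking [u2] above
     [ln M'] puts the far set into the given neighbourhood. *)
  set (u1 := ln M + 32 * distortion). set (u2 := Rmax u1 (ln M') + 1).
  assert (U1 := Rmax_l u1 (ln M')). assert (U2 := Rmax_r u1 (ln M')).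
  assert (L''_small : forall z, U z -> u1 < Re (L z) -> Cmod (L'' z) <= / 32 * (Cmod (L' z) * Cmod (L' z))).
  { intros z Hz Hu.
    assert (Q := inverse_distortion U L L' phi phi' (ln M) HUopen L_hol phi_hol phi_U L_H L'' z L'_hol Hz).
    unfold u1 in Hu. assert (P := Cmod_ge_0 (L'' z)).
    assert (Cmod (L'' z) * (32 * distortion) <= Cmod (L'' z) * (Re (L z) - ln M))
      by (apply Rmult_le_compat_l; lra).
    apply Rmult_le_reg_l with (32 * distortion); lra. }
  assert (HE : exists E E', hol U E E' /\ (forall z, U z -> E z <> 0%C) /\
    (forall z, U z -> g z = (L' z * E z)%C) /\
    (forall z, U z -> u1 < Re (L z) -> Cmod (E' z - E z * L' z) <= / 32 * Cmod (E z * L' z))).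
  { destruct Hcase as [[e1 e2]|e1].
    - exists h, h'. split; [auto|]. split; [auto|]. split.
      + intros z Hz. rewrite <- h'_eq, e2; auto.
      + intros z Hz _. rewrite h'_eq by auto. replace (L' z * h z - h z * L' z)%C with (RtoC 0) by ring.
        rewrite Cmod_0. apply Rmult_le_pos; [lra|apply Cmod_ge_0].
    (* Here [E = h / L'], and [E' - E * L' = - h * L'' / L'^2]. Relative to [E * L' = h] the error
       is [|L''| / |L'|^2], so the factor [1 / 32] carries over unchanged. *)
    - assert (H1 := hol_mult U h h' _ _ h_hol (hol_inv U L' L'' L'_neq L'_hol)). cbv beta in H1.
      eexists. eexists. split; [exact H1|]. split; [|split].
      + intros z Hz. cbv beta. apply Cmult_neq_0; auto. intros e. assert (X := Cinv_r _ (L'_neq z Hz)).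
        rewrite e in X. apply (f_equal Re) in X. revert X. rewrite re_mult. simpl. lra.
      + intros z Hz. cbv beta. rewrite e1. field. auto.
      + intros z Hz Hu. cbv beta. rewrite h'_eq by auto. assert (N := L'_neq z Hz).
        replace (L' z * h z * / L' z + h z * - (L'' z * (/ L' z * / L' z)) - h z * / L' z * L' z)%C
          with (- (h z * (L'' z * / (L' z * L' z))))%C by (field; auto).
        replace (h z * / L' z * L' z)%C with (h z) by (field; auto).
        rewrite Cmod_opp, !Cmod_mult, Cmod_inv, Cmod_mult by now apply Cmult_neq_0.
        rewrite (Rmult_comm (/ 32)). apply Rmult_le_compat_l; [apply Cmod_ge_0|].
        apply Cmod_gt_0 in N. apply Rle_div_l; [now apply Rmult_lt_0_compat|now apply L''_small]. }
  destruct HE as [E [E' [E_hol [E_neq [g_eq E'_near]]]]].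
  assert (Hu2 : M' < exp u2).
  { rewrite <- (exp_ln M') by lra. apply exp_increasing. unfold u2. lra. }
  destruct (escaping_family g G g' Pg U L L' L'' E E' u1 u2) with (phi := phi) (phi' := phi') (m := ln M)
    as [Z [A [B [H1 H2]]]]; auto.
  - intros z Hz Hu. eapply Rle_trans; [now apply L''_small|].
    apply Rmult_le_compat_r; [apply Rmult_le_pos; apply Cmod_ge_0|lra].
  - unfold u2. lra.
  - apply (superlevel_far_closed h Ph M u2 U L); auto. lra.
  - unfold u1. lra.
  - exists Z, A, B. split; auto. intros Y. destruct (H1 Y) as [T1 [T2 [t0 [T3 [T4 T5]]]]].
    split; [auto|]. split; [auto|]. exists t0. split; [auto|]. split; [auto|].
    intros t Ht HtB. destruct (T5 t Ht HtB) as [F1 F2]. split; auto.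
    rewrite <- HL2, Cmod_cexp by auto. eapply Rlt_le_trans; [apply Hu2|].
    destruct F2 as [F2|F2]; [left; now apply exp_increasing|right; now rewrite F2].
Qed.
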